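(* Let $p,q>1$ and let $\alpha,\beta,s$ be real. (1) If $\alpha<2$, $\beta<1$, $0\le s\le1$, then $$\int_0^1\frac{\arcsin_{p,q}(sx)}{x^\alpha(1-x^q)^\beta}\,dx=\frac sq\,B\!\left(\tfrac{2-\alpha}{q},1-\beta\right){}_3F_2\!\left(\tfrac1p,\tfrac{2-\alpha}{q},\tfrac1q;\;\tfrac{2-\alpha}{q}+1-\beta,\tfrac1q+1;\;s^q\right).$$ (2) If $\alpha<1$, $\beta<1$, $0\le s\le1$, then $$\int_0^1\frac{\arccos_{p,q}(sx)}{x^\alpha(1-x^p)^\beta}\,dx=\frac1{pq}B\!\left(\tfrac{p-1}{p},\tfrac1q\right)B\!\left(\tfrac{1-\alpha}{p},1-\beta\right)-\frac{s^{p-1}}{q(p-1)}B\!\left(1-\tfrac\alpha p,1-\beta\right){}_3F_2\!\left(1-\tfrac1q,1-\tfrac\alpha p,\tfrac{p-1}{p};\;2-\tfrac\alpha p-\beta,\tfrac{2p-1}{p};\;s^p\right).$$ (3) If $q\alpha>-1$, $q(\alpha-\beta)-\min(1,q/p)<-1$, $0\le s\le1$, then $$\int_0^\infty\frac{\operatorname{arcsinh}_{p,q}(sx)}{x^{1-\alpha q}(1+x^q)^\beta}\,dx=\frac sq\,B\!\left(\alpha+\tfrac1q,\beta-\alpha-\tfrac1q\right){}_3F_2\!\left(\tfrac1p,\alpha+\tfrac1q,\tfrac1q;\;\alpha-\beta+\tfrac1q+1,\tfrac1q+1;\;s^q\right)$$ $$\qquad+\frac{s^{q(\beta-\alpha)}}{q^2(\beta-\alpha)}B\!\left(\alpha-\beta+\tfrac1q,\beta-\alpha+\tfrac1p-\tfrac1q\right){}_3F_2\!\left(\beta,\beta-\alpha+\tfrac1p-\tfrac1q,\beta-\alpha;\;\beta-\alpha-\tfrac1q+1,\beta-\alpha+1;\;s^q\right).$$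 (4) If $p<q$, $s\ge1$, $\beta<1$ and $(\alpha+\beta)p>1$, then $$\int_1^\infty\frac{\operatorname{arccosh}_{p,q}(sx)}{x^{\alpha p}(x^p-1)^\beta}\,dx=\frac1{pq}B\!\left(\tfrac1p-\tfrac1q,\tfrac1q\right)B\!\left(1-\beta,\beta+\alpha-\tfrac1p\right)$$ $$\qquad+\frac{s^{p/q-1}}{p-q}B\!\left(\beta+\alpha-\tfrac1q,1-\beta\right){}_3F_2\!\left(1-\tfrac1q,\beta+\alpha-\tfrac1q,\tfrac1p-\tfrac1q;\;\alpha+1-\tfrac1q,\tfrac1p-\tfrac1q+1;\;s^{-p}\right).$$
   Context: ${}_3F_2(a_1,a_2,a_3;b_1,b_2;z)=\sum_{k\ge0}\frac{(a_1)_k(a_2)_k(a_3)_k}{(b_1)_k(b_2)_k}\frac{z^k}{k!}$ is the generalized hypergeometric function, where $(a)_k=a(a+1)\cdots(a+k-1)$, $(a)_0=1$. $B(a,b)=\Gamma(a)\Gamma(b)/\Gamma(a+b)$ is Euler's beta function, given by this Gamma-function formula also when an argument is negative. For $p,q>1$: $\arcsin_{p,q}(x)=\int_0^x(1-t^q)^{-1/p}\,dt$ for $0\le x\le1$; $\arccos_{p,q}(x)=\arcsin_{p,q}\big((1-x^p)^{1/q}\big)=\frac pq\int_x^1(1-u^p)^{1/q-1}u^{p-2}\,du$ for $0\le x\le1$; $\operatorname{arcsinh}_{p,q}(x)=\int_0^x(1+t^q)^{-1/p}\,dt$ for $x\ge0$; $\operatorname{arccosh}_{p,q}(x)=\operatorname{arcsinh}_{p,q}\big((x^p-1)^{1/q}\big)=\frac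 pq\int_1^x(u^p-1)^{1/q-1}u^{p-2}\,du$ for $x\ge1$.
   Formalization: In (3) it is also assumed that β−α−1/q is not a non-negative integer (else B(α−β+1/q,·) has a Gamma pole) and that s<1 or β+1/p<2 (else the first ₃F₂ series diverges at argument 1); in the excluded cases the right-hand side is undefined. *)

(* Defs.v *)
From mathcomp Require Import all_boot all_order all_algebra.
From mathcomp Require Import all_classical all_reals all_analysis.
Set Implicit Arguments.
Unset Strict Implicit.
Unset Printing Implicit Defensive.
Import Order.TTheory GRing.Theory Num.Theory.
Import numFieldNormedType.Exports.
Local Open Scope classical_set_scope.
Local Open Scope ring_scope.

Definition pochhammer (R : realType) (a : R) (k : nat) : R :=
  \prod_(0 <= i < k) (a + i%:R).

Definition euler_Gamma (R : realType) (x : R) : R :=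
  \int[lebesgue_measure]_(t in `]0, +oo[) (t `^ (x - 1) * expR (- t)).

(* For x <= 0, Gamma is extended by Gamma x = Gamma (x + n) / (x)_n, with n the
   least natural number such that 0 < x + n.  At the poles x = 0, -1, -2, ...
   one has (x)_n = 0, so that Gamma x = 0 and (Gamma x)^-1 = 0; the latter is the
   value there of the entire function 1 / Gamma. *)
Definition Gamma (R : realType) (x : R) : R :=
  if 0 < x then euler_Gamma x
  else let n := (Num.truncn (- x)).+1 in
       euler_Gamma (x + n%:R) / pochhammer x n.

Definition Beta (R : realType) (a b : R) : R :=
  Gamma a * Gamma b / Gamma (a + b).

(* Meaningful only if neither b1 nor b2 is a non-positive integer and the series
   converges. *)
Definition hyp3F2 (R : realType) (a1 a2 a3 b1 b2 z : R) : R :=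
  limn (series (fun k : nat =>
    pochhammer a1 k * pochhammer a2 k * pochhammer a3 k /
    (pochhammer b1 k * pochhammer b2 k) * (z ^+ k / k`!%:R))).

Definition arcsin_pq (R : realType) (p q x : R) : R :=
  \int[lebesgue_measure]_(t in `[0, x]) (1 - t `^ q) `^ (- p^-1).

Definition arccos_pq (R : realType) (p q x : R) : R :=
  arcsin_pq p q ((1 - x `^ p) `^ q^-1).

Definition arcsinh_pq (R : realType) (p q x : R) : R :=
  \int[lebesgue_measure]_(t in `[0, x]) (1 + t `^ q) `^ (- p^-1).

Definition arccosh_pq (R : realType) (p q x : R) : R :=
  arcsinh_pq p q ((x `^ p - 1) `^ q^-1).

(* Main.v *)
Require Import Defs.
From mathcomp Require Import all_boot all_order all_algebra.
From mathcomp Require Import all_classical all_reals all_analysis.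
From mathcomp Require Import measurable_realfun ring lra.
Import Order.TTheory GRing.Theory Num.Theory.
Import numFieldNormedType.Exports.
Local Open Scope classical_set_scope.
Local Open Scope ring_scope.

(** The four integrals are evaluated by opening the integral that defines the arc
    function and integrating the weight first.

    For [arcsin], the binomial series of [(1 - t ^ q) ^ (- 1 / p)] integrates term
    by term to a series of powers of [s * x] with positive coefficients
    ([arcsin_pq_series]). Sum and integral may therefore be exchanged, the weighted
    integral of each power is a complete beta integral, and the values
    [Beta (A + k) B / (k + d)] add up to a [3F2] because they are proportional to
    ratios of Pochhammer symbols ([beta_transform_itv01], [hyp3F2_Beta_sum]).
    [arccos] and [arccosh] are obtained in the same way by passing to complements:
    each of them is a complete beta integral minus a tail that has such a series,
    in powers of [y ^ p] at 0 for [arccos y] and in powers of [y ^ (- p)] at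
    infinity for [arccosh y] ([arccos_pq_series], [arccosh_pq_series]). The
    constant gives the product of two beta values, the tail the [3F2].

    For [arcsinh] the integral runs over the whole half-line, on which no single
    power series of [arcsinh] converges. Writing [arcsinh (s * x)] as the integral of
    [x * (1 + (x * t) ^ q) ^ (- 1 / p)] over [t] between 0 and [s] and exchanging
    the integrals leads, with [y = x ^ q], to Euler's integral
    [E w = \int_0^oo y ^ (a - 1) (1 + y) ^ (- a - c) (1 + w y) ^ (- b) dy] at
    [w = t ^ q], for [a = alpha + 1 / q], [c = beta - alpha - 1 / q] and [b = 1 / p]
    ([integral_arcsinh_pq_tonelli]). The function [E] solves a hypergeometric
    equation whose exponents at 0 are [0] and [c], hence is a combination of two
    [2F1] ([connection_formula]):
    [E w = B(a, c) F(b, a; 1 - c; w) + w ^ c B(- c, c + b) F(a + c, c + b; 1 + c; w)].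
    When [0 < c < 1] the difference of the two sides is a solution which is too
    small at 0 to be nonzero, by a Wronskian argument ([hyp_ode_unique]); the
    coefficients come from limits of [E] and of its derivative at 0. Differentiating
    the identity for [c] gives the identity for [c - 1], which yields the larger
    values of [c] by induction, and inverting [y] gives the values [-1 < c < 0].
    Integrating [t ^ (q d - 1) F(t ^ q)] from 0 to [s] turns each [2F1] into a [3F2]
    with the additional parameters [d] and [d + 1]
    ([is_derive_powR_hyp3F2]), where [d = 1 / q] for the first term and
    [d = c + 1 / q = beta - alpha] for the second; these are the two terms of the
    formula. At [s = 1] the passage to the limit is Abel's theorem. *)

Set Implicit Arguments.
Unset Strict Implicit.
Unset Printing Implicit Defensive.

(** * Improper integrals as limits over compact intervals *)

(** Compact intervals inside [I], on which the integrands below are regular even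
    when they are singular at the ends of [I]; the integrals over [I] are limits
    along them. *)
Definition exhausts {R : realType} (I : set R) (u v : nat -> R) :=
  [/\ {homo u : n m / (n <= m)%N >-> m <= n},
      {homo v : n m / (n <= m)%N >-> n <= m},
      forall n, u n < v n,
      forall n x, u n <= x <= v n -> I x
    & forall x, I x -> exists n, u n <= x <= v n].

(** [is_derive] as a plain proposition: as a class it would make rewriting with
    a quantified differentiability hypothesis start a search for an instance. *)
Definition has_derivative {R : realType} (f : R -> R) (x d : R) : Prop :=
  is_derive x 1 f d.

Section exhaustion.
Context {R : realType}.
Notation mu := (@lebesgue_measure R).
Implicit Types (I J : set R) (u v : nat -> R).

Lemma exhausts_bigcup I u v : exhausts I u v -> \bigcup_n [set` `[u n, v n]] = I.
Proof.
move=> [_ _ _ sI Iex]; apply/seteqP; split => [x [n _]/=|x /Iex[n xn]].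
  by rewrite in_itv/= => /sI.
by exists n => //=; rewrite in_itv.
Qed.

Lemma exhausts_nondecreasing I u v :
  exhausts I u v -> nondecreasing_seq (fun n => [set` `[u n, v n]]).
Proof.
move=> [hu hv _ _ _] n m nm; rewrite subsetEset => x /=; rewrite !in_itv/=.
move=> /andP[ux xv]; apply/andP; split.
  exact: le_trans (hu _ _ nm) ux.
exact: le_trans xv (hv _ _ nm).
Qed.

Lemma exhausts_measurable I u v : exhausts I u v -> measurable I.
Proof.
by move=> /exhausts_bigcup <-; apply: bigcup_measurable => n _; exact: measurable_itv.
Qed.

Lemma exhausts_sub I u v n : exhausts I u v -> [set` `[u n, v n]] `<=` I.
Proof. by move=> [_ _ _ sI _] x /=; rewrite in_itv/= => /sI. Qed.

Let cvg_div_S (x : R) : x / n.+3%:R @[n --> \oo] --> 0.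
Proof.
rewrite -(mulr0 x); apply: cvgM; first exact: cvg_cst.
rewrite (cvg_shiftS (fun n => (n.+2%:R : R)^-1)) (cvg_shiftS (fun n => (n.+1%:R : R)^-1)).
exact: cvg_harmonic.
Qed.

Let div_S_le (x : R) n m : 0 < x -> (n <= m)%N -> x / m.+3%:R <= x / n.+3%:R.
Proof. by move=> x0 nm; rewrite ler_pM2l// lef_pV2 ?posrE// ler_nat !ltnS. Qed.

Lemma exhausts_itvoo (a b : R) : a < b ->
  exists u v, [/\ exhausts [set` `]a, b[] u v,
    forall n, a < u n, u n @[n --> \oo] --> a,
    forall n, v n < b & v n @[n --> \oo] --> b].
Proof.
move=> ab.
have ba0 : 0 < b - a by rewrite subr_gt0.
pose e n : R := (b - a) / n.+3%:R.
have e0 n : 0 < e n by rewrite divr_gt0.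
have e_lt n : e n + e n < b - a.
  rewrite -mulr2n -mulr_natr /e mulrAC ltr_pdivrMr// ltr_pM2l//.
  by rewrite ltr_nat.
exists (fun n => a + e n), (fun n => b - e n); split.
- split.
  + by move=> n m nm; rewrite lerD2l div_S_le.
  + by move=> n m nm; rewrite lerD2l lerN2 div_S_le.
  + by move=> n; have := e_lt n; lra.
  + move=> n x /andP[ax xb]; rewrite /= in_itv/=; have := e0 n.
    by move=> ?; apply/andP; split; lra.
  + move=> x /=; rewrite in_itv/= => /andP[ax xb].
    have [N _ HN] : \forall n \near \oo, e n < Num.min (x - a) (b - x).
      by apply: cvgr_lt (cvg_div_S _) _ _; rewrite lt_min !subr_gt0 ax xb.
    exists N; have := HN N (leqnn N); rewrite /= lt_min => /andP[h1 h2].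
    by apply/andP; split; lra.
- by move=> n; rewrite ltrDl.
- by rewrite -[X in _ --> X]addr0; apply: cvgD; [exact: cvg_cst|exact: cvg_div_S].
- by move=> n; rewrite ltrBlDr ltrDl.
- by rewrite -[X in _ --> X]subr0; apply: cvgB; [exact: cvg_cst|exact: cvg_div_S].
Qed.

Lemma exhausts_itvoy (a : R) :
  exists u v, [/\ exhausts [set` `]a, +oo[] u v,
    forall n, a < u n, u n @[n --> \oo] --> a &
    v n @[n --> \oo] --> +oo%R].
Proof.
pose e n : R := 1 / n.+3%:R.
exists (fun n => a + e n), (fun n => a + 1 + n%:R).
have cvgv : a + 1 + n%:R @[n --> \oo] --> +oo%R.
  by apply: cvg_comp (cvg_addrl _); exact: cvgr_idn.
have le1 n : e n < 1 :> R.
  by rewrite /e mul1r invf_lt1// ltr1n.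
have gt0 n : 0 < e n by rewrite divr_gt0.
split => //.
- split.
  + by move=> n m nm; rewrite lerD2l div_S_le.
  + by move=> n m nm; rewrite lerD2l ler_nat.
  + by move=> n; have := le1 n; have : 0 <= n%:R :> R by []; lra.
  + by move=> n x /andP[ax xb]; rewrite /= in_itv/= andbT; have := gt0 n; lra.
  + move=> x /=; rewrite in_itv/= andbT => ax.
    have [N1 _ H1] : \forall n \near \oo, e n < x - a.
      by apply: cvgr_lt (cvg_div_S _) _ _; rewrite subr_gt0.
    have [N2 _ H2] : \forall n \near \oo, x <= a + 1 + n%:R.
      by move/cvgryPge : cvgv => /(_ x).
    exists (maxn N1 N2).
    have := H1 _ (leq_maxl N1 N2); have := H2 _ (leq_maxr N1 N2) => /=.
    by move=> *; apply/andP; split; lra.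
- by move=> n; have := gt0 n; lra.
- by rewrite -[X in _ --> X]addr0; apply: cvgD; [exact: cvg_cst|exact: cvg_div_S].
Qed.

Lemma ge0_exhausts_cvg I u v (f : R -> R) : exhausts I u v ->
  measurable_fun I f -> (forall x, I x -> 0 <= f x) ->
  (\int[mu]_(x in [set` `[u n, v n]]) (f x)%:E)%E @[n --> \oo]
    --> (\int[mu]_(x in I) (f x)%:E)%E.
Proof.
move=> Iuv mf f0; rewrite -(exhausts_bigcup Iuv).
have mI := exhausts_measurable Iuv.
apply: ge0_nondecreasing_set_cvg_integral.
- exact: exhausts_nondecreasing Iuv.
- by move=> n; exact: measurable_itv.
- move=> n; apply: measurable_funS (exhausts_sub Iuv) _ => //.
  exact/measurable_EFinP.
- by move=> n x /(exhausts_sub Iuv)/f0; rewrite lee_fin.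
Qed.

Lemma integrable_exhausts_cvg I u v (f : R -> R) : exhausts I u v ->
  mu.-integrable I (EFin \o f) ->
  (\int[mu]_(x in [set` `[u n, v n]]) (f x)%:E)%E @[n --> \oo]
    --> (\int[mu]_(x in I) (f x)%:E)%E.
Proof.
move=> Iuv fi; have mI := exhausts_measurable Iuv.
have mf := measurable_int _ fi.
pose f_ n := (EFin \o f) \_ [set` `[u n, v n]].
have -> : (fun n => \int[mu]_(x in [set` `[u n, v n]]) (f x)%:E)%E =
    (fun n => \int[mu]_(x in I) f_ n x)%E.
  apply/funext => n; rewrite /f_ -integral_mkcondr.
  by rewrite (setIidr (exhausts_sub Iuv)).
have [] := @dominated_convergence _ _ _ mu I mI f_ (EFin \o f)
  (fun x => `|(f x)%:E|%E) _ _ _ _ _ => //.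
- move=> n; apply/(measurable_restrict _ (measurable_itv _) mI).
  by apply: (measurable_funS mI _ mf); exact: subIsetl.
- apply: aeW => x Ix.
  have [_ _ _ _ /(_ _ Ix)[N xN]] := Iuv.
  apply: cvg_near_cst; exists N => // n /= Nn.
  rewrite /f_ patchE mem_set//=.
  have /(_ _ _ Nn) := exhausts_nondecreasing Iuv.
  by rewrite subsetEset; apply; rewrite /= in_itv.
- by move: fi => /integrable_abse.
- apply: aeW => x n Ix; rewrite /f_ patchE; case: ifPn => //=.
  by rewrite normr0 lee_fin.
Qed.

Lemma FTC_itv (f F : R -> R) (a b : R) : a < b ->
  (forall x, a <= x <= b -> is_derive x 1 F (f x)) ->
  (forall x, a <= x <= b -> {for x, continuous f}) ->
  (\int[mu]_(x in `[a, b]) (f x)%:E = (F b - F a)%:E)%E.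
Proof.
move=> ab dF cf.
have cF x : a <= x <= b -> {for x, continuous F}.
  move=> /dF Fx; apply: differentiable_continuous.
  by apply/derivable1_diffP; exact: ex_derive.
rewrite (@continuous_FTC2 _ f F)//.
- by apply: continuous_in_subspaceT => x; rewrite inE/= in_itv/= => /cf.
- split.
  + move=> x; rewrite in_itv/= => /andP[ax xb].
    by have := dF x; rewrite !ltW// => /(_ isT) H; exact: ex_derive.
  + by apply: cvg_at_right_filter; apply: cF; rewrite lexx ltW.
  + by apply: cvg_at_left_filter; apply: cF; rewrite lexx ltW.
- move=> x; rewrite in_itv/= => /andP[ax xb].
  have := dF x; rewrite !ltW// => /(_ isT) H.
  by rewrite derive1E; exact: derive_val.
Qed.

Section improper_FTC.
Variables (I : set R) (u v : nat -> R) (f F : R -> R) (l L : R).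
Hypothesis Iuv : exhausts I u v.
Hypothesis dF : forall x, I x -> has_derivative F x (f x).
Hypothesis cf : forall x, I x -> {for x, continuous f}.
Hypothesis Fl : F (u n) @[n --> \oo] --> l.
Hypothesis FL : F (v n) @[n --> \oo] --> L.

Let FTC_cvg :
  (\int[mu]_(x in [set` `[u n, v n]]) (f x)%:E)%E @[n --> \oo] --> (L - l)%:E.
Proof.
have [_ _ uv sI _] := Iuv.
rewrite (_ : (fun _ => _) = (fun n => (F (v n) - F (u n))%:E)); last first.
  apply/funext => n; apply: FTC_itv => // x /sI; [exact: dF|exact: cf].
by apply: cvg_EFin; [exact: nearW|apply: cvgB].
Qed.

(** The antiderivative need only have limits at the ends of [I]: pass to the limit
    in [FTC_itv] along the exhaustion. *)
Lemma ge0_FTC_exhausts : measurable_fun I f -> (forall x, I x -> 0 <= f x) ->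
  (\int[mu]_(x in I) (f x)%:E = (L - l)%:E)%E.
Proof.
move=> mf f0; have := ge0_exhausts_cvg Iuv mf f0.
by move/cvg_lim => <- //; move/cvg_lim : FTC_cvg => <-.
Qed.

Lemma integrable_FTC_exhausts : mu.-integrable I (EFin \o f) ->
  (\int[mu]_(x in I) (f x)%:E = (L - l)%:E)%E.
Proof.
move=> fi; have := integrable_exhausts_cvg Iuv fi.
by move/cvg_lim => <- //; move/cvg_lim : FTC_cvg => <-.
Qed.

End improper_FTC.

End exhaustion.

(** * Monotone change of variables *)

Section change_of_variables.
Context {R : realType}.
Notation mu := (@lebesgue_measure R).

Section substitution.
Variables (I J : set R) (u v : nat -> R) (phi dphi psi G : R -> R).
Hypotheses (Iuv : exhausts I u v) (oI : open I) (iJ : is_interval J).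
Hypothesis dphiE : forall x, I x -> has_derivative phi x (dphi x).
Hypothesis cdphi : forall x, I x -> {for x, continuous dphi}.
Hypothesis phiJ : forall x, I x -> J (phi x).
Hypothesis psiI : forall y, J y -> I (psi y).
Hypothesis psiK : forall y, J y -> phi (psi y) = y.
Hypothesis cG : forall y, J y -> {for y, continuous G}.
Hypothesis G0 : forall y, J y -> 0 <= G y.

Let cphi x : I x -> {for x, continuous phi}.
Proof.
move=> /dphiE; rewrite /has_derivative => Fx; apply: differentiable_continuous.
by apply/derivable1_diffP; exact: ex_derive.
Qed.

Let phi'E x : I x -> phi^`()%classic x = dphi x.
Proof. by move=> /dphiE; rewrite /has_derivative => Fx; rewrite derive1E; exact: derive_val. Qed.

Let near_phi' x : I x -> \near x, dphi x = phi^`()%classic x.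
Proof.
move=> Ix; near=> z; apply/esym/phi'E; near: z.
exact: open_nbhs_nbhs.
Unshelve. all: by end_near. Qed.

Let cphi' x : I x -> {for x, continuous phi^`()%classic}.
Proof.
move=> Ix; rewrite /prop_for /continuous_at phi'E//.
apply: cvg_trans (cdphi Ix); apply: near_eq_cvg.
exact: near_phi'.
Qed.

Let Isub n x : u n <= x <= v n -> I x.
Proof. by have [_ _ _ sI _] := Iuv; exact: sI. Qed.

Let uv n : u n < v n.
Proof. by have [_ _ uv _ _] := Iuv; exact: uv. Qed.

Let Iu n : I (u n). Proof. by apply: (@Isub n); rewrite lexx ltW. Qed.
Let Iv n : I (v n). Proof. by apply: (@Isub n); rewrite lexx ltW. Qed.

Let phi_LR n : derivable_oo_LRcontinuous phi (u n) (v n).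
Proof.
split.
- move=> x; rewrite in_itv/= => /andP[ax xb].
  have /dphiE : I x by apply: (@Isub n); rewrite !ltW.
  rewrite /has_derivative => H.
  exact: ex_derive.
- by apply: cvg_at_right_filter; exact: cphi (Iu n).
- by apply: cvg_at_left_filter; exact: cphi (Iv n).
Qed.

Let phi'_cvg n : [/\ {in `]u n, v n[, continuous phi^`()%classic},
  cvg (phi^`()%classic x @[x --> (u n)^'+]) & cvg (phi^`()%classic x @[x --> (v n)^'-])].
Proof.
split.
- move=> x; rewrite in_itv/= => /andP[ax xb]; apply: cphi'.
  by apply: (@Isub n); rewrite !ltW.
- apply/cvg_ex; exists (phi^`()%classic (u n)).
  by apply: cvg_at_right_filter; exact: cphi' (Iu n).
- apply/cvg_ex; exists (phi^`()%classic (v n)).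
  by apply: cvg_at_left_filter; exact: cphi' (Iv n).
Qed.

Let phi_cc n : {within `[u n, v n], continuous phi}.
Proof.
apply: continuous_in_subspaceT => x; rewrite inE/= in_itv/= => xuv.
by apply: cphi; exact: Isub xuv.
Qed.

Let image_mono (x y : R) : J x -> J y -> forall z, x <= z <= y -> J z.
Proof. by move=> Jx Jy z; exact: iJ Jx Jy _. Qed.

Let subst_cvg :
  (\int[mu]_(x in `[u n, v n]) (G (phi x) * `|dphi x|)%:E)%E @[n --> \oo]
    --> (\int[mu]_(x in I) (G (phi x) * `|dphi x|)%:E)%E.
Proof.
apply: (ge0_exhausts_cvg Iuv).
- apply: open_continuous_measurable_fun => // x; rewrite inE => Ix.
  apply: cvgM; last by apply: cvg_norm; exact: cdphi.
  by apply: (@continuous_comp _ _ _ phi G); [exact: cphi|apply: cG; exact: phiJ].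
- by move=> x Ix; rewrite mulr_ge0// G0//; exact: phiJ.
Qed.

Let G_measurable : open J -> measurable_fun J G.
Proof. by move=> oJ; apply: open_continuous_measurable_fun => // y /set_mem/cG. Qed.

(** [phi] carries the exhaustion of [I] to one of [J], so that the formula on
    compact intervals passes to the limit on both sides. Surjectivity, in the form
    of the right inverse [psi], shows that the images exhaust [J]. *)
Lemma ge0_subst_incr : open J -> (forall x, I x -> 0 < dphi x) ->
  (\int[mu]_(y in J) (G y)%:E = \int[mu]_(x in I) (G (phi x) * dphi x)%:E)%E.
Proof.
move=> oJ dphi0.
have incr n x y : u n <= x -> x < y -> y <= v n -> phi x < phi y.
  apply: (gtr0_derive1_incr _ _ (@phi_cc n)) => z; rewrite in_itv/= => /andP[uz zv].
    by have [+ _ _] := phi_LR n; apply; rewrite in_itv/= uz.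
  have Iz : I z by apply: (@Isub n); rewrite !ltW.
  by rewrite phi'E// dphi0.
have incrW n x y : u n <= x -> x <= y -> y <= v n -> phi x <= phi y.
  move=> ux; rewrite le_eqVlt => /predU1P[->//|xy yv].
  by rewrite ltW//; exact: (@incr n).
have Juv : exhausts J (phi \o u) (phi \o v).
  have [hu hv _ _ Iex] := Iuv; split => /=.
  - move=> n m nm; apply: (@incrW m); rewrite ?lexx//; first exact: hu.
    by rewrite (le_trans _ (hv _ _ nm))// ltW.
  - move=> n m nm; apply: (@incrW m); rewrite ?lexx//; last exact: hv.
    by rewrite (le_trans (hu _ _ nm))// ltW.
  - by move=> n; apply: (@incr n).
  - by move=> n x; apply: image_mono; apply: phiJ.
  - move=> y Jy; have [n /andP[un vn]] := Iex _ (psiI Jy).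
    by exists n; rewrite -(psiK Jy) !(@incrW n).
have := ge0_exhausts_cvg Juv (G_measurable oJ) G0.
move=> /cvg_lim <- //; have := subst_cvg => /cvg_lim => /(_ (@ereal_hausdorff _)).
rewrite (_ : (\int[mu]_(x in I) (G (phi x) * `|dphi x|)%:E)%E =
   (\int[mu]_(x in I) (G (phi x) * dphi x)%:E)%E); last first.
  by apply: eq_integral => x /set_mem/dphi0 dx; rewrite gtr0_norm.
move=> <-; congr (limn _); apply/funext => n /=.
have [h1 h2 h3] := phi'_cvg n.
rewrite integration_by_substitution_increasing//.
- apply: eq_integral => x; rewrite inE/= in_itv/= => xuv.
  have Ix := Isub xuv.
  by rewrite /= !fctE phi'E// gtr0_norm// dphi0.
- exact: ltW.
- move=> x y; rewrite !in_itv/= => /andP[? ?] /andP[? ?] xy.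
  exact: (@incr n).
- apply: continuous_in_subspaceT => y; rewrite inE/= in_itv/= => yuv.
  by apply: cG; apply: image_mono yuv; apply: phiJ.
Qed.

Lemma ge0_subst_decr : open J -> (forall x, I x -> dphi x < 0) ->
  (\int[mu]_(y in J) (G y)%:E = \int[mu]_(x in I) (G (phi x) * - dphi x)%:E)%E.
Proof.
move=> oJ dphi0.
have decr n x y : u n <= x -> x < y -> y <= v n -> phi y < phi x.
  apply: (ltr0_derive1_decr _ _ (@phi_cc n)) => z; rewrite in_itv/= => /andP[uz zv].
    by have [+ _ _] := phi_LR n; apply; rewrite in_itv/= uz.
  have Iz : I z by apply: (@Isub n); rewrite !ltW.
  by rewrite phi'E// dphi0.
have decrW n x y : u n <= x -> x <= y -> y <= v n -> phi y <= phi x.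
  move=> ux; rewrite le_eqVlt => /predU1P[->//|xy yv].
  by rewrite ltW//; exact: (@decr n).
have Juv : exhausts J (phi \o v) (phi \o u).
  have [hu hv _ _ Iex] := Iuv; split => /=.
  - move=> n m nm; apply: (@decrW m); rewrite ?lexx//; last exact: hv.
    by rewrite (le_trans (hu _ _ nm))// ltW.
  - move=> n m nm; apply: (@decrW m); rewrite ?lexx//; first exact: hu.
    by rewrite (le_trans _ (hv _ _ nm))// ltW.
  - by move=> n; apply: (@decr n).
  - by move=> n x; apply: image_mono; apply: phiJ.
  - move=> y Jy; have [n /andP[un vn]] := Iex _ (psiI Jy).
    by exists n; rewrite -(psiK Jy) !(@decrW n).
have := ge0_exhausts_cvg Juv (G_measurable oJ) G0.
move=> /cvg_lim <- //; have := subst_cvg => /cvg_lim => /(_ (@ereal_hausdorff _)).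
rewrite (_ : (\int[mu]_(x in I) (G (phi x) * `|dphi x|)%:E)%E =
   (\int[mu]_(x in I) (G (phi x) * - dphi x)%:E)%E); last first.
  by apply: eq_integral => x /set_mem/dphi0 dx; rewrite ltr0_norm.
move=> <-; congr (limn _); apply/funext => n /=.
have [h1 h2 h3] := phi'_cvg n.
rewrite integration_by_substitution_decreasing//.
- apply: eq_integral => x; rewrite inE/= in_itv/= => xuv.
  have Ix := Isub xuv.
  by rewrite /= !fctE phi'E// ltr0_norm// dphi0.
- exact: ltW.
- move=> x y; rewrite !in_itv/= => /andP[? ?] /andP[? ?] xy.
  exact: (@decr n).
- apply: continuous_in_subspaceT => y; rewrite inE/= in_itv/= => yuv.
  by apply: cG; apply: image_mono yuv; apply: phiJ.
Qed.

End substitution.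
End change_of_variables.

(** * Real powers and power substitutions *)

Section powR_calculus.
Context {R : realType}.
Implicit Types (x a b r d e : R) (f g : R -> R).

Lemma powR_expR x a : 0 < x -> x `^ a = expR (a * ln x).
Proof. by move=> x0; rewrite /powR gt_eqF. Qed.

Lemma powRD_gt0 x a b : 0 < x -> x `^ (a + b) = x `^ a * x `^ b.
Proof. by move=> x0; rewrite powRD//; apply/implyP => _; rewrite gt_eqF. Qed.

Lemma is_derive_continuous f x d : is_derive x 1 f d -> {for x, continuous f}.
Proof.
move=> fx; apply: differentiable_continuous.
by apply/derivable1_diffP; exact: ex_derive.
Qed.

Lemma is_derive_cstM (c : R) f x d :
  is_derive x 1 f d -> is_derive x 1 (fun y => c * f y) (c * d).
Proof. exact: (@is_deriveZ R R^o R^o f c x 1 d). Qed.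

Lemma is_derive_funD f g x d e : is_derive x 1 f d -> is_derive x 1 g e ->
  is_derive x 1 (fun y => f y + g y) (d + e).
Proof. exact: is_deriveD. Qed.

Lemma is_derive_funB f g x d e : is_derive x 1 f d -> is_derive x 1 g e ->
  is_derive x 1 (fun y => f y - g y) (d - e).
Proof. exact: is_deriveB. Qed.

Lemma is_derive_funM f g x d e : is_derive x 1 f d -> is_derive x 1 g e ->
  is_derive x 1 (fun y => f y * g y) (d * g x + f x * e).
Proof.
move=> fd ge; have := is_deriveM fd ge.
suff -> : f x *: e + g x *: d = d * g x + f x * e by [].
by rewrite addrC; congr (_ + _); exact: mulrC.
Qed.

Lemma powR_continuous a x : 0 < x -> {for x, continuous (@powR R ^~ a)}.
Proof. by move=> x0; exact: is_derive_continuous (@is_derive1_powR R a x x0). Qed.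

Lemma continuous_powRf f a x : 0 < f x -> {for x, continuous f} ->
  {for x, continuous (fun y => f y `^ a)}.
Proof.
move=> fx cf; apply: (@continuous_comp _ _ _ f (@powR R ^~ a)) => //.
exact: powR_continuous.
Qed.

Lemma is_derive_powRf f a x d : 0 < f x -> is_derive x 1 f d ->
  is_derive x 1 (fun y => f y `^ a) (a * f x `^ (a - 1) * d).
Proof.
by move=> fx df; apply: (@is_derive1_comp R (@powR R ^~ a) f); exact: is_derive1_powR.
Qed.

Lemma powRK x r : r != 0 -> 0 <= x -> (x `^ r) `^ r^-1 = x.
Proof. by move=> r0 x0; rewrite -powRrM divff// powRr1. Qed.

Lemma powRVK x r : r != 0 -> 0 <= x -> (x `^ r^-1) `^ r = x.
Proof. by move=> r0 x0; rewrite -powRrM mulVf// powRr1. Qed.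

Lemma powR_lt1 x r : 0 < x < 1 -> 0 < r -> x `^ r < 1.
Proof.
move=> /andP[x0 x1] r0; rewrite powR_expR// -[ltRHS]expR0 ltr_expR.
by rewrite pmulr_rlt0// ln_lt0// x0.
Qed.

Lemma powR_gt1 x r : 1 < x -> 0 < r -> 1 < x `^ r.
Proof.
move=> x1 r0; rewrite powR_expR ?(lt_trans _ x1)// -[ltLHS]expR0 ltr_expR.
by rewrite mulr_gt0// ln_gt0.
Qed.

End powR_calculus.

Section standard_substitutions.
Context {R : realType}.
Notation mu := (@lebesgue_measure R).
Implicit Types (G : R -> R) (r c : R).

Let is_derive_cpow (c r x : R) : 0 < x ->
  is_derive x 1 (fun x => c * x `^ r) (c * (r * x `^ (r - 1))).
Proof.
by move=> x0; apply: is_derive_cstM; exact: is_derive1_powR.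
Qed.

Let continuous_cpow (c r s x : R) : 0 < x ->
  {for x, continuous (fun x => c * (r * x `^ s))}.
Proof.
move=> x0; apply: cvgM; first exact: cvg_cst.
by apply: cvgM; [exact: cvg_cst|exact: powR_continuous].
Qed.

Lemma ge0_subst_powR_itv0y G (r c : R) : 0 < c -> r != 0 ->
  (forall y, 0 < y -> {for y, continuous G}) -> (forall y, 0 < y -> 0 <= G y) ->
  (\int[mu]_(y in `]0%R, +oo[) (G y)%:E =
   \int[mu]_(x in `]0%R, +oo[) (G (c * x `^ r) * (c * (`|r| * x `^ (r - 1))))%:E)%E.
Proof.
move=> c0 r0 cG G0.
have [u [v [uv _ _ _]]] := @exhausts_itvoy R 0.
have inE0 x : [set` `]0%R, +oo[] x -> 0 < x by rewrite /= in_itv/= andbT.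
have phiJ x : [set` `]0%R, +oo[] x -> [set` `]0%R, +oo[] (c * x `^ r).
  by move=> /inE0 x0; rewrite /= in_itv/= andbT mulr_gt0// powR_gt0.
have psiI y : [set` `]0%R, +oo[] y -> [set` `]0%R, +oo[] ((y / c) `^ r^-1).
  by move=> /inE0 x0; rewrite /= in_itv/= andbT powR_gt0// divr_gt0.
have psiK y : [set` `]0%R, +oo[] y -> c * ((y / c) `^ r^-1) `^ r = y.
  by move=> /inE0 x0; rewrite powRVK ?divr_ge0// ?ltW// mulrC divfK// gt_eqF.
have := @interval_is_interval R `]0%R, +oo[ => iI.
have := r0; rewrite neq_lt => /orP[rn|rp].
- rewrite (ge0_subst_decr (phi := fun x => c * x `^ r) (psi := fun y => (y / c) `^ r^-1)
     (dphi := fun x => c * (r * x `^ (r - 1))) uv)//.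
  + apply: eq_integral => x _; congr (_ * _)%:E.
    by rewrite ltr0_norm// mulNr mulrN.
  + by move=> x /inE0; exact: is_derive_cpow.
  + by move=> x /inE0; exact: continuous_cpow.
  + by move=> y /inE0/cG.
  + by move=> y /inE0/G0.
  + by move=> x /inE0 x0; rewrite pmulr_rlt0// nmulr_rlt0// powR_gt0.
- rewrite (ge0_subst_incr (phi := fun x => c * x `^ r) (psi := fun y => (y / c) `^ r^-1)
     (dphi := fun x => c * (r * x `^ (r - 1))) uv)//.
  + by apply: eq_integral => x _; rewrite gtr0_norm.
  + by move=> x /inE0; exact: is_derive_cpow.
  + by move=> x /inE0; exact: continuous_cpow.
  + by move=> y /inE0/cG.
  + by move=> y /inE0/G0.
  + by move=> x /inE0 x0; rewrite !mulr_gt0// powR_gt0.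
Qed.

Lemma ge0_subst_powR_itv01 G r : 0 < r ->
  (forall y, 0 < y < 1 -> {for y, continuous G}) ->
  (forall y, 0 < y < 1 -> 0 <= G y) ->
  (\int[mu]_(y in `]0%R, 1%R[) (G y)%:E =
   \int[mu]_(x in `]0%R, 1%R[) (G (x `^ r) * (r * x `^ (r - 1)))%:E)%E.
Proof.
move=> r0 cG G0.
have [u [v [uv _ _ _ _]]] := @exhausts_itvoo R 0 1 ltr01.
have inE0 x : [set` `]0%R, 1%R[] x -> 0 < x < 1 by rewrite /= in_itv/=.
have phiJ s x : 0 < s -> [set` `]0%R, 1%R[] x -> [set` `]0%R, 1%R[] (x `^ s).
  by move=> s0 /inE0 x0; rewrite /= in_itv/= powR_lt1// powR_gt0//; case/andP: x0.
rewrite (ge0_subst_incr (phi := fun x => x `^ r) (psi := fun y => y `^ r^-1)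
     (dphi := fun x => r * x `^ (r - 1)) uv)//.
- exact: interval_is_interval.
- by move=> x /inE0/andP[? _]; exact: is_derive1_powR.
- move=> x /inE0/andP[? _]; apply: cvgM; first exact: cvg_cst.
  exact: powR_continuous.
- by move=> x Ix; exact: phiJ.
- by move=> x Ix; apply: phiJ => //; rewrite invr_gt0.
- by move=> y /inE0/andP[y0 _]; rewrite powRVK ?gt_eqF// ltW.
- by move=> x /inE0/andP[x0 _]; rewrite !mulr_gt0// powR_gt0.
Qed.

Lemma ge0_subst_powRN_itv1y G r : 0 < r ->
  (forall y, 0 < y < 1 -> {for y, continuous G}) ->
  (forall y, 0 < y < 1 -> 0 <= G y) ->
  (\int[mu]_(y in `]0%R, 1%R[) (G y)%:E =
   \int[mu]_(x in `]1%R, +oo[) (G (x `^ (- r)) * (r * x `^ (- r - 1)))%:E)%E.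
Proof.
move=> r0 cG G0.
have [u [v [uv _ _ _]]] := @exhausts_itvoy R 1.
have inE0 x : [set` `]0%R, 1%R[] x -> 0 < x < 1 by rewrite /= in_itv/=.
have inE1 x : [set` `]1%R, +oo[] x -> 1 < x by rewrite /= in_itv/= andbT.
rewrite (ge0_subst_decr (phi := fun x => x `^ (- r)) (psi := fun y => y `^ (- r)^-1)
     (dphi := fun x => - r * x `^ (- r - 1)) uv)//.
- by apply: eq_integral => x _; rewrite mulNr opprK.
- exact: interval_is_interval.
- by move=> x /inE1 x1; apply: is_derive1_powR; rewrite (lt_trans _ x1).
- move=> x /inE1 x1; apply: cvgM; first exact: cvg_cst.
  by apply: powR_continuous; rewrite (lt_trans _ x1).
- move=> x /inE1 x1; rewrite /= in_itv/= powR_gt0 ?(lt_trans _ x1)//=.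
  by rewrite powRN invf_lt1 ?powR_gt1// powR_gt0// (lt_trans _ x1).
- move=> y /inE0 y01; have /andP[y0 _] := y01; rewrite /= in_itv/= andbT.
  rewrite invrN powRN -[ltLHS]invr1 ltf_pV2 ?posrE ?powR_gt0//.
  by rewrite powR_lt1// invr_gt0.
- by move=> y /inE0/andP[y0 _]; rewrite powRVK ?oppr_eq0 ?gt_eqF// ltW.
- move=> x /inE1 x1; rewrite nmulr_rlt0 ?oppr_lt0//.
  by rewrite powR_gt0 ?(lt_trans _ x1).
Qed.

(** [y = 1 / t - 1] exchanges the two usual forms of the beta integral. *)
Lemma ge0_subst_invB1_itv01 G :
  (forall y, 0 < y -> {for y, continuous G}) -> (forall y, 0 < y -> 0 <= G y) ->
  (\int[mu]_(y in `]0%R, +oo[) (G y)%:E =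
   \int[mu]_(t in `]0%R, 1%R[) (G (t `^ (-1) - 1) * t `^ (- 2))%:E)%E.
Proof.
move=> cG G0.
have [u [v [uv _ _ _ _]]] := @exhausts_itvoo R 0 1 ltr01.
have inE1 x : [set` `]0%R, 1%R[] x -> 0 < x < 1 by rewrite /= in_itv/=.
have inE0 x : [set` `]0%R, +oo[] x -> 0 < x by rewrite /= in_itv/= andbT.
rewrite (ge0_subst_decr (phi := fun x => x `^ (- 1) - 1) (psi := fun y => (y + 1) `^ (- 1))
     (dphi := fun x => - 1 * x `^ (- 1 - 1)) uv)//.
- apply: eq_integral => x _; congr (_ * _)%:E; rewrite mulN1r opprK; congr (_ `^ _); lra.
- exact: interval_is_interval.
- move=> x /inE1/andP[x0 _]; have := @is_derive1_powR R (-1) x x0 => H.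
  rewrite /has_derivative -[X in is_derive _ _ _ X]subr0.
  by apply: is_derive_funB; exact: is_derive_cst.
- move=> x /inE1/andP[x0 _]; apply: cvgM; first exact: cvg_cst.
  exact: powR_continuous.
- move=> x /inE1/andP[x0 x1]; rewrite /= in_itv/= andbT subr_gt0.
  by rewrite powRN powRr1 ?ltW// invf_gt1.
- move=> y /inE0 y0; have y1 : 0 < y + 1 by rewrite addr_gt0.
  rewrite /= in_itv/= powR_gt0//= powRN powRr1 ?ltW// invf_lt1//.
  by rewrite ltrDr.
- move=> y /inE0 y0; have y1 : 0 <= y + 1 by rewrite addr_ge0// ltW.
  by rewrite -powRrM mulN1r opprK powRr1// addrK.
- by move=> y /inE0/cG.
- by move=> y /inE0/G0.
- by move=> x /inE1/andP[x0 _]; rewrite mulN1r oppr_lt0 powR_gt0.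
Qed.

Lemma ge0_subst_scale G (c L : R) : 0 < c -> 0 < L ->
  (forall y, 0 < y -> {for y, continuous G}) -> (forall y, 0 < y -> 0 <= G y) ->
  (\int[mu]_(y in `]0%R, (c * L)%R[) (G y)%:E =
   \int[mu]_(x in `]0%R, L[) (G (c * x) * c)%:E)%E.
Proof.
move=> c0 L0 cG G0.
have [u [v [uv _ _ _ _]]] := @exhausts_itvoo R 0 L L0.
have inE0 M x : [set` `]0%R, M[] x -> 0 < x < M by rewrite /= in_itv/=.
rewrite (ge0_subst_incr (phi := fun x => c * x) (psi := fun y => y / c)
     (dphi := fun x => c) uv)//.
- exact: interval_is_interval.
- move=> x _; rewrite /has_derivative -[X in is_derive _ _ _ X]mulr1.
  by apply: is_derive_cstM; exact: is_derive_id.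
- by move=> x _; exact: cvg_cst.
- by move=> x /inE0/andP[x0 xL]; rewrite /= in_itv/= mulr_gt0//= ltr_pM2l.
- move=> y /inE0/andP[y0 yL]; rewrite /= in_itv/= divr_gt0//=.
  by rewrite ltr_pdivrMr// mulrC.
- by move=> y _; rewrite mulrC divfK// gt_eqF.
- by move=> y /inE0/andP[/cG].
- by move=> y /inE0/andP[/G0].
Qed.

End standard_substitutions.

(** * The Gamma integral *)

Section measurability.
Context {d} {T : measurableType d} {R : realType}.

Lemma measurable_powRf (D : set T) (f : T -> R) (a : R) :
  measurable_fun D f -> measurable_fun D (fun x => f x `^ a).
Proof. move=> mf; exact: (measurableT_comp (measurable_powR a) mf). Qed.

Lemma measurable_expRf (D : set T) (f : T -> R) :
  measurable_fun D f -> measurable_fun D (fun x => expR (f x)).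
Proof. move=> mf; exact: (measurableT_comp (@measurable_expR R) mf). Qed.
End measurability.

(** Measurability of expressions built from coordinates by field operations,
    powers and exponentials. *)
Ltac measR := repeat first
  [ exact: measurable_cst | exact: measurable_id | exact: measurable_fst
  | exact: measurable_snd | assumption
  | apply: measurable_powRf | apply: measurable_expRf | apply: measurable_funM
  | apply: measurable_funD | apply: measurable_funB | apply: measurable_funN ].

Section tonelli.
Context {R : realType}.
Notation mu := (@lebesgue_measure R).

Lemma tonelli_itv (A B : set R) (f : R -> R -> R) :
  measurable A -> measurable B ->
  measurable_fun [set: R * R] (fun z => f z.1 z.2) ->
  (forall x y, 0 <= f x y) ->
  (\int[mu]_(x in A) \int[mu]_(y in B) (f x y)%:E =
   \int[mu]_(y in B) \int[mu]_(x in A) (f x y)%:E)%E.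
Proof.
move=> mA mB mf f0.
pose g := (fun z : R * R => (f z.1 z.2)%:E) \_ (A `*` B).
have mg : measurable_fun setT g.
  apply/(measurable_restrictT _ (measurableX mA mB)).
  by apply: measurable_funTS; exact/measurable_EFinP.
have g0 z : (0 <= g z)%E by apply: erestrict_ge0 => ? _; rewrite lee_fin.
have H := @fubini_tonelli _ _ _ _ R mu mu g mg g0.
rewrite [LHS]integral_mkcond [RHS]integral_mkcond.
transitivity (\int[mu]_x \int[mu]_y g (x, y))%E.
  apply: eq_integral => x _; rewrite patchE; case: ifPn => xA.
    rewrite integral_mkcond; apply: eq_integral => y _.
    by rewrite /g !patchE in_setX/= xA.
  apply/esym/integral0_eq => y _.
  by rewrite /g !patchE in_setX/= (negbTE xA).
rewrite H; apply: eq_integral => y _; rewrite patchE; case: ifPn => yB.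
  rewrite [RHS]integral_mkcond; apply: eq_integral => x _.
  by rewrite /g !patchE in_setX/= yB andbT.
apply: integral0_eq => x _.
by rewrite /g !patchE in_setX/= (negbTE yB) andbF.
Qed.

Lemma ge0_integralZl_total (D : set R) (k : R) (f : R -> R) :
  measurable D -> 0 <= k -> (forall x, 0 <= f x) -> measurable_fun [set: R] f ->
  (\int[mu]_(x in D) (k * f x)%:E = k%:E * \int[mu]_(x in D) (f x)%:E)%E.
Proof.
move=> mD k0 f0 mf; rewrite -ge0_integralZl_EFin//.
- by move=> x _; rewrite lee_fin.
- by apply/measurable_EFinP; apply: measurable_funTS.
Qed.

End tonelli.

Section gamma.
Context {R : realType}.
Notation mu := (@lebesgue_measure R).
Implicit Types (a b c t x : R).

Lemma ge0_subst_scale_itv0y (G : R -> R) c : 0 < c ->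
  (forall y, 0 < y -> {for y, continuous G}) -> (forall y, 0 < y -> 0 <= G y) ->
  (\int[mu]_(y in `]0%R, +oo[) (G y)%:E =
   \int[mu]_(x in `]0%R, +oo[) (G (c * x)%R * c)%:E)%E.
Proof.
move=> c0 cG G0; rewrite (@ge0_subst_powR_itv0y _ G 1 c)// ?oner_eq0//.
apply: eq_integral => x /set_mem/=; rewrite in_itv/= andbT => x0.
by rewrite powRr1 ?ltW// normr1 subrr powRr0 !mulr1.
Qed.

Definition gamma_integrand a t : R := t `^ (a - 1) * expR (- t).

Lemma gamma_integrand_ge0 a t : 0 <= gamma_integrand a t.
Proof. by rewrite mulr_ge0// ?powR_ge0 ?expR_ge0. Qed.

Lemma continuous_gamma_integrand a t : 0 < t -> {for t, continuous (gamma_integrand a)}.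
Proof.
move=> t0; apply: cvgM; first exact: powR_continuous.
by apply: cvg_comp; [exact: cvgN cvg_id|exact: continuous_expR].
Qed.

Lemma measurable_gamma_integrand a D : measurable_fun D (gamma_integrand a).
Proof. by apply: measurable_funTS; measR. Qed.

(** Polynomial growth is negligible with respect to the exponential, with an
    explicit constant: apply [x <= expR x] to [(1 + t) / m]. *)
Lemma powR1D_le_expR (m t : R) : 0 < m -> 0 < t ->
  (1 + t) `^ m <= m `^ m * expR (1 + t).
Proof.
move=> m0 t0; have t1 : 0 < 1 + t by rewrite addr_gt0.
pose x := (1 + t) / m; have x0 : 0 < x by rewrite divr_gt0.
have -> : 1 + t = m * x by rewrite mulrC divfK// gt_eqF.
have -> : expR (m * x) = expR x `^ m.
  by rewrite [RHS]powR_expR ?expR_gt0// expRK.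
rewrite powRM ?(ltW m0) ?(ltW x0)// ler_pM2l ?powR_gt0//.
apply: ge0_ler_powR; rewrite ?nnegrE ?(ltW m0) ?(ltW x0) ?expR_ge0//.
by apply: le_trans (expR_ge1Dx _); rewrite lerDr.
Qed.

(** The derivative of [(t / (1 + t)) ^ a]: an elementary density of mass 1, a
    multiple of which dominates the Gamma integrand. *)
Definition unit_beta a t : R := a * (t `^ (a - 1) * (1 + t) `^ (- a - 1)).

Lemma powR_cvg0n a (u : nat -> R) : 0 < a -> (forall n, 0 < u n) ->
  u n @[n --> \oo] --> 0 -> u n `^ a @[n --> \oo] --> 0.
Proof. by move=> a0 u0 ucvg; have /cvg_at_rightP := powR_cvg0 a0; apply. Qed.

Lemma powRN_cvgyn a (u : nat -> R) : 0 < a ->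
  u n @[n --> \oo] --> +oo%R -> u n `^ (- a) @[n --> \oo] --> 0.
Proof.
move=> a0 ucvg.
pose v n := (Num.max (u n) 1)^-1.
have v0 n : 0 < v n by rewrite invr_gt0 lt_max ltr01 orbT.
have vcvg : v n @[n --> \oo] --> 0.
  apply/gtr0_cvgV0; first by near=> n; rewrite lt_max ltr01 orbT.
  move/cvgryPge : ucvg => ucvg; apply/cvgryPge => A.
  near=> n; rewrite le_max; apply/orP; left.
  by near: n; exact: ucvg.
have := powR_cvg0n a0 v0 vcvg; apply: cvg_trans; apply: near_eq_cvg.
have : \forall n \near \oo, 1 <= u n by move/cvgryPge : ucvg; apply.
apply: filterS => n u1; rewrite /v max_l// powRN.
rewrite -[(u n)^-1]powR_inv1 ?(le_trans _ u1)// -powRrM mulN1r.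
by rewrite powRN.
Unshelve. all: by end_near. Qed.

Lemma integral_unit_beta a : 0 < a ->
  (\int[mu]_(t in `]0%R, +oo[) (unit_beta a t)%:E = 1%:E)%E.
Proof.
move=> a0; have [u [v [uv u0 ucvg vcvg]]] := @exhausts_itvoy R 0.
have vpos n : 0 < v n by have [_ _ + _ _] := uv => /(_ n); apply: lt_trans.
pose F (t : R) := (t `^ (-1) + 1) `^ (- a).
have dF t : 0 < t -> is_derive t 1 F (unit_beta a t).
  move=> t0; have t1 : 0 < 1 + t by rewrite addr_gt0.
  have e : t `^ (-1) + 1 = (1 + t) * t `^ (-1).
    by rewrite powRN powRr1 ?ltW//; field; rewrite gt_eqF.
  have ti : 0 < t `^ (-1) by rewrite powR_gt0.
  have := @is_derive_powRf R (fun t => t `^ (-1) + 1) (- a) t (-1 * t `^ (-1 - 1) + 0).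
  move=> /(_ (addr_gt0 ti ltr01)) H.
  suff -> : unit_beta a t =
      - a * (t `^ (-1) + 1) `^ (- a - 1) * (-1 * t `^ (-1 - 1) + 0).
    apply: H; apply: (@is_derive_funD R (@powR R ^~ (-1)) (cst 1)).
      exact: is_derive1_powR.
  rewrite /unit_beta e powRM ?ltW// -powRrM addr0 mulN1r mulrN !mulNr opprK.
  rewrite -!mulrA; congr (_ * _); rewrite mulrC; congr (_ * _).
  by rewrite -powRD_gt0//; congr (_ `^ _); lra.
rewrite (@ge0_FTC_exhausts _ _ u v _ F 0 1 uv) ?subr0//.
- move=> t /=; rewrite in_itv/= andbT => t0; exact: dF.
- move=> t /=; rewrite in_itv/= andbT => t0.
  have t1 : 0 < 1 + t by rewrite addr_gt0.
  apply: cvgM; first exact: cvg_cst.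
  apply: cvgM; first exact: powR_continuous.
  apply: continuous_powRf => //.
  by apply: cvgD; [exact: cvg_cst|exact: cvg_id].
- rewrite /F; apply: powRN_cvgyn => //.
  have uy : (u n)^-1 @[n --> \oo] --> +oo%R.
    apply/(cvgrVy _); first by near=> n; exact: u0.
    exact: ucvg.
  move/cvgryPge : uy => uy; apply/cvgryPge => A; near=> n.
  rewrite ler_wpDr// powRN powRr1 ?(ltW (u0 _))//.
  by near: n; exact: uy.
- rewrite /F -[X in _ --> X](congr1 (fun f => f (- a)) (@powR1 R)) -[X in X `^ _]add0r.
  apply: (@cvg_comp _ _ _ (fun n => v n `^ (-1) + 1) (@powR R ^~ (- a))); last first.
    by apply: powR_continuous; rewrite add0r.
  by apply: cvgD; [exact: powRN_cvgyn|exact: cvg_cst].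
- by apply: measurable_funTS; measR.
- by move=> t _; rewrite !mulr_ge0// ?powR_ge0// ltW.
Unshelve. all: by end_near. Qed.

(** The Gamma integral, in the extended reals so that it can be used before its
    finiteness is known. *)
Definition gammae a := (\int[mu]_(t in `]0%R, +oo[) (gamma_integrand a t)%:E)%E.

Lemma gammae_lty a : 0 < a -> (gammae a < +oo)%E.
Proof.
move=> a0; have a1 : 0 < a + 1 by rewrite addr_gt0.
pose C := (a + 1) `^ (a + 1) * expR 1 / a.
have C0 : 0 <= C by rewrite divr_ge0 ?mulr_ge0 ?powR_ge0 ?expR_ge0 ?ltW.
apply: (@le_lt_trans _ _ (\int[mu]_(t in `]0%R, +oo[) (C * unit_beta a t)%:E)%E).
  apply: ge0_le_integral => //.
  - by move=> t _; rewrite lee_fin gamma_integrand_ge0.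
  - apply/measurable_EFinP; exact: measurable_gamma_integrand.
  - by apply/measurable_EFinP; apply: measurable_funTS; measR.
  - move=> t /=; rewrite in_itv/= andbT => t0; rewrite lee_fin.
    have t1 : 0 < 1 + t by rewrite addr_gt0.
    have e : C * unit_beta a t = t `^ (a - 1) *
        ((a + 1) `^ (a + 1) * expR 1 * (1 + t) `^ (- a - 1)).
      by rewrite /C /unit_beta; field; rewrite gt_eqF.
    rewrite e ler_pM2l ?powR_gt0// -opprD powRN ler_pdivlMr ?powR_gt0//.
    rewrite expRN mulrC ler_pdivrMr ?expR_gt0// -mulrA -expRD.
    exact: powR1D_le_expR.
under eq_integral do rewrite EFinM.
rewrite ge0_integralZl_EFin//.
- by rewrite integral_unit_beta// mule1 ltry.
- by move=> t _; rewrite lee_fin !mulr_ge0// ?powR_ge0// ltW.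
- by apply/measurable_EFinP; apply: measurable_funTS; measR.
Qed.

Lemma gammae_euler a : 0 < a -> gammae a = (euler_Gamma a)%:E.
Proof.
move=> a0; rewrite /euler_Gamma /Rintegral fineK// ge0_fin_numE.
  exact: gammae_lty.
by apply: integral_ge0 => t _; rewrite lee_fin gamma_integrand_ge0.
Qed.

(** Between 1 and 2 the integrand is bounded below by a positive constant. *)
Lemma euler_Gamma_gt0 a : 0 < a -> 0 < euler_Gamma a.
Proof.
move=> a0; rewrite -lte_fin -gammae_euler//.
pose m := expR (- (`|a - 1| * ln 2) - 2).
have m0 : 0 < m by exact: expR_gt0.
apply: (@lt_le_trans _ _ (\int[mu]_(t in `]1%R, 2%R[) m%:E)%E).
  rewrite integral_cst//= lebesgue_measure_itv/= lte_fin ltr1n -EFinB -EFinM lte_fin.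
  by rewrite mulr_gt0// subr_gt0 ltr1n.
apply: (@le_trans _ _ (\int[mu]_(t in `]1%R, 2%R[) (gamma_integrand a t)%:E)%E).
  apply: ge0_le_integral => //.
  - by move=> t _; rewrite lee_fin ltW.
  - apply/measurable_EFinP; exact: measurable_gamma_integrand.
  - move=> t /=; rewrite in_itv/= => /andP[t1 t2]; rewrite lee_fin.
    have t0 : 0 < t by rewrite (lt_trans _ t1).
    rewrite /gamma_integrand powR_expR// -expRD ler_expR lerD//; last by rewrite lerN2 ltW.
    have lt0 : 0 <= ln t by apply: ln_ge0; exact: ltW.
    have lt2 : ln t <= ln 2 by rewrite ler_ln ?posrE// ltW.
    rewrite lerNl -mulNr; apply: (@le_trans _ _ (`|a - 1| * ln t)).
      by rewrite ler_wpM2r// -normrN ler_norm.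
    by rewrite ler_wpM2l.
apply: ge0_subset_integral => //.
- by apply/measurable_EFinP; exact: measurable_gamma_integrand.
- by move=> t _; rewrite lee_fin gamma_integrand_ge0.
- by move=> t /=; rewrite !in_itv/= andbT => /andP[t1 _]; rewrite (lt_trans _ t1).
Qed.

Lemma gammae_scale a c : 0 < a -> 0 < c ->
  (\int[mu]_(t in `]0%R, +oo[) (t `^ (a - 1) * expR (- (c * t)))%:E =
   (c `^ (- a) * euler_Gamma a)%:E)%E.
Proof.
move=> a0 c0; rewrite EFinM -gammae_euler// /gammae.
rewrite (@ge0_subst_scale_itv0y _ c)//; last first.
- by move=> t _; exact: gamma_integrand_ge0.
- by move=> t; exact: continuous_gamma_integrand.
rewrite -ge0_integralZl_EFin//.
- apply: eq_integral => t /set_mem/=; rewrite in_itv/= andbT => t0.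
  rewrite -EFinM /gamma_integrand powRM ?ltW//; congr EFin.
  have : c `^ (- a) * (c `^ (a - 1) * c) = 1.
    rewrite -{3}[c]powRr1 ?ltW// -!powRD_gt0//.
    by rewrite (_ : _ + _ = 0) ?powRr0//; lra.
  by move=> e; rewrite -[LHS]mul1r -[X in X * _ = _]e; ring.
- by move=> t _; rewrite lee_fin mulr_ge0// ?gamma_integrand_ge0// ltW.
- by apply/measurable_EFinP; apply: measurable_funTS; measR.
- by rewrite powR_ge0.
Qed.

Lemma gamma_integrand_integrable a : 0 < a ->
  mu.-integrable `]0%R, +oo[ (EFin \o gamma_integrand a).
Proof.
move=> a0; apply/integrableP; split.
  by apply/measurable_EFinP; exact: measurable_gamma_integrand.
under eq_integral do rewrite gee0_abs ?lee_fin ?gamma_integrand_ge0//.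
exact: gammae_lty.
Qed.

Lemma powR_expRN_cvgy a (v : nat -> R) : 0 < a -> (forall n, 0 < v n) ->
  v n @[n --> \oo] --> +oo%R -> v n `^ a * expR (- v n) @[n --> \oo] --> 0.
Proof.
move=> a0 v0 vcvg; have a1 : 0 < a + 1 by rewrite addr_gt0.
pose C := (a + 1) `^ (a + 1) * expR 1.
apply: (@squeeze_cvgr _ _ _ _ (fun=> 0) (fun n => C * v n `^ (-1))).
- apply: nearW => n; rewrite mulr_ge0 ?powR_ge0 ?expR_ge0//=.
  have n1 : 0 < 1 + v n by rewrite addr_gt0.
  rewrite powRN powRr1 ?(ltW (v0 n))// expRN ler_pdivrMr ?expR_gt0// mulrAC.
  rewrite ler_pdivlMr// -mulrA -expRD -[X in _ * X <= _]powRr1 ?(ltW (v0 n))//.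
  rewrite -powRD_gt0//; apply: le_trans (powR1D_le_expR _ _) => //.
  by apply: ge0_ler_powR; rewrite ?nnegrE ?(ltW a1) ?(ltW (v0 n)) ?(ltW n1)// lerDr.
- exact: cvg_cst.
- rewrite -(mulr0 C); apply: cvgM; first exact: cvg_cst.
  exact: powRN_cvgyn.
Qed.

(** Integration by parts: the derivative of [- t ^ a exp (- t)] has integral 0. *)
Lemma euler_GammaS a : 0 < a -> euler_Gamma (a + 1) = a * euler_Gamma a.
Proof.
move=> a0; have a1 : 0 < a + 1 by rewrite addr_gt0.
have [u [v [uv u0 ucvg vcvg]]] := @exhausts_itvoy R 0.
have vpos n : 0 < v n by have [_ _ + _ _] := uv => /(_ n); apply: lt_trans.
pose F (t : R) := - (t `^ a * expR (- t)).
pose f t := gamma_integrand (a + 1) t - a * gamma_integrand a t.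
have cexpN (t : R) : {for t, continuous (fun t : R => expR (- t))}.
  by apply: cvg_comp; [exact: cvgN cvg_id|exact: continuous_expR].
have dF t : 0 < t -> is_derive t 1 F (f t).
  move=> t0; rewrite /F.
  have dE : is_derive t 1 (fun t : R => expR (- t)) (- expR (- t)).
    rewrite -[X in is_derive _ _ _ X]mulrN1.
    by apply: (@is_derive1_comp R expR -%R).
  have := is_derive_funM (@is_derive1_powR R a t t0) dE.
  move=> /(is_derive_cstM (-1)).
  rewrite (_ : (fun y => -1 * _) = (fun y => - (y `^ a * expR (- y)))); last first.
    by apply/funext => y; rewrite mulN1r.
  rewrite (_ : -1 * _ = f t)// /f /gamma_integrand addrK; ring.
have gai : mu.-integrable `]0%R, +oo[ (EFin \o (fun t => a * gamma_integrand a t)).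
  exact: (integrableZl _ a (gamma_integrand_integrable a0)).
have fi : mu.-integrable `]0%R, +oo[ (EFin \o f).
  apply: (@integrableB _ _ _ mu _ _ (EFin \o gamma_integrand (a + 1))
    (EFin \o (fun t => a * gamma_integrand a t))) => //.
  exact: gamma_integrand_integrable.
have := @integrable_FTC_exhausts _ _ u v f F 0 0 uv.
rewrite subr0 => H; apply: EFin_inj; rewrite EFinM -!gammae_euler//.
have : (gammae (a + 1) - a%:E * gammae a = \int[mu]_(t in `]0%R, +oo[) (f t)%:E)%E.
  rewrite /gammae -integralZl//; last exact: gamma_integrand_integrable.
  by rewrite integralB_EFin//; exact: gamma_integrand_integrable.
rewrite H//.
- rewrite !gammae_euler// -EFinM -EFinB => -[] /eqP.
  by rewrite subr_eq0 => /eqP ->.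
- by move=> t /=; rewrite in_itv/= andbT; exact: dF.
- move=> t /=; rewrite in_itv/= andbT => t0; apply: cvgB.
    exact: continuous_gamma_integrand.
  by apply: cvgM; [exact: cvg_cst|exact: continuous_gamma_integrand].
- rewrite /F -[X in _ --> X]oppr0; apply: cvgN; rewrite -(mul0r (expR (- 0))).
  apply: cvgM; first exact: powR_cvg0n.
  by apply: (@cvg_comp _ _ _ u (fun t => expR (- t)) _ _ _ ucvg); exact: cexpN.
- by rewrite /F -[X in _ --> X]oppr0; apply: cvgN; exact: powR_expRN_cvgy.
Qed.

End gamma.

(** * The Gamma and Beta functions on the real line *)

Section pochhammer.
Context {R : realType}.
Implicit Types (a b x : R) (k : nat).

Lemma pochhammer0 a : pochhammer a 0 = 1.
Proof. by rewrite /pochhammer big_nil. Qed.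

Lemma pochhammerSr a k : pochhammer a k.+1 = pochhammer a k * (a + k%:R).
Proof. by rewrite /pochhammer big_nat_recr. Qed.

Lemma pochhammerS a k : pochhammer a k.+1 = a * pochhammer (a + 1) k.
Proof.
rewrite /pochhammer big_nat_recl// addr0; congr (_ * _).
by apply: eq_bigr => i _; rewrite -natr1 (addrC i%:R) addrA.
Qed.

Lemma pochhammer_gt0 a k : 0 < a -> 0 < pochhammer a k.
Proof. by move=> a0; apply: prodr_gt0 => i _; rewrite ltr_wpDr. Qed.

Lemma pochhammer_neq0 a k : (forall n : nat, a != - n%:R) -> pochhammer a k != 0.
Proof.
move=> an; elim: k => [|k IH]; first by rewrite pochhammer0 oner_eq0.
by rewrite pochhammerSr mulf_neq0// addr_eq0.
Qed.

End pochhammer.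

Section real_Gamma.
Context {R : realType}.
Implicit Types (a b x : R).

Lemma Gamma_euler x : 0 < x -> Gamma x = euler_Gamma x.
Proof. by rewrite /Gamma => ->. Qed.

Lemma Gamma_gt0 x : 0 < x -> 0 < Gamma x.
Proof. by move=> x0; rewrite Gamma_euler// euler_Gamma_gt0. Qed.

(** For [-1 < x < 0] this is the definition of [Gamma x]; for [x <= -1] both values
    are computed from the same positive argument, and only the Pochhammer symbols in
    the denominators differ. *)
Lemma GammaS x : x != 0 -> Gamma (x + 1) = x * Gamma x.
Proof.
move=> x0; have [xp|xn] := ltP 0 x.
  by rewrite !Gamma_euler ?euler_GammaS// addr_gt0.
have xN0 : x < 0 by rewrite lt_neqAle x0.
rewrite [in RHS]/Gamma ltNge xn/=.
have [x1|x1] := ltP 0 (x + 1).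
  have -> : Num.truncn (- x) = 0%N.
    by apply: truncn_def; apply/andP; split; lra.
  rewrite Gamma_euler// pochhammerS pochhammer0 mulr1.
  by rewrite mulrC divfK.
rewrite /Gamma ltNge x1/=.
set m := Num.truncn (- (x + 1)).
have -> : Num.truncn (- x) = m.+1.
  have /truncn_itv : 0 <= - (x + 1) by lra.
  rewrite -/m => /andP[m1 m2]; apply: truncn_def; rewrite -!natr1 in m2 *.
  by apply/andP; split; lra.
rewrite [in RHS]pochhammerS; set P := pochhammer _ _.
have -> : forall e, x * (e / (x * P)) = e / P.
  by move=> e; rewrite invfM mulrCA (mulVKf x0).
by have -> : x + 1 + m.+1%:R = x + m.+2%:R by rewrite -[m.+2%:R]natr1; ring.
Qed.

(** The reciprocal Gamma function satisfies the recurrence without exception,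
    thanks to the value 0 chosen for Gamma at its poles. *)
Lemma invr_GammaS x : (Gamma x)^-1 = x / Gamma (x + 1).
Proof.
have [->|x0] := eqVneq x 0; last by rewrite GammaS// invfM mulrA divff ?mul1r.
rewrite mul0r /Gamma ltxx oppr0.
have -> : Num.truncn (0 : R) = 0%N by apply: truncn_def; rewrite lexx ltr01.
by rewrite pochhammerS mul0r invr0 mulr0 invr0.
Qed.

Lemma Gamma_pochhammer x k : 0 < x -> Gamma (x + k%:R) = pochhammer x k * Gamma x.
Proof.
move=> x0; elim: k => [|k IH]; first by rewrite addr0 pochhammer0 mul1r.
have xk : 0 < x + k%:R by rewrite ltr_wpDr.
by rewrite -natr1 addrA GammaS ?gt_eqF// IH pochhammerSr mulrA (mulrC (x + _)).
Qed.

Lemma BetaC a b : Beta a b = Beta b a.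
Proof. by rewrite /Beta addrC (mulrC (Gamma a)). Qed.

Lemma Beta_gt0 a b : 0 < a -> 0 < b -> 0 < Beta a b.
Proof. by move=> a0 b0; rewrite divr_gt0 ?mulr_gt0 ?Gamma_gt0// addr_gt0. Qed.

Lemma Beta_pochhammer a b k : 0 < a -> 0 < b ->
  Beta (a + k%:R) b = Beta a b * (pochhammer a k / pochhammer (a + b) k).
Proof.
move=> a0 b0; have ab : 0 < a + b by rewrite addr_gt0.
rewrite /Beta addrAC !Gamma_pochhammer//; field.
by rewrite !gt_eqF ?pochhammer_gt0 ?Gamma_gt0.
Qed.

End real_Gamma.

Section beta_integral.
Context {R : realType}.
Notation mu := (@lebesgue_measure R).
Implicit Types (a b A r : R).

(** Both orders of integration of [t ^ (a + b - 1) * w ^ (b - 1) * exp (- t (1 + w))]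
    are Gamma integrals after a rescaling. *)
Lemma Beta_integral_itv0y a b : 0 < a -> 0 < b ->
  (\int[mu]_(w in `]0%R, +oo[) (w `^ (b - 1) * (1 + w) `^ (- (a + b)))%:E =
   (Beta a b)%:E)%E.
Proof.
move=> a0 b0; have ab0 : 0 < a + b by rewrite addr_gt0.
pose f t w : R := t `^ (a + b - 1) * (w `^ (b - 1) * expR (- ((1 + w) * t))).
have f0 t w : 0 <= f t w by rewrite !mulr_ge0 ?powR_ge0 ?expR_ge0.
have mf : measurable_fun [set: R * R] (fun z => f z.1 z.2) by measR.
have ga0 := euler_Gamma_gt0 a0; have gb0 := euler_Gamma_gt0 b0.
have gab0 := euler_Gamma_gt0 ab0.
have mD := @measurable_itv R `]0%R, +oo[.
have := tonelli_itv mD mD mf f0.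
have -> : (\int[mu]_(x in `]0%R, +oo[) \int[mu]_(y in `]0%R, +oo[) (f x y)%:E =
    (euler_Gamma b)%:E * gammae a)%E.
  rewrite -(ge0_integralZl_total mD (ltW gb0) (gamma_integrand_ge0 a)
    (@measurable_gamma_integrand R a setT)).
  apply: eq_integral => t /set_mem/=; rewrite in_itv/= andbT => t0.
  rewrite EFinM -(gammae_euler b0) /gammae.
  rewrite (ge0_subst_scale_itv0y t0 (@continuous_gamma_integrand R b)
     (fun y _ => gamma_integrand_ge0 b y)).
  rewrite [RHS]muleC -ge0_integralZl_total; last 4 first.
  - exact: mD.
  - exact: gamma_integrand_ge0.
  - by move=> w; rewrite mulr_ge0 ?gamma_integrand_ge0// ltW.
  - by measR.
  apply: eq_integral => w /set_mem/=; rewrite in_itv/= andbT => w0.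
  rewrite /f /gamma_integrand (powRM _ (ltW t0) (ltW w0)); congr EFin.
  rewrite (_ : - ((1 + w) * t) = - t + - (t * w)) ?expRD; last by ring.
  have -> : t `^ (a + b - 1) = t `^ (a - 1) * (t `^ (b - 1) * t).
    by rewrite -[X in _ = _ * (_ * X)](powRr1 (ltW t0)) -!(powRD_gt0 _ _ t0);
      congr (_ `^ _); ring.
  ring.
pose h w : R := w `^ (b - 1) * (1 + w) `^ (- (a + b)).
have h0 w : 0 <= h w by rewrite mulr_ge0 ?powR_ge0.
have mh : measurable_fun [set: R] h by measR.
have -> : (\int[mu]_(y in `]0%R, +oo[) \int[mu]_(x in `]0%R, +oo[) (f x y)%:E =
    (euler_Gamma (a + b))%:E * \int[mu]_(w in `]0%R, +oo[) (h w)%:E)%E.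
  rewrite -(ge0_integralZl_total mD (ltW gab0) h0 mh).
  apply: eq_integral => w /set_mem/=; rewrite in_itv/= andbT => w0.
  have w1 : 0 < 1 + w by rewrite addr_gt0.
  transitivity ((w `^ (b - 1))%:E * \int[mu]_(t in `]0%R, +oo[)
      (t `^ (a + b - 1) * expR (- ((1 + w) * t)))%:E)%E.
    rewrite -ge0_integralZl_total; last 4 first.
    - exact: mD.
    - exact: powR_ge0.
    - by move=> t; rewrite mulr_ge0 ?powR_ge0 ?expR_ge0.
    - by measR.
    by apply: eq_integral => t _; rewrite /f; congr EFin; ring.
  by rewrite (gammae_scale ab0 w1) -EFinM; congr EFin; rewrite /h; ring.
set X := (\int[mu]_(w in _) (h w)%:E)%E => H.
rewrite /Beta (Gamma_euler a0) (Gamma_euler b0) (Gamma_euler ab0).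
rewrite mulrC [(_ * euler_Gamma b)]mulrC !EFinM -(gammae_euler a0) H muleA -EFinM.
by rewrite (mulVf (lt0r_neq0 gab0)) mul1e.
Qed.

Let beta01_continuous a b (y : R) : 0 < y < 1 ->
  {for y, continuous (fun y => y `^ (a - 1) * (1 - y) `^ (b - 1))}.
Proof.
move=> /andP[y0 y1]; apply: cvgM; first exact: powR_continuous.
apply: (@continuous_powRf R (fun y => 1 - y) (b - 1)); first by rewrite subr_gt0.
by apply: cvgB; [exact: cvg_cst|exact: cvg_id].
Qed.

Let beta01_ge0 a b (y : R) : 0 <= y `^ (a - 1) * (1 - y) `^ (b - 1).
Proof. by rewrite mulr_ge0 ?powR_ge0. Qed.

Lemma Beta_integral_itv01 a b : 0 < a -> 0 < b ->
  (\int[mu]_(t in `]0%R, 1%R[) (t `^ (a - 1) * (1 - t) `^ (b - 1))%:E =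
   (Beta a b)%:E)%E.
Proof.
move=> a0 b0; rewrite -(Beta_integral_itv0y a0 b0) ge0_subst_invB1_itv01; last 2 first.
- move=> y y0; apply: cvgM; first exact: powR_continuous.
  apply: continuous_powRf; first by rewrite addr_gt0.
  by apply: cvgD; [exact: cvg_cst|exact: cvg_id].
- by move=> y y0; rewrite mulr_ge0 ?powR_ge0.
apply: eq_integral => t /set_mem/=; rewrite in_itv/= => /andP[t0 t1].
have ti : 0 < t `^ (-1) by rewrite powR_gt0.
have -> : t `^ (-1) - 1 = t `^ (-1) * (1 - t).
  by rewrite powRN (powRr1 (ltW t0)); field; rewrite gt_eqF.
have -> : 1 + t `^ (-1) * (1 - t) = t `^ (-1).
  by rewrite powRN (powRr1 (ltW t0)); field; rewrite gt_eqF.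
have t1' : 0 <= 1 - t by rewrite subr_ge0 ltW.
rewrite (powRM _ (ltW ti) t1') -!powRrM; congr EFin.
have -> : t `^ (a - 1) =
   t `^ (-1 * (b - 1)) * (t `^ (-1 * - (a + b)) * t `^ (-2)).
  by rewrite -!(powRD_gt0 _ _ t0); congr (_ `^ _); lra.
ring.
Qed.

Lemma Beta_integral_powR r A b : 0 < r -> 0 < A -> 0 < b ->
  (\int[mu]_(x in `]0%R, 1%R[) (x `^ (r * A - 1) * (1 - x `^ r) `^ (b - 1))%:E =
   (r^-1 * Beta A b)%:E)%E.
Proof.
move=> r0 A0 b0; have r0' : 0 <= r^-1 by rewrite invr_ge0 ltW.
rewrite EFinM -(Beta_integral_itv01 A0 b0).
rewrite (ge0_subst_powR_itv01 r0 (@beta01_continuous A b) (fun y _ => beta01_ge0 A b y)).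
rewrite -ge0_integralZl_total; last 4 first.
- exact: measurable_itv.
- exact: r0'.
- by move=> x; rewrite !mulr_ge0 ?powR_ge0// ltW.
- by measR.
apply: eq_integral => x /set_mem/=; rewrite in_itv/= => /andP[x0 x1].
congr EFin; rewrite -powRrM.
have -> : x `^ (r * A - 1) = x `^ (r * (A - 1)) * x `^ (r - 1).
  by rewrite -(powRD_gt0 _ _ x0); congr (_ `^ _); ring.
by field; rewrite gt_eqF.
Qed.

Lemma Beta_integral_powRN r A b : 0 < r -> 0 < A -> 0 < b ->
  (\int[mu]_(x in `]1%R, +oo[) (x `^ (- r * A - 1) * (1 - x `^ (- r)) `^ (b - 1))%:E =
   (r^-1 * Beta A b)%:E)%E.
Proof.
move=> r0 A0 b0; have r0' : 0 <= r^-1 by rewrite invr_ge0 ltW.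
rewrite EFinM -(Beta_integral_itv01 A0 b0).
rewrite (ge0_subst_powRN_itv1y r0 (@beta01_continuous A b) (fun y _ => beta01_ge0 A b y)).
rewrite -ge0_integralZl_total; last 4 first.
- exact: measurable_itv.
- exact: r0'.
- by move=> x; rewrite !mulr_ge0 ?powR_ge0// ltW.
- by measR.
apply: eq_integral => x /set_mem/=; rewrite in_itv/= andbT => x1.
have x0 : 0 < x by rewrite (lt_trans _ x1).
congr EFin; rewrite -powRrM.
have -> : x `^ (- r * A - 1) = x `^ (- r * (A - 1)) * x `^ (- r - 1).
  by rewrite -(powRD_gt0 _ _ x0); congr (_ `^ _); ring.
by field; rewrite gt_eqF.
Qed.

End beta_integral.

(** * Hypergeometric coefficients and the binomial series *)

Section raabe.
Context {R : realType}.
Implicit Types (t : nat -> R) (e z : R).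

Lemma series_nat_shift_cvg t N : cvgn (series (fun k => t (k + N)%N)) -> cvgn (series t).
Proof.
move=> /cvg_ex[l tl]; apply/cvg_ex; exists (l + \sum_(0 <= k < N) t k).
rewrite -(cvg_shiftn N).
rewrite (_ : (fun n => series t (n + N)%N) =
  (fun n => series (fun k => t (k + N)%N) n + \sum_(0 <= k < N) t k)).
  by apply: cvgD => //; exact: cvg_cst.
apply/funext => n; rewrite /series/= addrC (big_cat_nat (n := N)) ?leq_addl//=.
by congr (_ + _); rewrite -{1}(add0n N) big_addn addnK.
Qed.

(** Raabe's test: the hypothesis makes [k * t k] decrease by at least
    [e * t k], so that the partial sums telescope. *)
Lemma raabe_cvg t e N : 0 < e ->
  (forall k, (N <= k)%N -> `|t k.+1| * k.+1%:R <= (k%:R - e) * `|t k|) ->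
  cvgn [normed series t].
Proof.
move=> e0 te.
apply: (@series_nat_shift_cvg _ N); apply: nondecreasing_is_cvgn.
  by apply/nondecreasing_seqP => n; rewrite /series/= big_nat_recr//= lerDl.
exists (e^-1 * (N%:R * `|t N|)) => _ [n _ <-] /=.
rewrite ler_pdivlMl//.
suff : e * series (fun k => `|t (k + N)%N|) n <= N%:R * `|t N| - (n + N)%:R * `|t (n + N)%N|.
  by move=> /le_trans; apply; rewrite gerBl mulr_ge0.
elim: n => [|n IH]; first by rewrite /series/= big_nil mulr0 add0n subrr.
rewrite /series/= big_nat_recr//= mulrDr.
have := te (n + N)%N (leq_addl _ _); rewrite -addSn mulrBl => H.
move: IH; rewrite /series/= => IH; lra.
Qed.

Lemma raabe_cvg_series t e N : 0 < e ->
  (forall k, (N <= k)%N -> `|t k.+1| * k.+1%:R <= (k%:R - e) * `|t k|) ->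
  cvgn (series t).
Proof. by move=> e0 te; apply: normed_cvg; exact: raabe_cvg te. Qed.

Lemma quadratic_eventually_ge0 (c d e : R) : 0 < c ->
  \forall k \near \oo, 0 <= c * k%:R ^+ 2 + d * k%:R + e.
Proof.
move=> c0; near=> k.
have k1 : 1 <= k%:R :> R by near: k; exact: nbhs_infty_ger.
have kM : (`|d| + `|e|) / c <= k%:R by near: k; exact: nbhs_infty_ger.
rewrite ler_pdivrMr// in kM.
have h1 : (`|d| + `|e|) * k%:R <= k%:R * c * k%:R by rewrite ler_wpM2r.
have h2 : - `|d| * k%:R <= d * k%:R by rewrite ler_wpM2r// lerNl -normrN ler_norm.
have h3 : - `|e| <= e by rewrite lerNl -normrN ler_norm.
have h4 : `|e| * 1 <= `|e| * k%:R by rewrite ler_wpM2l.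
have : k%:R * c * k%:R = c * k%:R ^+ 2 by ring.
lra.
Unshelve. all: by end_near. Qed.

Lemma cubic_eventually_ge0 (c d e f : R) : 0 < c ->
  \forall k \near \oo, 0 <= c * k%:R ^+ 3 + d * k%:R ^+ 2 + e * k%:R + f.
Proof.
move=> c0; near=> k.
have k1 : 1 <= k%:R :> R by near: k; exact: nbhs_infty_ger.
have h : 0 <= c * k%:R ^+ 2 + d * k%:R + (- `|e| - `|f|).
  by near: k; exact: quadratic_eventually_ge0.
have h2 : - `|e| * k%:R <= e * k%:R by rewrite ler_wpM2r// lerNl -normrN ler_norm.
have h3 : - `|f| <= f by rewrite lerNl -normrN ler_norm.
have h4 : `|f| * 1 <= `|f| * k%:R by rewrite ler_wpM2l.
have h5 : 0 <= k%:R * (c * k%:R ^+ 2 + d * k%:R + (- `|e| - `|f|)).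
  by rewrite mulr_ge0.
have : k%:R * (c * k%:R ^+ 2 + d * k%:R + (- `|e| - `|f|)) =
  c * k%:R ^+ 3 + d * k%:R ^+ 2 - `|e| * k%:R - `|f| * k%:R by ring.
lra.
Unshelve. all: by end_near. Qed.

End raabe.

Section hypergeometric_terms.
Context {R : realType}.
Implicit Types (a b z : R).

Definition hyp3F2_coef a1 a2 a3 b1 b2 (k : nat) : R :=
  pochhammer a1 k * pochhammer a2 k * pochhammer a3 k /
  (pochhammer b1 k * pochhammer b2 k) / k`!%:R.

Lemma hyp3F2E a1 a2 a3 b1 b2 z :
  hyp3F2 a1 a2 a3 b1 b2 z = limn (pseries (hyp3F2_coef a1 a2 a3 b1 b2) z).
Proof.
rewrite /hyp3F2 /pseries /hyp3F2_coef; congr (limn (series _)).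
by apply/funext => k /=; rewrite [LHS]mulrA mulrAC.
Qed.

Lemma hyp3F2_coefS a1 a2 a3 b1 b2 k :
  hyp3F2_coef a1 a2 a3 b1 b2 k.+1 =
  (a1 + k%:R) * (a2 + k%:R) * (a3 + k%:R) / ((b1 + k%:R) * (b2 + k%:R)) / k.+1%:R
  * hyp3F2_coef a1 a2 a3 b1 b2 k.
Proof.
by rewrite /hyp3F2_coef !pochhammerSr factS natrM !invfM; ring.
Qed.

Let add_nat_gt0 a : \forall k \near \oo, 0 < a + k%:R.
Proof.
near=> k; rewrite -ltrBlDl sub0r; near: k.
exact: nbhs_infty_gtr.
Unshelve. all: by end_near. Qed.

(** Raabe's condition compares two cubic polynomials in [k]. For [z < 1] the
    leading coefficients decide; for [z = 1] they agree, and the coefficients of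
    [k ^ 2] decide. *)
Lemma hyp3F2_coef_normed_cvg a1 a2 a3 b1 b2 z : 0 <= z ->
  z < 1 \/ z = 1 /\ a1 + a2 + a3 < b1 + b2 ->
  cvgn [normed pseries (hyp3F2_coef a1 a2 a3 b1 b2) z].
Proof.
move=> z0 zb.
have [e e0 [N _ HN]] : exists2 e : R, 0 < e & \forall k \near \oo,
    z * ((a1 + k%:R) * (a2 + k%:R) * (a3 + k%:R)) <=
    (k%:R - e) * ((b1 + k%:R) * (b2 + k%:R)).
  case: zb => [z1|[-> ab]].
    (* any positive [e] would do *)
    exists 1 => //; have : 0 < 1 - z by rewrite subr_gt0.
    move=> /cubic_eventually_ge0.
    move=> /(_ (b1 + b2 - 1 - z * (a1 + a2 + a3))
       (b1 * b2 - b1 - b2 - z * (a1 * a2 + a2 * a3 + a1 * a3))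
       (- b1 * b2 - z * (a1 * a2 * a3))).
    by apply: filterS => k H; rewrite -subr_ge0; apply: le_trans H _;
      rewrite le_eqVlt; apply/orP; left; apply/eqP; ring.
  pose e := (b1 + b2 - (a1 + a2 + a3)) / 2.
  have e0 : 0 < e by rewrite divr_gt0// subr_gt0.
  exists e => //; move: (e0) => /quadratic_eventually_ge0.
  move=> /(_ (b1 * b2 - e * (b1 + b2) - (a1 * a2 + a2 * a3 + a1 * a3))
       (- e * b1 * b2 - (a1 * a2 * a3))).
  apply: filterS => k H; rewrite -subr_ge0; apply: le_trans H _.
  by rewrite le_eqVlt; apply/orP; left; apply/eqP; rewrite /e; field.
have [N' _ HN'] : \forall k \near \oo,
  [/\ 0 < a1 + k%:R, 0 < a2 + k%:R, 0 < a3 + k%:R, 0 < b1 + k%:R & 0 < b2 + k%:R].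
  near=> k; split; near: k; exact: add_nat_gt0.
apply: (@raabe_cvg _ _ e (maxn N N')) => // k kN.
have {}HN := HN k (leq_trans (leq_maxl _ _) kN).
have [p1 p2 p3 p4 p5] := HN' k (leq_trans (leq_maxr _ _) kN).
rewrite /= hyp3F2_coefS exprS.
set r := _ / _ / _; set h := hyp3F2_coef _ _ _ _ _ _.
have r0 : 0 <= r by rewrite /r !divr_ge0 ?mulr_ge0 ?ltW.
have -> : `|r * h * (z * z ^+ k)| * k.+1%:R = (z * r * k.+1%:R) * `|h * z ^+ k|.
  by rewrite (normrM (r * h)) (normrM r) (normrM h) (normrM z) (ger0_norm r0) (ger0_norm z0); ring.
rewrite ler_wpM2r//.
have -> : z * r * k.+1%:R =
    z * ((a1 + k%:R) * (a2 + k%:R) * (a3 + k%:R)) / ((b1 + k%:R) * (b2 + k%:R)).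
  have kp : 0 < k%:R + 1 :> R by rewrite natr1.
  by rewrite /r -natr1; field; rewrite !gt_eqF.
by rewrite ler_pdivrMr// mulr_gt0.
Unshelve. all: by end_near. Qed.

End hypergeometric_terms.

Section nonnegative_series.
Context {R : realType}.
Notation mu := (@lebesgue_measure R).

Lemma EFin_series (f : nat -> R) : cvgn (series f) ->
  (\sum_(k <oo) (f k)%:E = (limn (series f))%:E)%E.
Proof.
move=> cf; rewrite -EFin_lim//; congr (limn _); apply/funext => n.
by rewrite /series/= sumEFin.
Qed.

(** Newton's binomial series, obtained by expanding the factor [exp (t u)] in the
    Gamma integral representation of [(1 - u) ^ (- b)]. *)
Lemma binomial_series (b u : R) : 0 < b -> 0 <= u < 1 ->
  (\sum_(k <oo) (pochhammer b k / k`!%:R * u ^+ k)%:E = ((1 - u) `^ (- b))%:E)%E.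
Proof.
move=> b0 /andP[u0 u1]; have u1' : 0 < 1 - u by rewrite subr_gt0.
have gb := euler_Gamma_gt0 b0.
have mD := @measurable_itv R `]0%R, +oo[.
pose e (k : nat) (t : R) : R := u ^+ k / k`!%:R * gamma_integrand (b + k%:R) t.
have c0 (k : nat) : 0 <= u ^+ k / k`!%:R by rewrite divr_ge0// exprn_ge0.
have e0 k t : 0 <= e k t by rewrite mulr_ge0 ?gamma_integrand_ge0.
have : (\int[mu]_(t in `]0%R, +oo[) (t `^ (b - 1) * expR (- ((1 - u) * t)))%:E =
    \int[mu]_(t in `]0%R, +oo[) (\sum_(k <oo) (e k t)%:E))%E.
  apply: eq_integral => t /set_mem/=; rewrite in_itv/= andbT => t0.
  rewrite (_ : - ((1 - u) * t) = - t + u * t); last by ring.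
  rewrite expRD mulrA EFinM /expR -(EFin_series (is_cvg_series_exp_coeff _)).
  rewrite -nneseriesZl; last first.
    by move=> k _; rewrite lee_fin divr_ge0// exprn_ge0// mulr_ge0// ltW.
  apply: eq_eseriesr => k _; rewrite -EFinM; congr EFin.
  rewrite /e /gamma_integrand /exp_coeff/= exprMn.
  have -> : t `^ (b + k%:R - 1) = t `^ (b - 1) * t ^+ k.
    by rewrite -(powR_mulrn _ (ltW t0)) -(powRD_gt0 _ _ t0); congr (_ `^ _); ring.
  by rewrite -/(expR (- t)); ring.
rewrite (gammae_scale b0 u1') integral_nneseries; last 3 first.
- exact: mD.
- move=> k; apply/measurable_EFinP; apply: measurable_funM; first exact: measurable_cst.
  exact: measurable_gamma_integrand.
- by move=> k t _; rewrite lee_fin.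
have -> : (\sum_(k <oo) \int[mu]_(t in `]0%R, +oo[) (e k t)%:E =
    \sum_(k <oo) ((euler_Gamma b)%:E * (pochhammer b k / k`!%:R * u ^+ k)%:E))%E.
  apply: eq_eseriesr => k _.
  have bk : 0 < b + k%:R by rewrite ltr_wpDr.
  rewrite (ge0_integralZl_total mD (c0 k) (gamma_integrand_ge0 _)
     (@measurable_gamma_integrand R (b + k%:R) setT)).
  rewrite -/(gammae (b + k%:R)) (gammae_euler bk) -!EFinM.
  rewrite -(Gamma_euler bk) (Gamma_pochhammer _ b0) (Gamma_euler b0); congr EFin; ring.
rewrite nneseriesZl; last first.
  by move=> k _; rewrite lee_fin mulr_ge0 ?exprn_ge0// divr_ge0// ltW// pochhammer_gt0.
set S := (\sum_(k <oo) _)%E => H.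
have : ((euler_Gamma b)^-1%:E * ((1 - u) `^ (- b) * euler_Gamma b)%:E =
  (euler_Gamma b)^-1%:E * ((euler_Gamma b)%:E * S))%E by rewrite H.
rewrite muleA -!EFinM (mulVf (lt0r_neq0 gb)) mul1e => <-.
by rewrite mulrC (mulfK (lt0r_neq0 gb)).
Qed.

End nonnegative_series.

(** * Incomplete beta integrals as series *)

Section power_integrals.
Context {R : realType}.
Notation mu := (@lebesgue_measure R).
Implicit Types (m y : R).

Lemma integral_powR_itv0 m y : 0 < m -> 0 < y ->
  (\int[mu]_(u in `]0%R, y[) (u `^ (m - 1))%:E = (y `^ m / m)%:E)%E.
Proof.
move=> m0 y0; have [u [v [uv u0 ucvg vy vcvg]]] := exhausts_itvoo y0.
rewrite (@ge0_FTC_exhausts _ _ u v _ (fun t => m^-1 * t `^ m) 0 (y `^ m / m) uv) ?subr0//.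
- move=> t /=; rewrite in_itv/= => /andP[t0 _]; rewrite /has_derivative.
  have -> : t `^ (m - 1) = m^-1 * (m * t `^ (m - 1)) by rewrite mulKf// gt_eqF.
  by apply: is_derive_cstM; exact: is_derive1_powR.
- by move=> t /=; rewrite in_itv/= => /andP[t0 _]; exact: powR_continuous.
- by rewrite -(mulr0 m^-1); apply: cvgM; [exact: cvg_cst|exact: powR_cvg0n].
- rewrite mulrC; apply: cvgM; first exact: cvg_cst.
  by apply: (@cvg_comp _ _ _ v (@powR R ^~ m) _ _ _ vcvg); exact: powR_continuous.
- by apply: measurable_funTS; measR.
- by move=> t _; rewrite powR_ge0.
Qed.

Lemma integral_powR_itvy m y : 0 < m -> 0 < y ->
  (\int[mu]_(u in `]y, +oo[) (u `^ (- m - 1))%:E = (y `^ (- m) / m)%:E)%E.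
Proof.
move=> m0 y0; have [u [v [uv yu ucvg vcvg]]] := exhausts_itvoy y.
rewrite (@ge0_FTC_exhausts _ _ u v _ (fun t => - m^-1 * t `^ (- m)) (- (y `^ (- m) / m)) 0 uv)
  ?sub0r ?opprK//.
- move=> t /=; rewrite in_itv/= andbT => yt; rewrite /has_derivative.
  have t0 : 0 < t by rewrite (lt_trans y0).
  have -> : t `^ (- m - 1) = - m^-1 * (- m * t `^ (- m - 1)).
    by rewrite !mulNr mulrN opprK mulKf// gt_eqF.
  by apply: is_derive_cstM; exact: is_derive1_powR.
- move=> t /=; rewrite in_itv/= andbT => yt; apply: powR_continuous.
  by rewrite (lt_trans y0).
- rewrite mulrC -mulNr; apply: cvgM; first exact: cvg_cst.
  by apply: (@cvg_comp _ _ _ u (@powR R ^~ (- m)) _ _ _ ucvg); exact: powR_continuous.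
- by rewrite -(mulr0 (- m^-1)); apply: cvgM; [exact: cvg_cst|exact: powRN_cvgyn].
- by apply: measurable_funTS; measR.
- by move=> t _; rewrite powR_ge0.
Qed.

End power_integrals.

Section incomplete_beta.
Context {R : realType}.
Notation mu := (@lebesgue_measure R).
Implicit Types (r e b y : R) (k : nat).

Definition binom_coef b k : R := pochhammer b k / k`!%:R.

Lemma binom_coef_ge0 b k : 0 < b -> 0 <= binom_coef b k.
Proof. by move=> b0; rewrite divr_ge0// ltW// pochhammer_gt0. Qed.

(** The terms of the expansion of the incomplete beta integral
    [\int_0^y u ^ (e - 1) * (1 - u ^ r) ^ (- b) du]. *)
Definition ibeta_term b r e y k : R :=
  binom_coef b k * (y `^ (r * k%:R + e) / (r * k%:R + e)).

Let rke r e k : 0 < r -> 0 < e -> 0 < r * k%:R + e.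
Proof. by move=> r0 e0; rewrite ltr_wpDl// mulr_ge0// ltW. Qed.

Lemma ibeta_term_ge0 b r e y k : 0 < b -> 0 < r -> 0 < e -> 0 <= ibeta_term b r e y k.
Proof.
by move=> b0 r0 e0; rewrite mulr_ge0 ?binom_coef_ge0// divr_ge0 ?powR_ge0// ltW ?rke.
Qed.

Let powR_exp_sum r c u k : 0 < u -> u `^ c * (u `^ r) ^+ k = u `^ (r * k%:R + c).
Proof.
move=> u0; rewrite -(powR_mulrn _ (powR_ge0 _ _)) -powRrM -(powRD_gt0 _ _ u0).
by rewrite addrC.
Qed.

Let binomial_series_powR b r c (u : R) : 0 < b -> 0 < u -> 0 <= u `^ r < 1 ->
  (\sum_(k <oo) (binom_coef b k * u `^ (r * k%:R + c))%:E =
   (u `^ c * (1 - u `^ r) `^ (- b))%:E)%E.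
Proof.
move=> b0 u0 ur; rewrite EFinM -(binomial_series b0 ur) -nneseriesZl; last first.
  move=> k _; rewrite lee_fin mulr_ge0 ?binom_coef_ge0// exprn_ge0//.
  by case/andP: ur.
apply: eq_eseriesr => k _; rewrite -EFinM; congr EFin.
by rewrite -powR_exp_sum// mulrCA.
Qed.

Lemma ibeta_series_itv0 b r e y : 0 < b -> 0 < r -> 0 < e -> 0 < y <= 1 ->
  (\int[mu]_(u in `]0%R, y[) (u `^ (e - 1) * (1 - u `^ r) `^ (- b))%:E =
   \sum_(k <oo) (ibeta_term b r e y k)%:E)%E.
Proof.
move=> b0 r0 e0 /andP[y0 y1].
transitivity (\int[mu]_(u in `]0%R, y[)
   \sum_(k <oo) (binom_coef b k * u `^ (r * k%:R + (e - 1)))%:E)%E.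
  apply: eq_integral => u /set_mem/=; rewrite in_itv/= => /andP[u0 uy].
  rewrite (binomial_series_powR _ b0 u0)// powR_ge0/=.
  by rewrite powR_lt1// u0 (lt_le_trans uy).
rewrite integral_nneseries; last 3 first.
- exact: measurable_itv.
- by move=> k; apply/measurable_EFinP; apply: measurable_funTS; measR.
- by move=> k u _; rewrite lee_fin mulr_ge0 ?binom_coef_ge0 ?powR_ge0.
apply: eq_eseriesr => k _.
rewrite ge0_integralZl_total; last 4 first.
- exact: measurable_itv.
- exact: binom_coef_ge0.
- by move=> u; rewrite powR_ge0.
- by measR.
by rewrite addrA (integral_powR_itv0 (rke k r0 e0) y0).
Qed.

(** The inversion [u |-> 1 / u] explains that the series of the tail at infinity
    is the previous one at [1 / y]. *)
Lemma ibeta_series_itvy b r e y : 0 < b -> 0 < r -> 0 < e -> 1 <= y ->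
  (\int[mu]_(u in `]y, +oo[) (u `^ (- e - 1) * (1 - u `^ (- r)) `^ (- b))%:E =
   \sum_(k <oo) (ibeta_term b r e (y `^ (-1)) k)%:E)%E.
Proof.
move=> b0 r0 e0 y1; have y0 : 0 < y by rewrite (lt_le_trans ltr01).
transitivity (\int[mu]_(u in `]y, +oo[)
   \sum_(k <oo) (binom_coef b k * u `^ (- r * k%:R + (- e - 1)))%:E)%E.
  apply: eq_integral => u /set_mem/=; rewrite in_itv/= andbT => uy.
  have u0 : 0 < u by rewrite (lt_trans y0).
  have u1 : 1 < u by rewrite (le_lt_trans y1).
  rewrite (binomial_series_powR _ b0 u0)// powR_ge0/=.
  by rewrite powRN invf_lt1 ?powR_gt1// powR_gt0.
rewrite integral_nneseries; last 3 first.
- exact: measurable_itv.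
- by move=> k; apply/measurable_EFinP; apply: measurable_funTS; measR.
- by move=> k u _; rewrite lee_fin mulr_ge0 ?binom_coef_ge0 ?powR_ge0.
apply: eq_eseriesr => k _.
rewrite ge0_integralZl_total; last 4 first.
- exact: measurable_itv.
- exact: binom_coef_ge0.
- by move=> u; rewrite powR_ge0.
- by measR.
have -> : - r * k%:R + (- e - 1) = - (r * k%:R + e) - 1 by ring.
rewrite (integral_powR_itvy (rke k r0 e0) y0) -EFinM; congr EFin.
by rewrite /ibeta_term -powRrM mulN1r.
Qed.

End incomplete_beta.

Section beta_transform.
Context {R : realType}.
Notation mu := (@lebesgue_measure R).
Implicit Types (b A B d z r e s : R).

Lemma pochhammer_shift d k : pochhammer d k * (d + k%:R) = d * pochhammer (d + 1) k.
Proof. by rewrite -pochhammerSr pochhammerS. Qed.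

(** As functions of [k], both [Beta (A + k) B] and [1 / (k + d)] are proportional to
    ratios of Pochhammer symbols. The condition [b < 1] makes the sum converge at
    [z = 1]. *)
Lemma hyp3F2_Beta_sum b A B d z : 0 < b < 1 -> 0 < A -> 0 < B -> 0 < d -> 0 <= z <= 1 ->
  (\sum_(k <oo) (binom_coef b k * (z ^+ k / (k%:R + d) * Beta (A + k%:R) B))%:E =
   (Beta A B / d * hyp3F2 b A d (A + B) (d + 1) z)%:E)%E.
Proof.
move=> /andP[b0 b1] A0 B0 d0 /andP[z0 z1].
have AB0 : 0 < A + B by rewrite addr_gt0.
have d1 : 0 < d + 1 by rewrite addr_gt0.
rewrite hyp3F2E EFinM -EFin_series; last first.
  apply: normed_cvg; apply: hyp3F2_coef_normed_cvg => //.
  move: z1; rewrite le_eqVlt => /predU1P[->|]; [right; split => //; lra|by left].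
have Bd : 0 <= Beta A B / d by rewrite divr_ge0 ?ltW// Beta_gt0.
rewrite -nneseriesZl; last first.
  move=> k _; rewrite lee_fin mulr_ge0 ?exprn_ge0// /hyp3F2_coef.
  by rewrite !divr_ge0 ?mulr_ge0 ?ltW ?pochhammer_gt0.
apply: eq_eseriesr => k _; rewrite -EFinM; congr EFin.
rewrite Beta_pochhammer// /binom_coef /hyp3F2_coef/=.
have dk : 0 < d + k%:R by rewrite ltr_wpDr.
have -> : pochhammer d k = d * pochhammer (d + 1) k / (d + k%:R).
  by rewrite -pochhammer_shift mulfK// gt_eqF.
by field; rewrite !gt_eqF ?pochhammer_gt0//= addrC.
Qed.

(** The terms are powers of [x], so that their integrals against the weight are
    complete beta integrals, which [hyp3F2_Beta_sum] adds up. *)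
Lemma beta_transform_itv01 b r e s alpha beta :
  0 < b < 1 -> 0 < r -> 0 < e -> 0 < s <= 1 -> alpha < e + 1 -> beta < 1 ->
  (\int[mu]_(x in `]0%R, 1%R[)
     \sum_(k <oo) (ibeta_term b r e (s * x)%R k
                   * (x `^ (- alpha) * (1 - x `^ r) `^ (- beta)))%:E =
   (s `^ e / (r * e) * Beta ((e + 1 - alpha) / r) (1 - beta) *
    hyp3F2 b ((e + 1 - alpha) / r) (e / r)
      ((e + 1 - alpha) / r + (1 - beta)) (e / r + 1) (s `^ r))%:E)%E.
Proof.
move=> b01 r0 e0 /andP[s0 s1] ae be; have /andP[b0 b1] := b01.
have A0 : 0 < (e + 1 - alpha) / r by rewrite divr_gt0// subr_gt0.
have B0 : 0 < 1 - beta by rewrite subr_gt0.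
have d0 : 0 < e / r by rewrite divr_gt0.
have z01 : 0 <= s `^ r <= 1.
  rewrite powR_ge0/= -(powRr0 s); apply: ger_powR; rewrite ?s0//; exact: ltW.
set A := (e + 1 - alpha) / r; set B := 1 - beta.
rewrite integral_nneseries; last 3 first.
- exact: measurable_itv.
- by move=> k; apply/measurable_EFinP; apply: measurable_funTS; rewrite /ibeta_term; measR.
- by move=> k x _; rewrite lee_fin mulr_ge0 ?ibeta_term_ge0 ?mulr_ge0 ?powR_ge0.
have se : 0 <= s `^ e / r ^+ 2 by rewrite divr_ge0 ?powR_ge0 ?exprn_ge0// ltW.
transitivity ((s `^ e / r ^+ 2)%:E * \sum_(k <oo)
   (binom_coef b k * ((s `^ r) ^+ k / (k%:R + e / r) * Beta (A + k%:R) B))%:E)%E.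
  rewrite -nneseriesZl; last first.
    move=> k _; rewrite lee_fin mulr_ge0 ?binom_coef_ge0// mulr_ge0//.
      by rewrite divr_ge0 ?exprn_ge0 ?powR_ge0// addr_ge0// ltW.
    by rewrite ltW// Beta_gt0// ltr_wpDr.
  apply: eq_eseriesr => k _.
  have Ak : 0 < A + k%:R by rewrite ltr_wpDr.
  have rk : 0 < r * k%:R + e by rewrite ltr_wpDl// mulr_ge0// ltW.
  transitivity ((binom_coef b k * (s `^ (r * k%:R + e) / (r * k%:R + e)))%:E *
     \int[mu]_(x in `]0%R, 1%R[) (x `^ (r * (A + k%:R) - 1) * (1 - x `^ r) `^ (B - 1))%:E)%E.
    rewrite -ge0_integralZl_total; last 4 first.
    - exact: measurable_itv.
    - by rewrite mulr_ge0 ?binom_coef_ge0// divr_ge0 ?powR_ge0// ltW.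
    - by move=> x; rewrite mulr_ge0 ?powR_ge0.
    - by measR.
    apply: eq_integral => x /set_mem/=; rewrite in_itv/= => /andP[x0 x1].
    rewrite /ibeta_term (powRM _ (ltW s0) (ltW x0)); congr EFin.
    have -> : B - 1 = - beta by rewrite /B; ring.
    have -> : x `^ (r * (A + k%:R) - 1) = x `^ (r * k%:R + e) * x `^ (- alpha).
      rewrite -(powRD_gt0 _ _ x0); congr (_ `^ _); rewrite /A; field.
      by rewrite gt_eqF.
    ring.
  rewrite (Beta_integral_powR r0 Ak B0) -!EFinM; congr EFin.
  have -> : s `^ (r * k%:R + e) = s `^ e * (s `^ r) ^+ k.
    rewrite -(powR_mulrn _ (powR_ge0 _ _)) -powRrM -(powRD_gt0 _ _ s0).
    by rewrite addrC.
  have -> : k%:R + e / r = (r * k%:R + e) / r by field; rewrite gt_eqF.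
  by field; rewrite !gt_eqF.
rewrite (hyp3F2_Beta_sum b01 A0 B0 d0 z01) -EFinM; congr EFin.
by rewrite /A /B; field; rewrite !gt_eqF.
Qed.

Lemma beta_transform_itv1y b r e s gamma beta :
  0 < b < 1 -> 0 < r -> 0 < e -> 1 <= s -> 1 < e + gamma -> beta < 1 ->
  (\int[mu]_(x in `]1%R, +oo[)
     \sum_(k <oo) (ibeta_term b r e ((s * x) `^ (-1)) k
                   * (x `^ (- gamma) * (1 - x `^ (- r)) `^ (- beta)))%:E =
   (s `^ (- e) / (r * e) * Beta ((e + gamma - 1) / r) (1 - beta) *
    hyp3F2 b ((e + gamma - 1) / r) (e / r)
      ((e + gamma - 1) / r + (1 - beta)) (e / r + 1) (s `^ (- r)))%:E)%E.
Proof.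
move=> b01 r0 e0 s1 ge be; have /andP[b0 b1] := b01.
have s0 : 0 < s by rewrite (lt_le_trans ltr01).
have A0 : 0 < (e + gamma - 1) / r by rewrite divr_gt0// subr_gt0.
have B0 : 0 < 1 - beta by rewrite subr_gt0.
have d0 : 0 < e / r by rewrite divr_gt0.
have z01 : 0 <= s `^ (- r) <= 1.
  rewrite powR_ge0/= -(powRr0 s); apply: ler_powR => //; by rewrite oppr_le0 ltW.
set A := (e + gamma - 1) / r; set B := 1 - beta.
rewrite integral_nneseries; last 3 first.
- exact: measurable_itv.
- by move=> k; apply/measurable_EFinP; apply: measurable_funTS; rewrite /ibeta_term; measR.
- by move=> k x _; rewrite lee_fin mulr_ge0 ?ibeta_term_ge0 ?mulr_ge0 ?powR_ge0.
have se : 0 <= s `^ (- e) / r ^+ 2 by rewrite divr_ge0 ?powR_ge0 ?exprn_ge0// ltW.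
transitivity ((s `^ (- e) / r ^+ 2)%:E * \sum_(k <oo)
   (binom_coef b k * ((s `^ (- r)) ^+ k / (k%:R + e / r) * Beta (A + k%:R) B))%:E)%E.
  rewrite -nneseriesZl; last first.
    move=> k _; rewrite lee_fin mulr_ge0 ?binom_coef_ge0// mulr_ge0//.
      by rewrite divr_ge0 ?exprn_ge0 ?powR_ge0// addr_ge0// ltW.
    by rewrite ltW// Beta_gt0// ltr_wpDr.
  apply: eq_eseriesr => k _.
  have Ak : 0 < A + k%:R by rewrite ltr_wpDr.
  have rk : 0 < r * k%:R + e by rewrite ltr_wpDl// mulr_ge0// ltW.
  transitivity ((binom_coef b k * (s `^ (- (r * k%:R + e)) / (r * k%:R + e)))%:E *
     \int[mu]_(x in `]1%R, +oo[)
       (x `^ (- r * (A + k%:R) - 1) * (1 - x `^ (- r)) `^ (B - 1))%:E)%E.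
    rewrite -ge0_integralZl_total; last 4 first.
    - exact: measurable_itv.
    - by rewrite mulr_ge0 ?binom_coef_ge0// divr_ge0 ?powR_ge0// ltW.
    - by move=> x; rewrite mulr_ge0 ?powR_ge0.
    - by measR.
    apply: eq_integral => x /set_mem/=; rewrite in_itv/= andbT => x1.
    have x0 : 0 < x by rewrite (lt_trans ltr01).
    rewrite /ibeta_term -powRrM mulN1r.
    rewrite (powRM _ (ltW s0) (ltW x0)); congr EFin.
    have -> : B - 1 = - beta by rewrite /B; ring.
    have -> : x `^ (- r * (A + k%:R) - 1) = x `^ (- (r * k%:R + e)) * x `^ (- gamma).
      rewrite -(powRD_gt0 _ _ x0); congr (_ `^ _); rewrite /A; field.
      by rewrite gt_eqF.
    ring.
  rewrite (Beta_integral_powRN r0 Ak B0) -!EFinM; congr EFin.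
  have -> : s `^ (- (r * k%:R + e)) = s `^ (- e) * (s `^ (- r)) ^+ k.
    rewrite -(powR_mulrn _ (powR_ge0 _ _)) -powRrM -(powRD_gt0 _ _ s0).
    by congr (_ `^ _); ring.
  have -> : k%:R + e / r = (r * k%:R + e) / r by field; rewrite gt_eqF.
  by field; rewrite !gt_eqF.
rewrite (hyp3F2_Beta_sum b01 A0 B0 d0 z01) -EFinM; congr EFin.
by rewrite /A /B; field; rewrite !gt_eqF.
Qed.

End beta_transform.

(** * Series for arcsin, arccos and arccosh *)

Section integral_tools.
Context {R : realType}.
Notation mu := (@lebesgue_measure R).

Lemma ge0_integral_itv_split (a b : itv_bound R) (y : R) (f : R -> R) :
  (a <= BLeft y)%O -> (BRight y <= b)%O ->
  measurable_fun [set: R] f -> (forall x, 0 <= f x) ->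
  (\int[mu]_(x in [set` Interval a b]) (f x)%:E =
   \int[mu]_(x in [set` Interval a (BLeft y)]) (f x)%:E +
   \int[mu]_(x in [set` Interval (BRight y) b]) (f x)%:E)%E.
Proof.
move=> ay yb mf f0.
have mf' D : measurable_fun D (EFin \o f).
  by apply/measurable_EFinP; exact: measurable_funTS.
rewrite (integral_itv_obnd_cbnd (mf' _)).
have yb' : (BLeft y <= b)%O by apply: le_trans yb; rewrite bnd_simp.
rewrite (itv_bndbnd_setU ay yb') ge0_integral_setU//.
- exact: mf'.
- by move=> x _; rewrite lee_fin.
- apply/disj_setPRL => x /=; rewrite !itv_boundlr => /andP[yx _].
  by apply/negP; rewrite negb_and -!ltNge /=; apply/orP; right; rewrite bnd_simp in yx *.
Qed.

(** Integrating [g - \sum_k e k], a difference whose subtrahend is only known as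
    a series of nonnegative terms. *)
Lemma integral_sub_nneseries (D : set R) (F g : R -> R) (e : nat -> R -> R) (c1 c2 : R) :
  measurable D -> measurable_fun [set: R] g -> (forall x, 0 <= g x) ->
  (forall k, measurable_fun D (e k)) -> (forall k x, 0 <= e k x) ->
  (forall x, D x -> (F x)%:E + \sum_(k <oo) (e k x)%:E = (g x)%:E)%E ->
  (\int[mu]_(x in D) (g x)%:E = c1%:E)%E ->
  (\int[mu]_(x in D) \sum_(k <oo) (e k x)%:E = c2%:E)%E ->
  (\int[mu]_(x in D) (F x)%:E = (c1 - c2)%:E)%E.
Proof.
move=> mD mg g0 me e0 Fe ig ie.
have se0 x : (0 <= \sum_(k <oo) (e k x)%:E)%E.
  by apply: nneseries_ge0 => k _ _; rewrite lee_fin.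
have mS : measurable_fun D (fun x => \sum_(k <oo) (e k x)%:E)%E.
  have := @ge0_emeasurable_sum _ _ R D (fun k x => (e k x)%:E) xpredT.
  apply; first by move=> k x _ _; rewrite lee_fin.
  by move=> k _; exact/measurable_EFinP.
transitivity (\int[mu]_(x in D) ((g x)%:E - \sum_(k <oo) (e k x)%:E))%E.
  apply: eq_integral => x /set_mem Dx; rewrite -(Fe x Dx).
  have := Fe x Dx; have := se0 x.
  by case: (\sum_(k <oo) _)%E => [z _ _| |]//; rewrite addeK.
rewrite integralB//.
- by rewrite ig ie.
- apply/integrableP; split; first by apply/measurable_EFinP; exact: measurable_funTS.
  under eq_integral do rewrite gee0_abs ?lee_fin//.
  by rewrite ig ltry.
- apply/integrableP; split => //.
  under eq_integral do rewrite gee0_abs//.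
  by rewrite ie ltry.
Qed.

Lemma integral_nneseriesZl (D : set R) (c : R) (e : nat -> R -> R) :
  measurable D -> 0 <= c ->
  (forall k, measurable_fun D (e k)) -> (forall k x, 0 <= e k x) ->
  (\int[mu]_(x in D) \sum_(k <oo) (c * e k x)%:E =
   c%:E * \int[mu]_(x in D) \sum_(k <oo) (e k x)%:E)%E.
Proof.
move=> mD c0 me e0; rewrite !integral_nneseries//; last 4 first.
- by move=> k; apply/measurable_EFinP; exact: me.
- by move=> k x _; rewrite lee_fin.
- by move=> k; apply/measurable_EFinP; apply: measurable_funM; [exact: measurable_cst|exact: me].
- by move=> k x _; rewrite lee_fin mulr_ge0.
rewrite -nneseriesZl; last by move=> k _; apply: integral_ge0 => x _; rewrite lee_fin.
apply: eq_eseriesr => k _; under eq_integral do rewrite EFinM.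
rewrite ge0_integralZl_EFin//; first by move=> x _; rewrite lee_fin.
by apply/measurable_EFinP; exact: me.
Qed.

Lemma powR_lt (x y r : R) : 0 < r -> 0 <= x -> x < y -> x `^ r < y `^ r.
Proof.
move=> r0 x0 xy; apply: gt0_ltr_powR; rewrite ?nnegrE//.
by rewrite (le_trans x0)// ltW.
Qed.

End integral_tools.

Section arc_functions.
Context {R : realType}.
Notation mu := (@lebesgue_measure R).
Implicit Types (p q x y b r e : R).

Lemma ibeta_series_lty b r e y : 0 < b < 1 -> 0 < r -> 0 < e -> 0 < y <= 1 ->
  (\sum_(k <oo) (ibeta_term b r e y k)%:E < +oo)%E.
Proof.
move=> /andP[b0 b1] r0 e0 /andP[y0 y1].
rewrite -ibeta_series_itv0 ?y0//.
have er : 0 < e / r by rewrite divr_gt0.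
have b1' : 0 < 1 - b by rewrite subr_gt0.
apply: (@le_lt_trans _ _ (r^-1 * Beta (e / r) (1 - b))%:E); last exact: ltry.
rewrite -(Beta_integral_powR r0 er b1').
have -> : r * (e / r) - 1 = e - 1 by rewrite mulrC divfK// gt_eqF.
have -> : 1 - b - 1 = - b by lra.
apply: ge0_subset_integral => //.
- by apply/measurable_EFinP; apply: measurable_funTS; measR.
- by move=> x _; rewrite lee_fin mulr_ge0 ?powR_ge0.
- by move=> x /=; rewrite !in_itv/= => /andP[-> xy]; rewrite (lt_le_trans xy).
Qed.

Lemma integral_arcsin_pq p q y :
  arcsin_pq p q y = fine (\int[mu]_(t in `]0%R, y[) ((1 - t `^ q) `^ (- p^-1))%:E)%E.
Proof.
rewrite /arcsin_pq /Rintegral integral_itv_bndoo//.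
by apply/measurable_EFinP; apply: measurable_funTS; measR.
Qed.

Lemma integral_arcsinh_pq p q y :
  arcsinh_pq p q y = fine (\int[mu]_(t in `]0%R, y[) ((1 + t `^ q) `^ (- p^-1))%:E)%E.
Proof.
rewrite /arcsinh_pq /Rintegral integral_itv_bndoo//.
by apply/measurable_EFinP; apply: measurable_funTS; measR.
Qed.

Lemma arcsin_pq_series p q y : 1 < p -> 1 < q -> 0 < y <= 1 ->
  ((arcsin_pq p q y)%:E = \sum_(k <oo) (ibeta_term p^-1 q 1 y k)%:E)%E.
Proof.
move=> p1 q1 y01; have p0 : 0 < p by rewrite (lt_trans ltr01).
have q0 : 0 < q by rewrite (lt_trans ltr01).
have pV : 0 < p^-1 < 1 by rewrite invr_gt0 p0 invf_lt1.
have /andP[pV0 _] := pV.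
have E : (\int[mu]_(t in `]0%R, y[) ((1 - t `^ q) `^ (- p^-1))%:E =
    \sum_(k <oo) (ibeta_term p^-1 q 1 y k)%:E)%E.
  rewrite -(ibeta_series_itv0 pV0 q0 ltr01 y01).
  by apply: eq_integral => t _; rewrite subrr powRr0 mul1r.
rewrite integral_arcsin_pq E fineK// ge0_fin_numE.
  exact: ibeta_series_lty.
by apply: nneseries_ge0 => k _ _; rewrite lee_fin ibeta_term_ge0.
Qed.

(** The substitution [t = (1 - u ^ p) ^ (1 / q)] turns the integral defining
    [arcsin] into the tail of a beta integral. *)
Lemma arccos_pq_integral p q y : 1 < p -> 1 < q -> 0 < y < 1 ->
  (\int[mu]_(t in `]0%R, ((1 - y `^ p) `^ q^-1)%R[) ((1 - t `^ q) `^ (- p^-1))%:E =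
   \int[mu]_(u in `]y, 1%R[) (p / q * (u `^ (p - 1 - 1) * (1 - u `^ p) `^ (- (1 - q^-1))))%:E)%E.
Proof.
move=> p1 q1 /andP[y0 y1]; have p0 : 0 < p by rewrite (lt_trans ltr01).
have q0 : 0 < q by rewrite (lt_trans ltr01).
have [u [v [uv _ _ _ _]]] := exhausts_itvoo y1.
have inI x : [set` `]y, 1%R[] x -> [/\ y < x, x < 1 & 0 < x].
  by rewrite /= in_itv/= => /andP[? ?]; split => //; exact: lt_trans y0 _.
have inJ t : [set` `]0%R, ((1 - y `^ p) `^ q^-1)%R[] t ->
    [/\ 0 < t, y `^ p < 1 - t `^ q & 1 - t `^ q < 1].
  rewrite /= in_itv/= => /andP[t0 tY]; split => //.
    have := powR_lt q0 (ltW t0) tY.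
    rewrite powRVK ?gt_eqF//; first lra.
    by rewrite subr_ge0 ltW// powR_lt1// y0.
  by rewrite gtrBl powR_gt0.
have px x : 0 < x < 1 -> 0 < 1 - x `^ p by move=> x01; rewrite subr_gt0 powR_lt1.
rewrite (ge0_subst_decr (phi := fun u => (1 - u `^ p) `^ q^-1)
  (psi := fun t => (1 - t `^ q) `^ p^-1)
  (dphi := fun u => q^-1 * (1 - u `^ p) `^ (q^-1 - 1) * (0 - p * u `^ (p - 1))) uv).
- apply: eq_integral => x /set_mem/inI[yx x1 x0]; congr EFin.
  have xp : 0 < 1 - x `^ p by rewrite px// x0.
  rewrite powRVK ?gt_eqF//; last exact: ltW.
  have -> : 1 - (1 - x `^ p) = x `^ p by ring.
  have -> : x `^ (p - 1 - 1) = (x `^ p) `^ (- p^-1) * x `^ (p - 1).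
    rewrite -powRrM -(powRD_gt0 _ _ x0); congr (_ `^ _); field.
    by rewrite gt_eqF.
  have -> : - (1 - q^-1) = q^-1 - 1 by ring.
  ring.
- exact: itv_open.
- exact: interval_is_interval.
- move=> x /inI[yx x1 x0]; rewrite /has_derivative.
  apply: (@is_derive_powRf R (fun u => 1 - u `^ p)); first by rewrite px// x0.
  by apply: is_derive_funB; exact: is_derive1_powR.
- move=> x /inI[yx x1 x0]; apply: cvgM.
    apply: cvgM; first exact: cvg_cst.
    apply: (@continuous_powRf R (fun u => 1 - u `^ p)); first by rewrite px// x0.
    by apply: cvgB; [exact: cvg_cst|exact: powR_continuous].
  apply: cvgB; first exact: cvg_cst.
  by apply: cvgM; [exact: cvg_cst|exact: powR_continuous].
- move=> x /inI[yx x1 x0]; rewrite /= in_itv/= powR_gt0 ?px ?x0//=.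
  apply: powR_lt; rewrite ?invr_gt0//; first by rewrite ltW// px// x0.
  by rewrite ltrD2l ltrN2 powR_lt// ltW.
- move=> t /inJ[t0 t1 t2]; rewrite /= in_itv/=.
  have yp : 0 < y `^ p by rewrite powR_gt0.
  rewrite -[ltLHS](powRK (lt0r_neq0 p0) (ltW y0)) powR_lt ?invr_gt0//; last exact: ltW.
  by rewrite powR_lt1 ?invr_gt0// (lt_trans yp).
- move=> t /inJ[t0 t1 t2].
  have yp : 0 < y `^ p by rewrite powR_gt0.
  rewrite powRVK ?gt_eqF//; last by rewrite ltW// (lt_trans yp).
  by rewrite subKr powRK ?gt_eqF// ltW.
- move=> t /inJ[t0 t1 t2].
  have yp : 0 < y `^ p by rewrite powR_gt0.
  apply: (@continuous_powRf R (fun u => 1 - u `^ q)); first by rewrite (lt_trans yp).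
  by apply: cvgB; [exact: cvg_cst|exact: powR_continuous].
- by move=> t _; exact: powR_ge0.
- exact: itv_open.
- move=> x /inI[yx x1 x0]; rewrite sub0r mulrN oppr_lt0.
  by rewrite !mulr_gt0 ?invr_gt0 ?powR_gt0// px// x0.
Qed.

(** [arccos] and the series are the integrals of one positive function over the
    two sides of [y], whose sum is a complete beta integral. *)
Lemma arccos_pq_series p q y : 1 < p -> 1 < q -> 0 < y < 1 ->
  ((arccos_pq p q y)%:E +
    (p / q)%:E * \sum_(k <oo) (ibeta_term (1 - q^-1) p (p - 1) y k)%:E =
   (q^-1 * Beta ((p - 1) / p) q^-1)%:E)%E.
Proof.
move=> p1 q1 /andP[y0 y1]; have p0 : 0 < p by rewrite (lt_trans ltr01).
have q0 : 0 < q by rewrite (lt_trans ltr01).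
have qV : 0 < 1 - q^-1 < 1 by rewrite subr_gt0 invf_lt1// q1 gtrBl invr_gt0.
have /andP[qV0 qV1] := qV.
have p1' : 0 < p - 1 by rewrite subr_gt0.
have y01 : 0 < y <= 1 by rewrite y0 ltW.
pose f u := p / q * (u `^ (p - 1 - 1) * (1 - u `^ p) `^ (- (1 - q^-1))).
have f0 u : 0 <= f u.
  by rewrite mulr_ge0 ?divr_ge0 ?(ltW p0) ?(ltW q0)// mulr_ge0 ?powR_ge0.
have mf : measurable_fun [set: R] f by rewrite /f; measR.
have pq : 0 <= p / q by rewrite divr_ge0 ?ltW.
have g0 u : 0 <= u `^ (p - 1 - 1) * (1 - u `^ p) `^ (- (1 - q^-1)).
  by rewrite mulr_ge0 ?powR_ge0.
have mg : measurable_fun [set: R]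
  (fun u => u `^ (p - 1 - 1) * (1 - u `^ p) `^ (- (1 - q^-1))) by measR.
have T : (\int[mu]_(u in `]0%R, 1%R[) (f u)%:E = (q^-1 * Beta ((p - 1) / p) q^-1)%:E)%E.
  rewrite (ge0_integralZl_total (measurable_itv _) pq g0 mg).
  have A0 : 0 < (p - 1) / p by rewrite divr_gt0.
  have B0 : 0 < q^-1 by rewrite invr_gt0.
  have := Beta_integral_powR p0 A0 B0.
  have -> : p * ((p - 1) / p) = p - 1 by rewrite mulrC divfK// gt_eqF.
  have -> : q^-1 - 1 = - (1 - q^-1) by ring.
  move=> ->; rewrite -EFinM; congr EFin; field.
  by rewrite !gt_eqF.
have S := @ge0_integral_itv_split R (BRight 0) (BLeft 1) y f.
rewrite T in S; rewrite S//.
rewrite (ge0_integralZl_total (measurable_itv _) pq g0 mg).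
rewrite (ibeta_series_itv0 qV0 p0 p1' y01) addeC; congr (_ + _)%E.
rewrite /arccos_pq integral_arcsin_pq arccos_pq_integral ?y0// fineK//.
rewrite ge0_fin_numE; last by apply: integral_ge0 => w _; rewrite lee_fin; exact: f0.
apply: (@le_lt_trans _ _ (\int[mu]_(u in `]0%R, 1%R[) (f u)%:E)%E).
  apply: ge0_subset_integral => //.
  - by apply/measurable_EFinP; apply: measurable_funTS.
  - by move=> x _; rewrite lee_fin; exact: f0.
  - by move=> x /=; rewrite !in_itv/= => /andP[yx ->]; rewrite (lt_trans y0).
by rewrite T ltry.
Qed.

(** The substitution [t = (u ^ p - 1) ^ (1 / q)]; writing [u ^ p - 1] as
    [u ^ p (1 - u ^ (- p))] prepares the expansion at infinity. *)
Lemma arccosh_pq_integral p q y : 1 < p -> 1 < q -> 1 < y ->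
  (\int[mu]_(t in `]0%R, ((y `^ p - 1) `^ q^-1)%R[) ((1 + t `^ q) `^ (- p^-1))%:E =
   \int[mu]_(u in `]1%R, y[) (p / q *
     (u `^ (- (1 - p / q) - 1) * (1 - u `^ (- p)) `^ (- (1 - q^-1))))%:E)%E.
Proof.
move=> p1 q1 y1; have p0 : 0 < p by rewrite (lt_trans ltr01).
have q0 : 0 < q by rewrite (lt_trans ltr01).
have y0 : 0 < y by rewrite (lt_trans ltr01).
have [u [v [uv _ _ _ _]]] := exhausts_itvoo y1.
have inI x : [set` `]1%R, y[] x -> [/\ x < y, 1 < x & 0 < x].
  by rewrite /= in_itv/= => /andP[? ?]; split => //; exact: lt_trans ltr01 _.
have px x : 1 < x -> 0 < x `^ p - 1 by move=> x1; rewrite subr_gt0 powR_gt1.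
have inJ t : [set` `]0%R, ((y `^ p - 1) `^ q^-1)%R[] t ->
    [/\ 0 < t, 1 < 1 + t `^ q & 1 + t `^ q < y `^ p].
  rewrite /= in_itv/= => /andP[t0 tY]; split => //.
    by rewrite ltrDl powR_gt0.
  have := powR_lt q0 (ltW t0) tY.
  rewrite powRVK ?gt_eqF//; first lra.
  by rewrite ltW// px.
rewrite (ge0_subst_incr (phi := fun u => (u `^ p - 1) `^ q^-1)
  (psi := fun t => (1 + t `^ q) `^ p^-1)
  (dphi := fun u => q^-1 * (u `^ p - 1) `^ (q^-1 - 1) * (p * u `^ (p - 1) - 0)) uv).
- apply: eq_integral => x /set_mem/inI[xy x1 x0]; congr EFin.
  have xp := px _ x1.
  rewrite powRVK ?gt_eqF//; last exact: ltW.
  have -> : 1 + (x `^ p - 1) = x `^ p by ring.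
  have xNp : 0 < 1 - x `^ (- p).
    by rewrite subr_gt0 powRN invf_lt1 ?powR_gt1// powR_gt0.
  have -> : x `^ p - 1 = x `^ p * (1 - x `^ (- p)).
    by rewrite mulrBr mulr1 -(powRD_gt0 _ _ x0) subrr powRr0.
  rewrite (powRM _ (powR_ge0 _ _) (ltW xNp)).
  have -> : x `^ (- (1 - p / q) - 1) =
      (x `^ p) `^ (- p^-1) * ((x `^ p) `^ (q^-1 - 1) * x `^ (p - 1)).
    rewrite -!powRrM -!(powRD_gt0 _ _ x0); congr (_ `^ _); field.
    by rewrite !gt_eqF.
  have -> : - (1 - q^-1) = q^-1 - 1 by ring.
  ring.
- exact: itv_open.
- exact: interval_is_interval.
- move=> x /inI[xy x1 x0]; rewrite /has_derivative.
  apply: (@is_derive_powRf R (fun u => u `^ p - 1)); first exact: px.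
  by apply: is_derive_funB; exact: is_derive1_powR.
- move=> x /inI[xy x1 x0]; apply: cvgM.
    apply: cvgM; first exact: cvg_cst.
    apply: (@continuous_powRf R (fun u => u `^ p - 1)); first exact: px.
    by apply: cvgB; [exact: powR_continuous|exact: cvg_cst].
  apply: cvgB; last exact: cvg_cst.
  by apply: cvgM; [exact: cvg_cst|exact: powR_continuous].
- move=> x /inI[xy x1 x0]; rewrite /= in_itv/= powR_gt0 ?px//=.
  apply: powR_lt; rewrite ?invr_gt0//; first by rewrite ltW// px.
  by rewrite ltrD2r powR_lt// ltW.
- move=> t /inJ[t0 t1 t2]; rewrite /= in_itv/= powR_gt1 ?invr_gt0//=.
  rewrite -[ltRHS](powRK (lt0r_neq0 p0) (ltW y0)) powR_lt ?invr_gt0//.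
  by rewrite ltW// (lt_trans ltr01).
- move=> t /inJ[t0 t1 t2].
  rewrite powRVK ?gt_eqF//; last by rewrite ltW// (lt_trans ltr01).
  by rewrite addrC addKr powRK ?gt_eqF// ltW.
- move=> t /inJ[t0 t1 t2].
  apply: (@continuous_powRf R (fun u => 1 + u `^ q)); first by rewrite (lt_trans ltr01).
  by apply: cvgD; [exact: cvg_cst|exact: powR_continuous].
- by move=> t _; exact: powR_ge0.
- exact: itv_open.
- move=> x /inI[xy x1 x0]; rewrite subr0.
  by rewrite !mulr_gt0 ?invr_gt0 ?powR_gt0// px.
Qed.

(** As for [arccos], with the half-line above 1 cut at [y]. The total integral
    converges because [p < q]. *)
Lemma arccosh_pq_series p q y : 1 < p -> 1 < q -> p < q -> 1 < y ->
  ((arccosh_pq p q y)%:E +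
    (p / q)%:E * \sum_(k <oo) (ibeta_term (1 - q^-1) p (1 - p / q) (y `^ (-1)) k)%:E =
   (q^-1 * Beta (p^-1 - q^-1) q^-1)%:E)%E.
Proof.
move=> p1 q1 plq y1; have p0 : 0 < p by rewrite (lt_trans ltr01).
have q0 : 0 < q by rewrite (lt_trans ltr01).
have qV : 0 < 1 - q^-1 < 1 by rewrite subr_gt0 invf_lt1// q1 gtrBl invr_gt0.
have /andP[qV0 qV1] := qV.
have e0 : 0 < 1 - p / q by rewrite subr_gt0 ltr_pdivrMr// mul1r.
pose g u := u `^ (- (1 - p / q) - 1) * (1 - u `^ (- p)) `^ (- (1 - q^-1)).
pose f u := p / q * g u.
have pq : 0 <= p / q by rewrite divr_ge0 ?ltW.
have g0 u : 0 <= g u by rewrite mulr_ge0 ?powR_ge0.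
have mg : measurable_fun [set: R] g by rewrite /g; measR.
have f0 u : 0 <= f u by rewrite mulr_ge0.
have mf : measurable_fun [set: R] f by apply: measurable_funM => //; exact: measurable_cst.
have T : (\int[mu]_(u in `]1%R, +oo[) (f u)%:E = (q^-1 * Beta (p^-1 - q^-1) q^-1)%:E)%E.
  rewrite (ge0_integralZl_total (measurable_itv _) pq g0 mg).
  have A0 : 0 < p^-1 - q^-1 by rewrite subr_gt0 ltf_pV2 ?posrE.
  have B0 : 0 < q^-1 by rewrite invr_gt0.
  have := Beta_integral_powRN p0 A0 B0.
  have -> : - p * (p^-1 - q^-1) = - (1 - p / q) by field; rewrite !gt_eqF.
  have -> : q^-1 - 1 = - (1 - q^-1) by ring.
  rewrite -/g => ->; rewrite -EFinM; congr EFin; field.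
  by rewrite !gt_eqF.
have S := @ge0_integral_itv_split R (BRight 1) +oo%O y f.
rewrite T in S; rewrite S//.
have -> : (\int[mu]_(u in `]y, +oo[) (f u)%:E = (p / q)%:E *
    \sum_(k <oo) (ibeta_term (1 - q^-1) p (1 - p / q) (y `^ (-1)) k)%:E)%E.
  rewrite (ge0_integralZl_total (measurable_itv _) pq g0 mg).
  by rewrite (ibeta_series_itvy qV0 p0 e0 (ltW y1)).
congr (_ + _)%E.
rewrite /arccosh_pq integral_arcsinh_pq arccosh_pq_integral// fineK//.
rewrite ge0_fin_numE; last by apply: integral_ge0 => w _; rewrite lee_fin; exact: f0.
apply: (@le_lt_trans _ _ (\int[mu]_(u in `]1%R, +oo[) (f u)%:E)%E).
  apply: ge0_subset_integral => //.
  - by apply/measurable_EFinP; apply: measurable_funTS.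
  - by move=> x _; rewrite lee_fin; exact: f0.
  - by move=> x /=; rewrite !in_itv/= andbT => /andP[].
by rewrite T ltry.
Qed.

End arc_functions.

(** * Weighted integrals of arcsin, arccos and arccosh *)

Section weighted_arcsin_arccos_arccosh.
Context {R : realType}.
Notation mu := (@lebesgue_measure R).
Implicit Types (p q s alpha beta : R).

Lemma powR_weight (x w alpha beta : R) :
  (x `^ alpha * w `^ beta)^-1 = x `^ (- alpha) * w `^ (- beta).
Proof. by rewrite invfM !powRN. Qed.

Lemma integral_arcsin_pq_beta p q alpha beta s : 1 < p -> 1 < q ->
  alpha < 2 -> beta < 1 -> 0 <= s <= 1 ->
  (\int[mu]_(x in `]0%R, 1%R[)
     (arcsin_pq p q (s * x) / (x `^ alpha * (1 - x `^ q) `^ beta))%:E =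
   (s / q * Beta ((2 - alpha) / q) (1 - beta) *
    hyp3F2 (1 / p) ((2 - alpha) / q) (1 / q)
           ((2 - alpha) / q + 1 - beta) (1 / q + 1) (s `^ q))%:E)%E.
Proof.
move=> p1 q1 a2 b1 /andP[s0 s1].
have p0 : 0 < p by rewrite (lt_trans ltr01).
have q0 : 0 < q by rewrite (lt_trans ltr01).
have pV : 0 < p^-1 < 1 by rewrite invr_gt0 p0 invf_lt1.
have [->|sn0] := eqVneq s 0.
  rewrite !mul0r; apply: integral0_eq => x _.
  by rewrite mul0r integral_arcsin_pq set_itv_ge ?bnd_simp ?ltxx// integral_set0 mul0r.
have {sn0}s0 : 0 < s by rewrite lt_neqAle eq_sym sn0.
have ae : alpha < 1 + 1 by lra.
have s01 : 0 < s <= 1 by rewrite s0.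
rewrite [1 / p]div1r.
have -> : s / q = s `^ 1 / (q * 1) by rewrite powRr1 ?mulr1// ltW.
have -> : 2 - alpha = 1 + 1 - alpha by lra.
rewrite -[_ / q + 1 - beta]addrA.
rewrite -(beta_transform_itv01 pV q0 ltr01 s01 ae b1).
apply: eq_integral => x /set_mem/=; rewrite in_itv/= => /andP[x0 x1].
have sx : 0 < s * x <= 1.
  by rewrite mulr_gt0//= mulr_ile1// ltW.
rewrite powR_weight EFinM (arcsin_pq_series p1 q1 sx) muleC -nneseriesZl.
  by apply: eq_eseriesr => k _; rewrite -EFinM mulrC.
by move=> k _; rewrite lee_fin ibeta_term_ge0// invr_gt0.
Qed.

(** The constant of [arccos_pq_series] contributes the product of two beta values,
    its series the [3F2]. At [s = 0] the integrand reduces to the constant times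
    the weight. *)
Lemma integral_arccos_pq_beta p q alpha beta s : 1 < p -> 1 < q ->
  alpha < 1 -> beta < 1 -> 0 <= s <= 1 ->
  (\int[mu]_(x in `]0%R, 1%R[)
     (arccos_pq p q (s * x) / (x `^ alpha * (1 - x `^ p) `^ beta))%:E =
   (1 / (p * q) * Beta ((p - 1) / p) (1 / q) * Beta ((1 - alpha) / p) (1 - beta)
    - s `^ (p - 1) / (q * (p - 1)) * Beta (1 - alpha / p) (1 - beta) *
      hyp3F2 (1 - 1 / q) (1 - alpha / p) ((p - 1) / p)
             (2 - alpha / p - beta) ((2 * p - 1) / p) (s `^ p))%:E)%E.
Proof.
move=> p1 q1 a1 b1 /andP[s0 s1].
have p0 : 0 < p by rewrite (lt_trans ltr01).
have q0 : 0 < q by rewrite (lt_trans ltr01).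
have p1' : 0 < p - 1 by rewrite subr_gt0.
have qV : 0 < 1 - q^-1 < 1 by rewrite subr_gt0 invf_lt1// q1 gtrBl invr_gt0.
have A0 : 0 < (1 - alpha) / p by rewrite divr_gt0// subr_gt0.
have B0 : 0 < 1 - beta by rewrite subr_gt0.
have Bc : 0 < Beta ((p - 1) / p) q^-1 by rewrite Beta_gt0 ?divr_gt0 ?invr_gt0.
pose w x := x `^ (- alpha) * (1 - x `^ p) `^ (- beta).
have w0 x : 0 <= w x by rewrite mulr_ge0 ?powR_ge0.
have mw : measurable_fun [set: R] w by rewrite /w; measR.
pose C := q^-1 * Beta ((p - 1) / p) q^-1.
have C0 : 0 <= C by rewrite mulr_ge0 ?invr_ge0 ?(ltW q0)// ltW.
have IC : (\int[mu]_(x in `]0%R, 1%R[) (C * w x)%:E =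
    (1 / (p * q) * Beta ((p - 1) / p) (1 / q) * Beta ((1 - alpha) / p) (1 - beta))%:E)%E.
  rewrite (ge0_integralZl_total (measurable_itv _) C0 w0 mw).
  have := Beta_integral_powR p0 A0 B0.
  have -> : p * ((1 - alpha) / p) - 1 = - alpha by field; rewrite gt_eqF.
  have -> : 1 - beta - 1 = - beta by ring.
  rewrite -/w => ->; rewrite -EFinM; congr EFin; rewrite /C !div1r; field.
  by rewrite !gt_eqF.
have [s0'|sn0] := eqVneq s 0.
  rewrite s0' powR0 ?gt_eqF// !mul0r subr0 -IC.
  apply: eq_integral => x /set_mem/=; rewrite in_itv/= => /andP[x0 x1].
  rewrite powR_weight -/(w x) mul0r; congr (_ * _)%:E.
  rewrite /arccos_pq powR0 ?gt_eqF// subr0 (congr1 (fun f => f q^-1) (@powR1 R)).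
  have pV : 0 < p^-1 < 1 by rewrite invr_gt0 p0 invf_lt1.
  have qV0 : 0 < q^-1 by rewrite invr_gt0.
  have pV1 : 0 < 1 - p^-1 by rewrite subr_gt0 invf_lt1.
  rewrite integral_arcsin_pq /C.
  have -> : (p - 1) / p = 1 - p^-1 by field; rewrite gt_eqF.
  rewrite BetaC -[RHS]/(fine (_)%:E) -(Beta_integral_powR q0 qV0 pV1); congr fine.
  apply: eq_integral => t _.
  rewrite divff ?gt_eqF// subrr powRr0 mul1r.
  by congr (_ `^ _)%:E; ring.
have {sn0}s0 : 0 < s by rewrite lt_neqAle eq_sym sn0.
have s01 : 0 < s <= 1 by rewrite s0.
have ae : alpha < p - 1 + 1 by lra.
have pq : 0 <= p / q by rewrite divr_ge0 ?ltW.
pose e k x := p / q * (ibeta_term (1 - q^-1) p (p - 1) (s * x) k * w x).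
have e0 k x : 0 <= e k x.
  by rewrite mulr_ge0// mulr_ge0// ibeta_term_ge0//; case/andP: qV.
have E := beta_transform_itv01 qV p0 p1' s01 ae b1.
apply: (@integral_sub_nneseries R _ _ (fun x => C * w x) e) => //.
- by apply: measurable_funM => //; exact: measurable_cst.
- by move=> x; rewrite mulr_ge0.
- by move=> k; apply: measurable_funTS; rewrite /e /w /ibeta_term; measR.
- move=> x /=; rewrite in_itv/= => /andP[x0 x1].
  have sx : 0 < s * x < 1.
    by rewrite mulr_gt0//= (le_lt_trans _ x1)// ger_pMl.
  have := arccos_pq_series p1 q1 sx; rewrite -/C powR_weight -/(w x) => H.
  rewrite !(EFinM _ (w x)) -H muleDl//; congr (_ + _)%E.
  rewrite muleAC -EFinM -nneseriesZl; last first.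
    by move=> k _; rewrite lee_fin ibeta_term_ge0//; case/andP: qV.
  by apply: eq_eseriesr => k _; rewrite /e -EFinM; congr EFin; ring.
- rewrite integral_nneseriesZl//; last 2 first.
  + by move=> k; apply: measurable_funTS; rewrite /w /ibeta_term; measR.
  + by move=> k x; rewrite mulr_ge0// ibeta_term_ge0//; case/andP: qV.
  rewrite E -EFinM; congr EFin; rewrite !div1r.
  have -> : p - 1 + 1 - alpha = p - alpha by ring.
  have -> : (p - alpha) / p = 1 - alpha / p by field; rewrite gt_eqF.
  have -> : 1 - alpha / p + (1 - beta) = 2 - alpha / p - beta by ring.
  have -> : (p - 1) / p + 1 = (2 * p - 1) / p by field; rewrite gt_eqF.
  by field; rewrite !gt_eqF.
Qed.

Lemma integral_arccosh_pq_beta p q alpha beta s : 1 < p -> 1 < q ->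
  p < q -> 1 <= s -> beta < 1 -> (alpha + beta) * p > 1 ->
  (\int[mu]_(x in `]1%R, +oo[)
     (arccosh_pq p q (s * x) / (x `^ (alpha * p) * (x `^ p - 1) `^ beta))%:E =
   (1 / (p * q) * Beta (1 / p - 1 / q) (1 / q) * Beta (1 - beta) (beta + alpha - 1 / p)
    + s `^ (p / q - 1) / (p - q) * Beta (beta + alpha - 1 / q) (1 - beta) *
      hyp3F2 (1 - 1 / q) (beta + alpha - 1 / q) (1 / p - 1 / q)
             (alpha + 1 - 1 / q) (1 / p - 1 / q + 1) (s `^ (- p)))%:E)%E.
Proof.
move=> p1 q1 plq s1 b1 ab1.
have p0 : 0 < p by rewrite (lt_trans ltr01).
have q0 : 0 < q by rewrite (lt_trans ltr01).
have s0 : 0 < s by rewrite (lt_le_trans ltr01).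
have e1 : 0 < 1 - p / q by rewrite subr_gt0 ltr_pdivrMr// mul1r.
have qV : 0 < 1 - q^-1 < 1 by rewrite subr_gt0 invf_lt1// q1 gtrBl invr_gt0.
have A0 : 0 < beta + alpha - p^-1.
  by rewrite subr_gt0 addrC -(ltr_pM2r p0) mulVf ?gt_eqF.
have B0 : 0 < 1 - beta by rewrite subr_gt0.
have pqV : 0 < p^-1 - q^-1 by rewrite subr_gt0 ltf_pV2 ?posrE.
have Bc : 0 < Beta (p^-1 - q^-1) q^-1 by rewrite Beta_gt0 ?invr_gt0.
pose gamma := (alpha + beta) * p.
pose w x := x `^ (- gamma) * (1 - x `^ (- p)) `^ (- beta).
have w0 x : 0 <= w x by rewrite mulr_ge0 ?powR_ge0.
have mw : measurable_fun [set: R] w by rewrite /w; measR.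
have wE x : 1 < x -> (x `^ (alpha * p) * (x `^ p - 1) `^ beta)^-1 = w x.
  move=> x1; have x0 : 0 < x by rewrite (lt_trans ltr01).
  have xNp : 0 < 1 - x `^ (- p).
    by rewrite subr_gt0 powRN invf_lt1 ?powR_gt1// powR_gt0.
  have -> : x `^ p - 1 = x `^ p * (1 - x `^ (- p)).
    by rewrite mulrBr mulr1 -(powRD_gt0 _ _ x0) subrr powRr0.
  rewrite powR_weight (powRM _ (powR_ge0 _ _) (ltW xNp)) mulrA /w; congr (_ * _).
  by rewrite -powRrM -(powRD_gt0 _ _ x0) /gamma; congr (_ `^ _); ring.
pose C := q^-1 * Beta (p^-1 - q^-1) q^-1.
have C0 : 0 <= C by rewrite mulr_ge0 ?invr_ge0 ?(ltW q0)// ltW.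
have IC : (\int[mu]_(x in `]1%R, +oo[) (C * w x)%:E =
    (1 / (p * q) * Beta (1 / p - 1 / q) (1 / q) * Beta (1 - beta) (beta + alpha - 1 / p))%:E)%E.
  rewrite (ge0_integralZl_total (measurable_itv _) C0 w0 mw).
  have := Beta_integral_powRN p0 A0 B0.
  have -> : - p * (beta + alpha - p^-1) - 1 = - gamma.
    by rewrite /gamma; field; rewrite gt_eqF.
  have -> : 1 - beta - 1 = - beta by ring.
  rewrite -/w => ->; rewrite -EFinM; congr EFin; rewrite /C !div1r.
  by rewrite (BetaC (1 - beta)); field; rewrite !gt_eqF.
have ge : 1 < 1 - p / q + gamma.
  have : 0 < 1 - p / q by []; rewrite /gamma; lra.
have pq : 0 <= p / q by rewrite divr_ge0 ?ltW.
pose e k x := p / q * (ibeta_term (1 - q^-1) p (1 - p / q) ((s * x) `^ (-1)) k * w x).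
have e0 k x : 0 <= e k x.
  by rewrite mulr_ge0// mulr_ge0// ibeta_term_ge0//; case/andP: qV.
have E := beta_transform_itv1y qV p0 e1 s1 ge b1.
(* the tail is subtracted; the sign is hidden in [p - q < 0] *)
have -> : s `^ (p / q - 1) / (p - q) = - (s `^ (p / q - 1) / (q - p)).
  by rewrite -mulrN -invrN opprB.
rewrite mulNr mulNr.
apply: (@integral_sub_nneseries R _ _ (fun x => C * w x) e) => //.
- by apply: measurable_funM => //; exact: measurable_cst.
- by move=> x; rewrite mulr_ge0.
- by move=> k; apply: measurable_funTS; rewrite /e /w /ibeta_term; measR.
- move=> x /=; rewrite in_itv/= andbT => x1.
  have sx : 1 < s * x.
    by rewrite (lt_le_trans x1)// ler_peMl// ltW// (lt_trans ltr01).
  have := arccosh_pq_series p1 q1 plq sx; rewrite -/C (wE _ x1) => H.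
  rewrite !(EFinM _ (w x)) -H muleDl//; congr (_ + _)%E.
  rewrite muleAC -EFinM -nneseriesZl; last first.
    by move=> k _; rewrite lee_fin ibeta_term_ge0//; case/andP: qV.
  by apply: eq_eseriesr => k _; rewrite /e -EFinM; congr EFin; ring.
- rewrite integral_nneseriesZl//; last 2 first.
  + by move=> k; apply: measurable_funTS; rewrite /w /ibeta_term; measR.
  + by move=> k x; rewrite mulr_ge0// ibeta_term_ge0//; case/andP: qV.
  rewrite E -EFinM; congr EFin; rewrite !div1r.
  have -> : - (1 - p / q) = p / q - 1 by ring.
  have -> : (1 - p / q + gamma - 1) / p = beta + alpha - q^-1.
    by rewrite /gamma; field; rewrite !gt_eqF.
  have -> : (1 - p / q) / p = p^-1 - q^-1 by field; rewrite !gt_eqF.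
  have -> : beta + alpha - q^-1 + (1 - beta) = alpha + 1 - q^-1 by ring.
  have qp : q - p != 0 by rewrite subr_eq0 gt_eqF.
  have -> : p * (1 - p / q) = p * (q - p) / q by field; rewrite gt_eqF.
  by field; rewrite qp !gt_eqF.
Qed.

End weighted_arcsin_arccos_arccosh.

(** * Power series on the open unit disk *)

Section power_series.
Context {R : realType}.
Implicit Types (c d : nat -> R) (x : R).

Definition ps c x : R := limn (pseries c x).

Definition cvg_unit_disk c := forall x, `|x| < 1 -> cvgn (pseries c x).

(** The action on coefficients of the operator [x d/dx]. *)
Definition theta c (k : nat) : R := k%:R * c k.

Lemma cvg_unit_diskD c d : cvg_unit_disk c -> cvg_unit_disk d ->
  cvg_unit_disk (fun k => c k + d k).
Proof.
move=> cc cd x x1; rewrite /pseries (_ : (fun _ => _) =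
  (fun i => c i * x ^+ i) + (fun i => d i * x ^+ i)).
  by apply: is_cvg_seriesD; [exact: cc|exact: cd].
by apply/funext => i; rewrite /= fctE mulrDl.
Qed.

Lemma psD c d x : cvg_unit_disk c -> cvg_unit_disk d -> `|x| < 1 ->
  ps (fun k => c k + d k) x = ps c x + ps d x.
Proof.
move=> cc cd x1; rewrite /ps /pseries (_ : (fun _ => _) =
  (fun i => c i * x ^+ i) + (fun i => d i * x ^+ i)).
  by rewrite lim_seriesD//; [exact: cc|exact: cd].
by apply/funext => i; rewrite /= fctE mulrDl.
Qed.

Lemma cvg_unit_diskZ (a : R) c : cvg_unit_disk c -> cvg_unit_disk (fun k => a * c k).
Proof.
move=> cc x x1; rewrite /pseries (_ : (fun _ => _) = a *: (fun i => c i * x ^+ i)).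
  by apply: is_cvg_seriesZ; exact: cc.
by apply/funext => i; rewrite /= fctE -mulrA.
Qed.

Lemma psZ (a : R) c x : cvg_unit_disk c -> `|x| < 1 ->
  ps (fun k => a * c k) x = a * ps c x.
Proof.
move=> cc x1; rewrite /ps /pseries (_ : (fun _ => _) = a *: (fun i => c i * x ^+ i)).
  by rewrite lim_seriesZ//; exact: cc.
by apply/funext => i; rewrite /= fctE -mulrA.
Qed.

Lemma eq_ps c d x : c =1 d -> ps c x = ps d x.
Proof. by move=> /funext ->. Qed.

Lemma ps_shift c x : cvg_unit_disk c -> `|x| < 1 ->
  cvgn (pseries (fun k => c k.+1) x) /\ ps c x = c 0%N + x * ps (fun k => c k.+1) x.
Proof.
move=> cc x1; have [->|x0] := eqVneq x 0.
  have e (d : nat -> R) : pseries d 0 @ \oo --> d 0%N.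
    rewrite -(cvg_shiftn 1); apply: cvg_near_cst; near=> n.
    rewrite /pseries/= /series/= addn1 big_nat_recl//= expr0 mulr1 big1 ?addr0// => i _.
    by rewrite expr0n/= mulr0.
  split; first by apply/cvg_ex; exists (c 1%N); exact: e.
  by rewrite mul0r addr0; apply/cvg_lim => //; exact: e.
have : (fun n => pseries c x n.+1) @ \oo --> ps c x by rewrite cvg_shiftS; exact: cc.
have eq : (fun n => pseries c x n.+1) =
    (fun n => c 0%N + x * pseries (fun k => c k.+1) x n).
  apply/funext => n; rewrite /pseries/= /series/= big_nat_recl//= expr0 mulr1.
  by congr (_ + _); rewrite big_distrr/=; apply: eq_bigr => i _; rewrite exprS mulrCA.
rewrite eq => H.
have {}H : pseries (fun k => c k.+1) x @ \oo --> x^-1 * (ps c x - c 0%N).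
  rewrite (_ : pseries _ _ = (fun n => x^-1 * (c 0%N + x * pseries (fun k => c k.+1) x n - c 0%N))).
    by apply: cvgM; [exact: cvg_cst|apply: cvgB => //; exact: cvg_cst].
  by apply/funext => n; rewrite addrAC subrr add0r mulKf.
split; first by apply/cvg_ex; eexists; exact: H.
by rewrite /ps (cvg_lim _ H)// mulVKf// addrC subrK.
Unshelve. all: by end_near. Qed.

Lemma cvg_geometric_linear (r : R) : 0 <= r < 1 ->
  cvgn (series (fun k => k.+1%:R * r ^+ k)).
Proof.
move=> /andP[r0 r1]; have r1' : 0 < 1 - r by rewrite subr_gt0.
have [N _ HN] := quadratic_eventually_ge0 (- 3 * r) (- 1 - 2 * r) r1'.
apply: (@raabe_cvg_series _ _ 1 N) => // k kN.
have := HN k kN; rewrite /=.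
rewrite !ger0_norm ?mulr_ge0 ?exprn_ge0// => H.
rewrite exprS -[k.+2%:R]natr1 -[k.+1%:R]natr1.
rewrite [leLHS](_ : _ = ((k%:R + 1 + 1) * (k%:R + 1) * r) * r ^+ k); last by ring.
rewrite mulrA ler_wpM2r ?exprn_ge0//.
rewrite -subr_ge0; apply: le_trans H _.
by rewrite le_eqVlt; apply/orP; left; apply/eqP; ring.
Qed.

(** At [x] with [|x| < y < 1] the terms of the derived series are dominated by
    those of [\sum_k (k + 1) r ^ k] for [r = |x| / y]. *)
Lemma cvg_unit_disk_diffs c : cvg_unit_disk c -> cvg_unit_disk (pseries_diffs c).
Proof.
move=> cc x x1.
have [y [y0 y1 xy]] : exists y : R, [/\ 0 < y, `|y| < 1 & `|x| < y].
  have x0 : 0 <= `|x| by [].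
  have y0 : 0 < (1 + `|x|) / 2 by lra.
  by exists ((1 + `|x|) / 2); split => //; [rewrite (gtr0_norm y0)|]; lra.
have [M [_ HM]] := cvg_series_bounded (cc y y1).
have {}HM k : `|c k| * y ^+ k <= `|M| + 1.
  have := HM (`|M| + 1); rewrite ltr_pwDr// => [|]; last exact: ler_norm.
  by move=> /(_ isT k I); rewrite /= normrM normrX (gtr0_norm y0).
pose r := `|x| / y.
have r01 : 0 <= r < 1 by rewrite /r divr_ge0 ?(ltW y0)//= ltr_pdivrMr// mul1r.
apply: normed_cvg; apply: (@series_le_cvg _ _ (fun k => (`|M| + 1) / y * (k.+1%:R * r ^+ k))).
- by move=> n /=.
- by move=> n /=; rewrite mulr_ge0 ?divr_ge0 ?addr_ge0 ?(ltW y0)// mulr_ge0// exprn_ge0//; case/andP: r01.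
- move=> k /=; rewrite /pseries_diffs !normrM normrX normr_nat.
  have -> : (`|M| + 1) / y * (k.+1%:R * r ^+ k) = k.+1%:R * ((`|M| + 1) / y ^+ k.+1) * `|x| ^+ k.
    have yn0 : y != 0 by rewrite gt_eqF.
    have : y ^+ k != 0 by rewrite expf_neq0.
    rewrite /r expr_div_n exprS; move: (y ^+ k) => Y Y0.
    by field; rewrite ?Y0 ?yn0.
  rewrite ler_wpM2r ?exprn_ge0// ler_wpM2l//.
  by rewrite ler_pdivlMr ?exprn_gt0.
- rewrite (_ : (fun k => _) = ((`|M| + 1) / y) *: (fun k => k.+1%:R * r ^+ k)).
    by apply: is_cvg_seriesZ; exact: cvg_geometric_linear.
  by apply/funext.
Qed.

Lemma is_derive_ps c x : cvg_unit_disk c -> `|x| < 1 ->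
  is_derive x 1 (ps c) (ps (pseries_diffs c) x).
Proof.
move=> cc x1; pose K := (1 + `|x|) / 2.
have x0 : 0 <= `|x| by [].
have K0 : 0 < K by rewrite /K; lra.
have K1 : `|K| < 1 by rewrite gtr0_norm// /K; lra.
have c1 := cvg_unit_disk_diffs cc; have c2 := cvg_unit_disk_diffs c1.
apply: (@pseries_snd_diffs _ c K); [exact: cc|exact: c1|exact: c2|].
by rewrite (gtr0_norm K0) /K; lra.
Qed.

Lemma ps_continuous c x : cvg_unit_disk c -> `|x| < 1 -> {for x, continuous (ps c)}.
Proof. by move=> cc x1; exact: is_derive_continuous (is_derive_ps cc x1). Qed.

Lemma ps0 c : cvg_unit_disk c -> ps c 0 = c 0%N.
Proof.
move=> cc; have x1 : `|0 : R| < 1 by rewrite normr0.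
by have [_ ->] := ps_shift cc x1; rewrite mul0r addr0.
Qed.

Lemma cvg_unit_disk_theta c : cvg_unit_disk c -> cvg_unit_disk (theta c).
Proof.
move=> cc x x1; have := cvg_unit_disk_diffs cc x1 => /cvg_ex[l H].
rewrite /pseries; apply/cvg_ex; exists (x * l); rewrite -(cvg_shiftS).
rewrite (_ : (fun n => _) = (fun n => x * pseries (pseries_diffs c) x n)).
  by apply: cvgM => //; exact: cvg_cst.
apply/funext => n; rewrite /pseries /series/= big_nat_recl//= /theta !mul0r add0r.
rewrite big_distrr/=; apply: eq_bigr => i _.
by rewrite /pseries_diffs exprS; ring.
Qed.

Lemma ps_theta c x : cvg_unit_disk c -> `|x| < 1 ->
  ps (theta c) x = x * ps (pseries_diffs c) x.
Proof.
move=> cc x1; have [_ ->] := ps_shift (cvg_unit_disk_theta cc) x1.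
by rewrite /theta mul0r add0r.
Qed.

Lemma is_derive_ps_theta c x : cvg_unit_disk c -> 0 < x < 1 ->
  is_derive x 1 (ps c) (ps (theta c) x / x).
Proof.
move=> cc /andP[x0 x1]; have xn : `|x| < 1 by rewrite gtr0_norm.
rewrite ps_theta// mulrC mulKf ?gt_eqF//.
exact: is_derive_ps.
Qed.

End power_series.

Section hyp2F1.
Context {R : realType}.
Implicit Types (a b c d x : R).

Definition hyp2F1_coef a b c (k : nat) : R :=
  pochhammer a k * pochhammer b k / pochhammer c k / k`!%:R.

Lemma cvg_unit_disk_hyp3F2 a1 a2 a3 b1 b2 : cvg_unit_disk (hyp3F2_coef a1 a2 a3 b1 b2).
Proof.
move=> x x1; pose y := (1 + `|x|) / 2.
have x0 : 0 <= `|x| by [].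
have y0 : 0 < y by rewrite /y; lra.
apply: (@is_cvg_pseries_inside _ _ y); last by rewrite (gtr0_norm y0) /y; lra.
apply: normed_cvg; apply: hyp3F2_coef_normed_cvg; first exact: ltW.
by left; rewrite /y; lra.
Qed.

Lemma hyp2F1_coefE a b c k : hyp2F1_coef a b c k = hyp3F2_coef a b 1 c 1 k.
Proof.
have p1 : pochhammer 1 k != 0 :> R by rewrite gt_eqF// pochhammer_gt0.
rewrite /hyp2F1_coef /hyp3F2_coef invfM (mulrC (pochhammer c k)^-1) mulrA.
by rewrite mulfK.
Qed.

Lemma cvg_unit_disk_hyp2F1 a b c : cvg_unit_disk (hyp2F1_coef a b c).
Proof.
by rewrite (_ : hyp2F1_coef a b c = hyp3F2_coef a b 1 c 1);
  [exact: cvg_unit_disk_hyp3F2|apply/funext => k; exact: hyp2F1_coefE].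
Qed.

Lemma hyp2F1_coef0 a b c : hyp2F1_coef a b c 0 = 1.
Proof. by rewrite /hyp2F1_coef !pochhammer0 fact0 !divr1 mulr1. Qed.

Lemma hyp2F1_coefS a b c k : c + k%:R != 0 ->
  (k%:R + 1) * (c + k%:R) * hyp2F1_coef a b c k.+1 =
  (a + k%:R) * (b + k%:R) * hyp2F1_coef a b c k.
Proof.
move=> ck; have k1 : k%:R + 1 != 0 :> R by rewrite natr1.
rewrite /hyp2F1_coef !pochhammerSr factS natrM !invfM -natr1.
set i := (pochhammer c k)^-1; set f := (k`!%:R)^-1.
by field; rewrite k1 ck.
Qed.

Lemma pseries_diffs_hyp2F1 a b c k : c != 0 ->
  pseries_diffs (hyp2F1_coef a b c) k = a * b / c * hyp2F1_coef (a + 1) (b + 1) (c + 1) k.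
Proof.
move=> c0; rewrite /pseries_diffs /hyp2F1_coef !pochhammerS factS natrM !invfM.
set i := (pochhammer (c + 1) k)^-1; set f := (k`!%:R)^-1.
have k1 : k%:R + 1 != 0 :> R by rewrite natr1.
by rewrite -natr1; field; rewrite ?c0 ?k1.
Qed.

Lemma pochhammer_ratio d k : (forall n : nat, d != - n%:R) ->
  (d + k%:R) * (pochhammer d k / pochhammer (d + 1) k) = d.
Proof.
move=> dn; have d1 : pochhammer (d + 1) k != 0.
  apply: pochhammer_neq0 => n; apply/eqP => H; have := dn n.+1.
  by rewrite -natr1 (_ : d = - (n%:R + 1)) ?eqxx//; lra.
by rewrite mulrA (mulrC (d + _)) pochhammer_shift mulfK.
Qed.

End hyp2F1.

(** * Euler's integral on the half-line *)

Section Euler_integral.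
Context {R : realType}.
Notation mu := (@lebesgue_measure R).
Implicit Types (a beta b c w y : R).

Definition euler_integrand a beta b w y : R :=
  y `^ (a - 1) * ((1 + y) `^ (- beta) * (1 + w * y) `^ (- b)).

(** With [beta = a + c] this solves, as a function of [w], a hypergeometric
    equation with exponents [0] and [c] at the origin. *)
Definition euler_integral a beta b w : R :=
  \int[mu]_(y in `]0%R, +oo[) euler_integrand a beta b w y.

Lemma euler_integrand_ge0 a beta b w y : 0 <= euler_integrand a beta b w y.
Proof. by rewrite !mulr_ge0 ?powR_ge0. Qed.

Lemma measurable_euler_integrand a beta b w (D : set R) :
  measurable_fun D (euler_integrand a beta b w).
Proof. by apply: measurable_funTS; rewrite /euler_integrand; measR. Qed.

(** [1 + w y] lies between [m (1 + y)] and [M (1 + y)], and one of these two bounds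
    applies according to the sign of [b]. This dominates Euler's integrands
    uniformly for [w] in a compact subset of the half-line. *)
Lemma powR1DM_le (m M b w y : R) : 0 < m <= 1 -> 1 <= M -> m <= w <= M -> 0 < y ->
  (1 + w * y) `^ (- b) <= (m `^ (- b) + M `^ (- b)) * (1 + y) `^ (- b).
Proof.
move=> /andP[m0 m1] M1 /andP[mw wM] y0.
have M0 : 0 < M by rewrite (lt_le_trans ltr01).
have w0 : 0 < w by rewrite (lt_le_trans m0).
have y1 : 0 < 1 + y by rewrite addr_gt0.
have wy : 0 < 1 + w * y by rewrite addr_gt0// mulr_gt0.
have lo : m * (1 + y) <= 1 + w * y.
  by rewrite mulrDr mulr1 lerD// ler_wpM2r// ltW.
have hi : 1 + w * y <= M * (1 + y).
  by rewrite mulrDr mulr1 lerD// ler_wpM2r// ltW.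
rewrite mulrDl -(powRM _ (ltW m0) (ltW y1)) -(powRM _ (ltW M0) (ltW y1)).
have [b0|b0] := leP 0 b.
  apply: ler_wpDr; first exact: powR_ge0.
  rewrite !powRN lef_pV2 ?posrE ?powR_gt0 ?mulr_gt0//.
  by apply: ge0_ler_powR; rewrite ?nnegrE ?mulr_ge0 ?(ltW m0) ?(ltW y1) ?(ltW wy).
apply: ler_wpDl; first exact: powR_ge0.
apply: ge0_ler_powR; rewrite ?nnegrE ?mulr_ge0 ?(ltW M0) ?(ltW y1) ?(ltW wy)//.
by rewrite oppr_ge0 ltW.
Qed.

Lemma beta_integrand_integrable a d : 0 < a -> a < d ->
  mu.-integrable `]0%R, +oo[ (EFin \o (fun y => y `^ (a - 1) * (1 + y) `^ (- d))).
Proof.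
move=> a0 ad; have da : 0 < d - a by rewrite subr_gt0.
apply/integrableP; split.
  by apply/measurable_EFinP; apply: measurable_funTS; measR.
under eq_integral do rewrite gee0_abs ?lee_fin ?mulr_ge0 ?powR_ge0//.
have := Beta_integral_itv0y da a0; rewrite subrK => ->.
exact: ltry.
Qed.

Let inE0 y : [set` `]0%R, +oo[] y -> 0 < y.
Proof. by rewrite /= in_itv/= andbT. Qed.

Let euler_bound a beta b (K : R) y : 0 < y -> 
  y `^ (a - 1) * ((1 + y) `^ (- beta) * (K * (1 + y) `^ (- b))) =
  K * (y `^ (a - 1) * (1 + y) `^ (- (beta + b))).
Proof.
move=> y0; have y1 : 0 < 1 + y by rewrite addr_gt0.
by rewrite opprD (powRD_gt0 _ _ y1); ring.
Qed.

Lemma euler_integrand_integrable a beta b w : 0 < a -> a < beta + b -> 0 < w ->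
  mu.-integrable `]0%R, +oo[ (EFin \o euler_integrand a beta b w).
Proof.
move=> a0 ab w0.
pose m := Num.min w 1; pose M := Num.max w 1.
have m01 : 0 < m <= 1 by rewrite lt_min w0 ltr01 ge_min lexx orbT.
have M1 : 1 <= M by rewrite le_max lexx orbT.
have mwM : m <= w <= M by rewrite ge_min lexx le_max lexx.
pose K := m `^ (- b) + M `^ (- b).
apply: (@le_integrable _ _ _ mu _ (measurable_itv _) _
  (EFin \o (fun y => K * (y `^ (a - 1) * (1 + y) `^ (- (beta + b)))))).
- by apply/measurable_EFinP; exact: measurable_euler_integrand.
- move=> y /inE0 y0; rewrite /= lee_fin ger0_norm ?euler_integrand_ge0//.
  apply: le_trans (ler_norm _); rewrite -euler_bound//.
  by rewrite ler_wpM2l ?powR_ge0// ler_wpM2l ?powR_ge0// powR1DM_le.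
- exact: (integrableZl _ K (beta_integrand_integrable a0 ab)).
Qed.

Lemma euler_integralE a beta b w : 0 < a -> a < beta + b -> 0 < w ->
  (\int[mu]_(y in `]0%R, +oo[) (euler_integrand a beta b w y)%:E =
   (euler_integral a beta b w)%:E)%E.
Proof.
move=> a0 ab w0; rewrite /euler_integral /Rintegral fineK//.
exact: integrable_fin_num (euler_integrand_integrable a0 ab w0).
Qed.

Let euler_integrand_derive a beta b w y : 0 < w -> 0 < y ->
  is_derive w 1 (fun w => euler_integrand a beta b w y)
    (- b * euler_integrand (a + 1) beta (b + 1) w y).
Proof.
move=> w0 y0; have wy : 0 < 1 + w * y by rewrite addr_gt0// mulr_gt0.
have -> : - b * euler_integrand (a + 1) beta (b + 1) w y =
  y `^ (a - 1) * ((1 + y) `^ (- beta) * (- b * (1 + w * y) `^ (- b - 1) * (0 + y * 1))).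
  rewrite /euler_integrand opprD.
  have -> : y `^ (a + 1 - 1) = y `^ (a - 1) * y.
    rewrite -[X in _ = _ * X](powRr1 (ltW y0)) -(powRD_gt0 _ _ y0).
    by congr (_ `^ _); ring.
  ring.
apply: is_derive_cstM; apply: is_derive_cstM.
apply: (@is_derive_powRf R (fun w => 1 + w * y)) => //.
apply: (@is_derive_funD R (cst 1) (fun w => w * y)).
rewrite (_ : (fun w => w * y) = (fun w => y * w)); last by apply/funext => ?; rewrite mulrC.
by apply: is_derive_cstM; exact: is_derive_id.
Qed.

(** Differentiation under the integral sign, with a domination on the
    neighbourhood of [w] between [w / 2] and [w + 1]. *)
Lemma is_derive_euler_integral a beta b w : 0 < a -> a < beta + b -> 0 < w ->
  is_derive w 1 (euler_integral a beta b)
    (- b * euler_integral (a + 1) beta (b + 1) w).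
Proof.
move=> a0 ab w0; have a1 : 0 < a + 1 by rewrite addr_gt0.
have ab1 : a + 1 < beta + (b + 1) by lra.
pose lo := w / 2; pose hi := w + 1.
pose m := Num.min lo 1; pose M := Num.max hi 1.
have lo0 : 0 < lo by rewrite divr_gt0.
have m01 : 0 < m <= 1 by rewrite lt_min lo0 ltr01 ge_min lexx orbT.
have M1 : 1 <= M by rewrite le_max lexx orbT.
pose K := m `^ (- (b + 1)) + M `^ (- (b + 1)).
have K0 : 0 <= K by rewrite addr_ge0 ?powR_ge0.
pose G y := `|b| * K * (y `^ (a + 1 - 1) * (1 + y) `^ (- (beta + (b + 1)))).
have Iw : [set` `]lo, hi[] w.
  by rewrite /= in_itv/= /lo /hi ltrDl ltr01 andbT; lra.
have inI x : [set` `]lo, hi[] x -> [/\ 0 < x, m <= x & x <= M].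
  rewrite /= in_itv/= => /andP[lx xh]; split; first exact: lt_trans lx.
    by rewrite ge_min (ltW lx).
  by rewrite le_max (ltW xh).
have dE x y : [set` `]lo, hi[] x -> [set` `]0%R, +oo[] y ->
    partial1of2 (euler_integrand a beta b) x y = - b * euler_integrand (a + 1) beta (b + 1) x y.
  move=> /inI[x0 _ _] /inE0 y0; rewrite /partial1of2 derive1E.
  have := @euler_integrand_derive a beta b x y x0 y0 => H.
  exact: derive_val.
have H1 x : [set` `]lo, hi[] x -> mu.-integrable `]0%R, +oo[ (EFin \o euler_integrand a beta b x).
  by move=> /inI[x0 _ _]; exact: euler_integrand_integrable.
have H2 x y : [set` `]lo, hi[] x -> [set` `]0%R, +oo[] y ->
    derivable (fun z => euler_integrand a beta b z y) x 1.
  move=> /inI[x0 _ _] /inE0 y0.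
  have H := @euler_integrand_derive a beta b x y x0 y0.
  exact: ex_derive.
have H3 y : 0 <= G y by rewrite !mulr_ge0 ?powR_ge0.
have H4 : mu.-integrable `]0%R, +oo[ (EFin \o G).
  exact: (integrableZl _ (`|b| * K) (beta_integrand_integrable a1 ab1)).
have H5 x y : [set` `]lo, hi[] x -> [set` `]0%R, +oo[] y ->
    `|partial1of2 (euler_integrand a beta b) x y| <= G y.
  move=> Ix By; rewrite dE//; have [x0 mx xM] := inI _ Ix; have y0 := inE0 By.
  rewrite normrM normrN (ger0_norm (euler_integrand_ge0 _ _ _ _ _)) /G -mulrA.
  rewrite ler_wpM2l// -euler_bound//.
  by rewrite ler_wpM2l ?powR_ge0// ler_wpM2l ?powR_ge0// powR1DM_le// mx.
have D := @derivable_under_integral R _ _ mu _ _ (measurable_itv _) w lo hi Iw H1 H2 G H3 H4 H5.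
have E := @differentiation_under_integral R _ _ mu _ _ (measurable_itv _) w lo hi Iw H1 H2 G H3 H4 H5.
apply: DeriveDef; first exact: D.
rewrite -derive1E E /Rintegral.
have -> : (\int[mu]_(y in `]0%R, +oo[) (partial1of2 (euler_integrand a beta b) w y)%:E =
   (- b * euler_integral (a + 1) beta (b + 1) w)%:E)%E.
  rewrite EFinM -(euler_integralE a1 ab1 w0) -integralZl//.
    by apply: eq_integral => y /set_mem By; rewrite dE.
  exact: euler_integrand_integrable.
by [].
Qed.

(** The inversion [y = 1 / (w u)] exchanges the roles of the two factors. *)
Lemma euler_integral_flip a beta b w : 0 < w ->
  (\int[mu]_(y in `]0%R, +oo[) (euler_integrand a beta b w y)%:E =
   (w `^ (beta - a))%:E *
   \int[mu]_(y in `]0%R, +oo[) (euler_integrand (beta + b - a) b beta w y)%:E)%E.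
Proof.
move=> w0; have w1 : 0 < w^-1 by rewrite invr_gt0.
rewrite (@ge0_subst_powR_itv0y R _ (-1) w^-1 w1); last 3 first.
- by rewrite oppr_eq0 oner_eq0.
- move=> y y0; apply: cvgM; first exact: powR_continuous.
  apply: cvgM.
    apply: (@continuous_powRf R (fun y => 1 + y)); first by rewrite addr_gt0.
    by apply: cvgD; [exact: cvg_cst|exact: cvg_id].
  apply: (@continuous_powRf R (fun y => 1 + w * y)); first by rewrite addr_gt0// mulr_gt0.
  apply: cvgD; first exact: cvg_cst.
  by apply: cvgM; [exact: cvg_cst|exact: cvg_id].
- by move=> y _; exact: euler_integrand_ge0.
rewrite -(ge0_integralZl_total (measurable_itv _) (powR_ge0 _ _)
  (euler_integrand_ge0 _ _ _ _) (@measurable_euler_integrand _ _ _ _ setT)).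
apply: eq_integral => y /set_mem/inE0 y0; congr EFin; rewrite /euler_integrand.
have yi : 0 < y `^ (-1) by rewrite powR_gt0.
have y1 : 0 < 1 + y by rewrite addr_gt0.
have wy : 0 < 1 + w * y by rewrite addr_gt0// mulr_gt0.
have yV : y `^ (-1) = y^-1 by rewrite powR_inv1// ltW.
have -> : 1 + w^-1 * y `^ (-1) = (1 + w * y) * (w `^ (-1) * y `^ (-1)).
  by rewrite yV (powR_inv1 (ltW w0)); field; rewrite !gt_eqF.
have -> : 1 + w * (w^-1 * y `^ (-1)) = (1 + y) * y `^ (-1).
  by rewrite yV; field; rewrite !gt_eqF.
have wi : 0 < w `^ (-1) by rewrite powR_gt0.
rewrite -{1 2}(powR_inv1 (ltW w0)).
rewrite (powRM _ (ltW wi) (ltW yi)) (powRM _ (ltW wy) (ltW (mulr_gt0 wi yi))).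
rewrite (powRM _ (ltW wi) (ltW yi)) (powRM _ (ltW y1) (ltW yi)) -!powRrM normrN normr1 mul1r.
have -> : w `^ (beta - a) = w `^ (-1 * (a - 1)) * (w `^ (-1 * - beta) * w `^ (-1)).
  by rewrite -!(powRD_gt0 _ _ w0); congr (_ `^ _); ring.
have -> : y `^ (beta + b - a - 1) =
    y `^ (-1 * (a - 1)) * (y `^ (-1 * - beta) * (y `^ (-1 * - b) * y `^ (-1 - 1))).
  by rewrite -!(powRD_gt0 _ _ y0); congr (_ `^ _); ring.
ring.
Qed.

Lemma euler_integral_flipR a beta b w : 0 < a -> a < beta + b -> 0 < w ->
  euler_integral a beta b w =
  w `^ (beta - a) * euler_integral (beta + b - a) b beta w.
Proof.
move=> a0 ab w0; apply: EFin_inj.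
rewrite EFinM -!euler_integralE//; first exact: euler_integral_flip.
- by rewrite subr_gt0.
- lra.
Qed.

(** Dominated convergence: for [0 < w <= 1] the integrand is at most the sum of the
    integrands at [w = 0] and at [w = 1]. *)
Lemma euler_integral_cvg a c b (u : nat -> R) : 0 < a -> 0 < c -> 0 < c + b ->
  (forall n, 0 < u n <= 1) -> u n @[n --> \oo] --> 0 ->
  euler_integral a (a + c) b (u n) @[n --> \oo] --> Beta a c.
Proof.
move=> a0 c0 cb u01 u0; have ac : a < a + c by rewrite ltrDl.
have acb : a < a + c + b by lra.
have mD := @measurable_itv R `]0%R, +oo[.
pose g y := y `^ (a - 1) * (1 + y) `^ (- (a + c)) +
            y `^ (a - 1) * (1 + y) `^ (- (a + c + b)).
have gi : mu.-integrable `]0%R, +oo[ (EFin \o g).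
  exact: (integrableD _ (beta_integrand_integrable a0 ac)
     (beta_integrand_integrable a0 acb)).
have [] := @dominated_convergence _ _ R mu _ mD
  (fun n y => (euler_integrand a (a + c) b (u n) y)%:E)
  (fun y => (y `^ (a - 1) * (1 + y) `^ (- (a + c)))%:E) (EFin \o g).
- by move=> n; apply/measurable_EFinP; exact: measurable_euler_integrand.
- by apply/measurable_EFinP; apply: measurable_funTS; measR.
- apply: aeW => y /inE0 y0; apply: cvg_EFin; first exact: nearW.
  rewrite /comp/=; apply: cvgM; first exact: cvg_cst.
  rewrite -[X in _ --> X]mulr1; apply: cvgM; first exact: cvg_cst.
  have e1 : (1 : R) = (1 + 0 * y) `^ (- b).
    by rewrite mul0r addr0 (congr1 (fun f => f (- b)) (@powR1 R)).
  rewrite [X in _ --> X]e1.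
  apply: (@cvg_comp _ _ _ (fun n => 1 + u n * y) (@powR R ^~ (- b))); last first.
    by apply: powR_continuous; rewrite mul0r addr0.
  apply: cvgD; first exact: cvg_cst.
  by apply: cvgM => //; exact: cvg_cst.
- exact: gi.
- apply: aeW => y n /inE0 y0; rewrite /= lee_fin ger0_norm ?euler_integrand_ge0//.
  have /andP[un0 un1] := u01 n.
  have y1 : 0 < 1 + y by rewrite addr_gt0.
  have uy : 0 < u n * y by rewrite mulr_gt0.
  rewrite /g -mulrDr ler_wpM2l ?powR_ge0//.
  have -> : (1 + y) `^ (- (a + c + b)) = (1 + y) `^ (- (a + c)) * (1 + y) `^ (- b).
    by rewrite -(powRD_gt0 _ _ y1) -opprD.
  rewrite -[X in _ <= X + _]mulr1 -mulrDr ler_wpM2l ?powR_ge0//.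
  have [b0|b0] := leP 0 b.
    apply: ler_wpDr; first exact: powR_ge0.
    rewrite powRN invf_le1 ?powR_gt0 ?addr_gt0//.
    rewrite -[X in X <= _](powRr0 (1 + u n * y)); apply: ler_powR => //.
    by rewrite lerDl ltW.
  apply: ler_wpDl => //.
  apply: ge0_ler_powR; rewrite ?nnegrE ?oppr_ge0 ?(ltW b0) ?(ltW y1) ?addr_ge0 ?(ltW uy)//.
  by rewrite lerD2l ger_pMl.
move=> _ _; have := Beta_integral_itv0y c0 a0; rewrite (addrC c) => -> H.
have /fine_cvgP[_] := H; rewrite BetaC; apply: cvg_trans; apply: near_eq_cvg.
by apply: nearW => n.
Qed.

(** The hypergeometric differential equation in contiguous form: the integral of
    the derivative of [y ^ a (1 + y) ^ (1 - a - c) (1 + w y) ^ (- b - 1)] vanishes. *)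
Lemma euler_integral_contiguous a c b w : 0 < a -> 0 < c + b -> 0 < w ->
  a * euler_integral a (a + c) b w +
  (1 - c - w * (a + b + 1)) * euler_integral (a + 1) (a + c) (b + 1) w -
  (1 - w) * (b + 1) * w * euler_integral (a + 2) (a + c) (b + 2) w = 0.
Proof.
move=> a0 cb w0.
have a1 : 0 < a + 1 by lra.
have a2 : 0 < a + 2 by lra.
have h0 : a < a + c + b by lra.
have h1 : a + 1 < a + c + (b + 1) by lra.
have h2 : a + 2 < a + c + (b + 2) by lra.
have mD := @measurable_itv R `]0%R, +oo[.
pose k1 := 1 - c - w * (a + b + 1); pose k2 := (1 - w) * (b + 1) * w.
pose e0 := euler_integrand a (a + c) b w.
pose e1 := euler_integrand (a + 1) (a + c) (b + 1) w.
pose e2 := euler_integrand (a + 2) (a + c) (b + 2) w.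
pose f y := a * e0 y + k1 * e1 y - k2 * e2 y.
pose F y := y `^ a * ((1 + y) `^ (1 - (a + c)) * (1 + w * y) `^ (- b - 1)).
have i0 := euler_integrand_integrable a0 h0 w0.
have i1 := euler_integrand_integrable a1 h1 w0.
have i2 := euler_integrand_integrable a2 h2 w0.
have j0 : mu.-integrable `]0%R, +oo[ (EFin \o (fun y => a * e0 y)).
  exact: (integrableZl _ a i0).
have j1 : mu.-integrable `]0%R, +oo[ (EFin \o (fun y => k1 * e1 y)).
  exact: (integrableZl _ k1 i1).
have j2 : mu.-integrable `]0%R, +oo[ (EFin \o (fun y => k2 * e2 y)).
  exact: (integrableZl _ k2 i2).
have j01 : mu.-integrable `]0%R, +oo[ (EFin \o (fun y => a * e0 y + k1 * e1 y)).
  exact: (integrableD _ j0 j1).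
have fi : mu.-integrable `]0%R, +oo[ (EFin \o f) by exact: (integrableB _ j01 j2).
have If : (\int[mu]_(y in `]0%R, +oo[) (f y)%:E =
   (a * euler_integral a (a + c) b w + k1 * euler_integral (a + 1) (a + c) (b + 1) w -
    k2 * euler_integral (a + 2) (a + c) (b + 2) w)%:E)%E.
  rewrite EFinB EFinD (EFinM a) (EFinM k1) (EFinM k2).
  rewrite -(euler_integralE a0 h0 w0) -(euler_integralE a1 h1 w0).
  rewrite -(euler_integralE a2 h2 w0) -!integralZl// -integralD//.
  by rewrite -integralB.
apply: EFin_inj; rewrite -/k1 -/k2 -If.
have [u [v [uv u0 ucvg vcvg]]] := @exhausts_itvoy R 0.
have v0 n : 0 < v n by have [_ _ + _ _] := uv => /(_ n); apply: lt_trans.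
rewrite (@integrable_FTC_exhausts _ _ u v f F 0 0 uv) ?subrr//.
- move=> y /inE0 y0; rewrite /has_derivative.
  have y1 : 0 < 1 + y by rewrite addr_gt0.
  have wy : 0 < 1 + w * y by rewrite addr_gt0// mulr_gt0.
  have d1 := @is_derive1_powR R a y y0.
  have d2 : is_derive y 1 (fun y => (1 + y) `^ (1 - (a + c)))
      ((1 - (a + c)) * (1 + y) `^ (1 - (a + c) - 1) * (0 + 1)).
    apply: (@is_derive_powRf R (fun y => 1 + y)) => //.
  have d3 : is_derive y 1 (fun y => (1 + w * y) `^ (- b - 1))
      ((- b - 1) * (1 + w * y) `^ (- b - 1 - 1) * (0 + w * 1)).
    apply: (@is_derive_powRf R (fun y => 1 + w * y)) => //.
  have := is_derive_funM d1 (is_derive_funM d2 d3).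
  set D := (X in is_derive _ _ _ X -> _).
  suff -> : f y = D by [].
  rewrite /D /f /e0 /e1 /e2 /euler_integrand /k1 /k2.
  have ya k : y `^ (a + k - 1) = y `^ (a - 1) * y `^ k.
    by rewrite -(powRD_gt0 _ _ y0); congr (_ `^ _); ring.
  have yaa : y `^ a = y `^ (a - 1) * y.
    by rewrite -[X in _ = _ * X](powRr1 (ltW y0)) -(powRD_gt0 _ _ y0); congr (_ `^ _); ring.
  have y2 : y `^ 2 = y * y.
    by rewrite (powR_mulrn 2 (ltW y0)) expr2.
  rewrite !ya (powRr1 (ltW y0)) y2 yaa.
  pose W := (1 + w * y) `^ (- b - 2).
  have W1 : (1 + w * y) `^ (- b - 1) = W * (1 + w * y).
    rewrite /W -[X in _ = _ * X](powRr1 (ltW wy)) -(powRD_gt0 _ _ wy); congr (_ `^ _); ring.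
  have W0 : (1 + w * y) `^ (- b) = W * (1 + w * y) * (1 + w * y).
    rewrite -W1 -[X in _ = _ * X](powRr1 (ltW wy)) -(powRD_gt0 _ _ wy); congr (_ `^ _); ring.
  have W2 : (1 + w * y) `^ (- b - 1 - 1) = W by congr (_ `^ _); ring.
  have Y0 : (1 + y) `^ (1 - (a + c)) = (1 + y) `^ (- (a + c)) * (1 + y).
    rewrite -[X in _ = _ * X](powRr1 (ltW y1)) -(powRD_gt0 _ _ y1); congr (_ `^ _); ring.
  have Y1 : (1 + y) `^ (1 - (a + c) - 1) = (1 + y) `^ (- (a + c)) by congr (_ `^ _); ring.
  have V2 : (1 + w * y) `^ (- (b + 2)) = W by rewrite /W opprD.
  have V1 : (1 + w * y) `^ (- (b + 1)) = W * (1 + w * y) by rewrite opprD W1.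
  rewrite V2 V1 W2 W1 W0 Y0 Y1.
  ring.
- move=> y /inE0 y0; rewrite /f /e0 /e1 /e2 /euler_integrand.
  have cy : {for y, continuous (fun y => 1 + y)}.
    by apply: cvgD; [exact: cvg_cst|exact: cvg_id].
  have cwy : {for y, continuous (fun y => 1 + w * y)}.
    apply: cvgD; first exact: cvg_cst.
    by apply: cvgM; [exact: cvg_cst|exact: cvg_id].
  have ce A B C : {for y, continuous (fun y => y `^ A * ((1 + y) `^ B * (1 + w * y) `^ C))}.
    apply: cvgM; first exact: powR_continuous.
    apply: cvgM; first by apply: (@continuous_powRf R (fun y => 1 + y)) => //; rewrite addr_gt0.
    by apply: (@continuous_powRf R (fun y => 1 + w * y)) => //; rewrite addr_gt0// mulr_gt0.
  apply: cvgB; first apply: cvgD.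
  + by apply: cvgM; [exact: cvg_cst|exact: ce].
  + by apply: cvgM; [exact: cvg_cst|exact: ce].
  + by apply: cvgM; [exact: cvg_cst|exact: ce].
- rewrite /F -(mul0r (1 * 1)); apply: cvgM; first exact: powR_cvg0n.
  apply: cvgM.
    have e : (1 : R) = (1 + 0) `^ (1 - (a + c)).
      by rewrite addr0 (congr1 (fun f => f (1 - (a + c))) (@powR1 R)).
    rewrite [X in _ --> X]e.
    apply: (@cvg_comp _ _ _ (fun n => 1 + u n) (@powR R ^~ (1 - (a + c)))); last first.
      by apply: powR_continuous; rewrite addr0.
    by apply: cvgD => //; exact: cvg_cst.
  have e : (1 : R) = (1 + w * 0) `^ (- b - 1).
    by rewrite mulr0 addr0 (congr1 (fun f => f (- b - 1)) (@powR1 R)).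
  rewrite [X in _ --> X]e.
  apply: (@cvg_comp _ _ _ (fun n => 1 + w * u n) (@powR R ^~ (- b - 1))); last first.
    by apply: powR_continuous; rewrite mulr0 addr0.
  apply: cvgD; first exact: cvg_cst.
  by apply: cvgM => //; exact: cvg_cst.
(* at infinity the primitive is of order [y ^ (- (c + b))] *)
- have Fv n : F (v n) = v n `^ (- (c + b)) *
      ((v n `^ (-1) + 1) `^ (1 - (a + c)) * (v n `^ (-1) + w) `^ (- b - 1)).
    have vn := v0 n; have vi : 0 < v n `^ (-1) by rewrite powR_gt0.
    have vV : v n `^ (-1) = (v n)^-1 by rewrite powR_inv1// ltW.
    have e1' : 1 + v n = v n * (v n `^ (-1) + 1) by rewrite vV; field; rewrite gt_eqF.
    have e2' : 1 + w * v n = v n * (v n `^ (-1) + w) by rewrite vV; field; rewrite gt_eqF.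
    have p1 : 0 <= v n `^ (-1) + 1 by rewrite addr_ge0// ltW.
    have p2 : 0 <= v n `^ (-1) + w by rewrite addr_ge0// ltW.
    rewrite /F e1' e2' (powRM _ (ltW vn) p1) (powRM _ (ltW vn) p2).
    have -> : v n `^ (- (c + b)) = v n `^ a * (v n `^ (1 - (a + c)) * v n `^ (- b - 1)).
      by rewrite -!(powRD_gt0 _ _ vn); congr (_ `^ _); ring.
    ring.
  rewrite (_ : (fun n => F (v n)) = (fun n => v n `^ (- (c + b)) *
      ((v n `^ (-1) + 1) `^ (1 - (a + c)) * (v n `^ (-1) + w) `^ (- b - 1)))); last first.
    by apply/funext.
  rewrite -(mul0r ((0 + 1) `^ (1 - (a + c)) * (0 + w) `^ (- b - 1))).
  apply: cvgM; first exact: powRN_cvgyn.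
  have vN : v n `^ (-1) @[n --> \oo] --> 0 by exact: powRN_cvgyn.
  apply: cvgM.
    apply: (@cvg_comp _ _ _ (fun n => v n `^ (-1) + 1) (@powR R ^~ (1 - (a + c)))); last first.
      by apply: powR_continuous; rewrite add0r.
    by apply: cvgD => //; exact: cvg_cst.
  apply: (@cvg_comp _ _ _ (fun n => v n `^ (-1) + w) (@powR R ^~ (- b - 1))); last first.
    by apply: powR_continuous; rewrite add0r.
  by apply: cvgD => //; exact: cvg_cst.
Qed.

End Euler_integral.

(** * The hypergeometric equation *)

Section hypergeometric_equation.
Context {R : realType}.
Notation mu := (@lebesgue_measure R).
Implicit Types (a b c w x : R) (y z : R -> R) (u : nat -> R).

Lemma has_derivative0_cst (f : R -> R) : (forall x, 0 < x < 1 -> has_derivative f x 0) ->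
  forall s t : R, 0 < s < 1 -> 0 < t < 1 -> f s = f t.
Proof.
move=> df; suff H (s t : R) : 0 < s < 1 -> 0 < t < 1 -> s < t -> f s = f t.
  move=> s t s01 t01; have [st|ts|->//] := ltgtP s t; first exact: H.
  by apply/esym; exact: H.
move=> /andP[s0 s1] /andP[t0 t1] st.
have d0 x : s <= x <= t -> is_derive x 1 f 0.
  by move=> /andP[sx xt]; apply: df; rewrite (lt_le_trans s0)// (le_lt_trans xt).
have c0 x : s <= x <= t -> {for x, continuous (fun=> 0 : R)}.
  by move=> _; exact: cvg_cst.
have := FTC_itv st d0 c0; rewrite integral0 => -[] /esym/eqP.
by rewrite subr_eq0 => /eqP.
Qed.

(** The hypergeometric equation
    [theta (theta - c) y = w (theta + a) (theta + b) y] for [theta = w d/dw],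
    whose exponents at 0 are [0] and [c], as a first order system for
    [y] and [y1 = theta y]. *)
Definition hyp_ode a b c y y1 := forall w, 0 < w < 1 ->
  has_derivative y w (y1 w / w) /\
  has_derivative y1 w (((c + w * (a + b)) * y1 w + w * a * b * y w) / ((1 - w) * w)).

Lemma hyp_odeB a b c y y1 z z1 (k : R) : hyp_ode a b c y y1 -> hyp_ode a b c z z1 ->
  hyp_ode a b c (fun w => y w - k * z w) (fun w => y1 w - k * z1 w).
Proof.
move=> hy hz w w01; have [y0 yd] := hy w w01; have [z0 zd] := hz w w01; split.
  rewrite /has_derivative mulrBl -mulrA.
  by apply: is_derive_funB => //; exact: is_derive_cstM.
rewrite /has_derivative (_ : _ / _ =
  ((c + w * (a + b)) * y1 w + w * a * b * y w) / ((1 - w) * w) -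
  k * (((c + w * (a + b)) * z1 w + w * a * b * z w) / ((1 - w) * w))).
  by apply: is_derive_funB => //; exact: is_derive_cstM.
ring.
Qed.

(** Uniqueness, by the Wronskian with the solution [z ~ w ^ c]: it vanishes
    because [y] tends to 0 and [theta y] is negligible with respect to [w ^ c].
    Hence [y] is a multiple of [z], and comparing [theta y] with
    [theta z ~ c w ^ c] shows that the multiple is 0. *)
Lemma hyp_ode_unique a b c y y1 (f f1 : R -> R) u : 0 < c ->
  hyp_ode a b c y y1 ->
  hyp_ode a b c (fun w => w `^ c * f w) (fun w => w `^ c * (c * f w + f1 w)) ->
  (forall w, 0 < w < 1 -> 0 < f w) ->
  (forall n, 0 < u n < 1) -> u n @[n --> \oo] --> 0 ->
  f (u n) @[n --> \oo] --> (1 : R) -> f1 (u n) @[n --> \oo] --> 0 ->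
  y (u n) @[n --> \oo] --> 0 ->
  u n `^ (- c) * y1 (u n) @[n --> \oo] --> 0 ->
  forall w, 0 < w < 1 -> y w = 0.
Proof.
move=> c0 hy hz f0 u01 u0 fu f1u yu y1u.
pose z w := w `^ c * f w; pose z1 w := w `^ c * (c * f w + f1 w).
have z0 w : 0 < w < 1 -> 0 < z w.
  by move=> w01; rewrite mulr_gt0 ?f0// powR_gt0; case/andP: w01.
have upos n : 0 < u n by case/andP: (u01 n).
have uc n : u n `^ c * u n `^ (- c) = 1.
  by rewrite -(powRD_gt0 _ _ (upos n)) subrr powRr0.
have ucc : u n `^ c @[n --> \oo] --> 0 by exact: powR_cvg0n.
have y1u0 : y1 (u n) @[n --> \oo] --> 0.
  rewrite -(mul0r 0) (_ : (fun n => y1 (u n)) =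
     (fun n => u n `^ c * (u n `^ (- c) * y1 (u n)))); first exact: cvgM.
  by apply/funext => n; rewrite mulrA uc mul1r.
have cf : c * f (u n) + f1 (u n) @[n --> \oo] --> c * 1 + 0.
  by apply: cvgD => //; apply: cvgM => //; exact: cvg_cst.
(* the Wronskian over [w ^ c (1 - w) ^ (- a - b - c)], which is constant by the
   formula of Abel and Liouville *)
pose e := a + b + c.
pose N w := w `^ (- c) * ((1 - w) `^ e * (y w * z1 w - z w * y1 w)).
have dN w : 0 < w < 1 -> has_derivative N w 0.
  move=> w01; have /andP[w0 w1] := w01; have w1' : 0 < 1 - w by rewrite subr_gt0.
  have [hy0 hy1] := hy w w01; have [hz0 hz1] := hz w w01.
  have d1 := @is_derive1_powR R (- c) w w0.
  have d2 : is_derive w 1 (fun w => (1 - w) `^ e) (e * (1 - w) `^ (e - 1) * (0 - 1)).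
    apply: (@is_derive_powRf R (fun w => 1 - w)) => //.
  have d3 := is_derive_funB (is_derive_funM hy0 hz1) (is_derive_funM hz0 hy1).
  have := is_derive_funM d1 (is_derive_funM d2 d3).
  set D := (X in is_derive _ _ _ X -> _).
  suff -> : D = 0 by [].
  rewrite /D -/(z w) -/(z1 w).
  have -> : w `^ (- c - 1) = w `^ (- c) / w.
    by rewrite -(powR_inv1 (ltW w0)) -(powRD_gt0 _ _ w0).
  have -> : (1 - w) `^ (e - 1) = (1 - w) `^ e / (1 - w).
    by rewrite -(powR_inv1 (ltW w1')) -(powRD_gt0 _ _ w1').
  have w1n : 1 - w != 0 by rewrite gt_eqF.
  have w0n : w != 0 by rewrite gt_eqF.
  rewrite /e; field.
  by rewrite w1n w0n.
have N0 w : 0 < w < 1 -> N w = 0.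
  move=> w01.
  have NE n : N (u n) = (1 - u n) `^ e *
      (y (u n) * (c * f (u n) + f1 (u n)) - f (u n) * y1 (u n)).
    rewrite /N /z /z1.
    transitivity ((u n `^ c * u n `^ (- c)) * ((1 - u n) `^ e *
      (y (u n) * (c * f (u n) + f1 (u n)) - f (u n) * y1 (u n)))); first by ring.
    by rewrite uc mul1r.
  have : N (u n) @[n --> \oo] --> (1 - 0) `^ e * (0 * (c * 1 + 0) - 1 * 0).
    rewrite (_ : (fun n => N (u n)) = (fun n => (1 - u n) `^ e *
      (y (u n) * (c * f (u n) + f1 (u n)) - f (u n) * y1 (u n)))); last exact/funext.
    apply: cvgM.
      apply: (@cvg_comp _ _ _ (fun n => 1 - u n) (@powR R ^~ e)); last first.
        by apply: powR_continuous; rewrite subr0.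
      by apply: cvgB => //; exact: cvg_cst.
    by apply: cvgB; apply: cvgM.
  rewrite (_ : (fun n => N (u n)) = (fun=> N w)); last first.
    by apply/funext => n; exact: has_derivative0_cst.
  rewrite mul0r mulr0 !subr0 mulr0 => H.
  have H1 : N w @[_ --> \oo] --> N w by exact: cvg_cst.
  exact: (cvg_unique (@norm_hausdorff _ _) H1 H).
have yz w : 0 < w < 1 -> y w * z1 w = z w * y1 w.
  move=> w01; have := N0 w w01; have /andP[w0 w1] := w01 => /eqP.
  rewrite /N mulf_eq0 gt_eqF ?powR_gt0//= mulf_eq0 gt_eqF ?powR_gt0 ?subr_gt0//=.
  by rewrite subr_eq0 => /eqP.
have dK w : 0 < w < 1 -> has_derivative (fun w => y w * (z w)^-1) w 0.
  move=> w01; have [hy0 _] := hy w w01; have [hz0 _] := hz w w01.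
  have zw : z w != 0 by rewrite gt_eqF// z0.
  have wn : w != 0 by rewrite gt_eqF//; case/andP: w01.
  have dV := @is_deriveV R z w (z1 w / w) 1 zw hz0.
  have := is_derive_funM hy0 dV; set D := (X in is_derive _ _ _ X -> _).
  suff -> : D = 0 by [].
  rewrite /D -[_ *: _]/(_ * _) -/(z w).
  transitivity ((z w * y1 w - y w * z1 w) / (w * z w ^+ 2)).
    by field; rewrite wn zw.
  by rewrite -yz// subrr mul0r.
pose K := y (2^-1) / z (2^-1).
have half : 0 < (2^-1 : R) < 1 by rewrite invr_gt0 ltr0n invf_lt1// ltr1n.
have yK w : 0 < w < 1 -> y w = K * z w.
  move=> w01; have -> : K = y w * (z w)^-1 by exact: (has_derivative0_cst dK half w01).
  by rewrite divfK// gt_eqF// z0.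
have y1K w : 0 < w < 1 -> y1 w = K * z1 w.
  move=> w01; have zw : z w != 0 by rewrite gt_eqF// z0.
  by apply: (mulfI zw); rewrite -yz// yK//; ring.
have K0 : K = 0.
  have : u n `^ (- c) * y1 (u n) @[n --> \oo] --> K * (c * 1 + 0).
    rewrite (_ : (fun n => _) = (fun n => K * (c * f (u n) + f1 (u n)))).
      by apply: cvgM => //; exact: cvg_cst.
    apply/funext => n; rewrite y1K// /z1.
    transitivity (K * ((u n `^ c * u n `^ (- c)) * (c * f (u n) + f1 (u n)))); first by ring.
    by rewrite uc mul1r.
  move=> /(cvg_unique (@norm_hausdorff _ _)) /(_ y1u) /eqP.
  by rewrite mulr1 addr0 mulf_eq0 (gt_eqF c0) orbF => /eqP.
by move=> w w01; rewrite yK// K0 mul0r.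
Qed.

(** The recurrence [hyp2F1_coefS] read on the sum of the series. *)
Lemma hyp2F1_theta (A B C : R) x : (forall k : nat, C + k%:R != 0) -> `|x| < 1 ->
  let f := hyp2F1_coef A B C in
  ps (theta (theta f)) x + (C - 1) * ps (theta f) x =
  x * (ps (theta (theta f)) x + (A + B) * ps (theta f) x + A * B * ps f x).
Proof.
move=> Ck x1 /=; set f := hyp2F1_coef A B C.
have cf : cvg_unit_disk f by exact: cvg_unit_disk_hyp2F1.
have ct := cvg_unit_disk_theta cf; have ctt := cvg_unit_disk_theta ct.
have cZ (k : R) (d : nat -> R) : cvg_unit_disk d -> cvg_unit_disk (fun n => k * d n).
  exact: cvg_unit_diskZ.
rewrite -(psZ (C - 1) ct x1) -(psD ctt (cZ _ _ ct) x1).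
rewrite -(psZ (A + B) ct x1) -(psD ctt (cZ _ _ ct) x1) -(psZ (A * B) cf x1).
rewrite -(psD (cvg_unit_diskD ctt (cZ _ _ ct)) (cZ _ _ cf) x1).
have [_ ->] := ps_shift (cvg_unit_diskD ctt (cZ (C - 1) _ ct)) x1.
rewrite /theta !mul0r mulr0 addr0 add0r; congr (x * _); apply: eq_ps => k.
have := hyp2F1_coefS A B (Ck k); rewrite -/f -[k.+1%:R]natr1 => H.
transitivity ((k%:R + 1) * (C + k%:R) * f k.+1); first by ring.
by rewrite H; ring.
Qed.

Lemma hyp_ode_hyp2F1_0 a b c : c < 1 ->
  let f := hyp2F1_coef b a (1 - c) in hyp_ode a b c (ps f) (ps (theta f)).
Proof.
move=> c1 f w w01; have /andP[w0 w1] := w01.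
have cf : cvg_unit_disk f by exact: cvg_unit_disk_hyp2F1.
have wn : `|w| < 1 by rewrite gtr0_norm.
split; first exact: is_derive_ps_theta.
have -> : ((c + w * (a + b)) * ps (theta f) w + w * a * b * ps f w) / ((1 - w) * w) =
    ps (theta (theta f)) w / w.
  have := @hyp2F1_theta b a (1 - c) w; rewrite -/f => H.
  have {}H : ps (theta (theta f)) w + (1 - c - 1) * ps (theta f) w =
    w * (ps (theta (theta f)) w + (b + a) * ps (theta f) w + b * a * ps f w).
    by apply: H => // k; rewrite gt_eqF// ltr_wpDr// subr_gt0.
  have w1n : 1 - w != 0 by rewrite gt_eqF// subr_gt0.
  have w0n : w != 0 by rewrite gt_eqF.
  have -> : (c + w * (a + b)) * ps (theta f) w + w * a * b * ps f w =
      (1 - w) * ps (theta (theta f)) w.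
    move: H; set T2 := ps (theta (theta f)) w; set T1 := ps (theta f) w.
    set T0 := ps f w => H.
    have -> : (1 - w) * T2 = T2 + (1 - c - 1) * T1 + c * T1 - w * T2 by ring.
    by rewrite H; ring.
  by field; rewrite w1n w0n.
exact: (is_derive_ps_theta (cvg_unit_disk_theta cf)).
Qed.

(** Conjugation by [w ^ c] shifts [theta] by [c]: the equation becomes the one with
    parameters [a + c] and [b + c] and exponents [0] and [- c]. *)
Lemma hyp_ode_hyp2F1_c a b c : 0 < c ->
  let f := hyp2F1_coef (a + c) (c + b) (1 + c) in
  hyp_ode a b c (fun w => w `^ c * ps f w)
    (fun w => w `^ c * (c * ps f w + ps (theta f) w)).
Proof.
move=> c0 f w w01; have /andP[w0 w1] := w01.
have cf : cvg_unit_disk f by exact: cvg_unit_disk_hyp2F1.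
have wn : `|w| < 1 by rewrite gtr0_norm.
have w1n : 1 - w != 0 by rewrite gt_eqF// subr_gt0.
have w0n : w != 0 by rewrite gt_eqF.
have dw := @is_derive1_powR R c w w0.
have wc : w `^ (c - 1) = w `^ c / w.
  by rewrite -(powR_inv1 (ltW w0)) -(powRD_gt0 _ _ w0).
have d0 := is_derive_ps_theta cf w01.
have d1 := is_derive_ps_theta (cvg_unit_disk_theta cf) w01.
split.
  have := is_derive_funM dw d0; rewrite /has_derivative.
  set D := (X in is_derive _ _ _ X -> _).
  suff -> : D = w `^ c * (c * ps f w + ps (theta f) w) / w by [].
  by rewrite /D wc; field.
have := is_derive_funM dw (is_derive_funD (is_derive_cstM c d0) d1).
rewrite /has_derivative; set D := (X in is_derive _ _ _ X -> _).
suff -> : ((c + w * (a + b)) * (w `^ c * (c * ps f w + ps (theta f) w)) +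
  w * a * b * (w `^ c * ps f w)) / ((1 - w) * w) = D by [].
rewrite /D wc.
have := @hyp2F1_theta (a + c) (c + b) (1 + c) w; rewrite -/f => H.
have {}H : ps (theta (theta f)) w + (1 + c - 1) * ps (theta f) w =
    w * (ps (theta (theta f)) w + (a + c + (c + b)) * ps (theta f) w
         + (a + c) * (c + b) * ps f w).
  by apply: H => // k; rewrite gt_eqF// ltr_wpDr// addr_gt0.
move: H; set T2 := ps (theta (theta f)) w; set T1 := ps (theta f) w.
set T0 := ps f w => H.
have {}H : (1 - w) * T2 = - c * T1 + w * ((a + c + (c + b)) * T1 + (a + c) * (c + b) * T0).
  have -> : (1 - w) * T2 = T2 + (1 + c - 1) * T1 - c * T1 - w * T2 by ring.
  by rewrite H; ring.
have -> : T2 = (- c * T1 + w * ((a + c + (c + b)) * T1 + (a + c) * (c + b) * T0)) / (1 - w).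
  by rewrite -H mulrC mulKf.
by field; rewrite w1n w0n.
Qed.

Lemma hyp_ode_euler_integral a b c : 0 < a -> 0 < c + b ->
  hyp_ode a b c (euler_integral a (a + c) b)
    (fun w => - b * (w * euler_integral (a + 1) (a + c) (b + 1) w)).
Proof.
move=> a0 cb w /andP[w0 w1].
have a1 : 0 < a + 1 by lra.
have h0 : a < a + c + b by lra.
have h1 : a + 1 < a + c + (b + 1) by lra.
have w1n : 1 - w != 0 by rewrite gt_eqF// subr_gt0.
have w0n : w != 0 by rewrite gt_eqF.
have d0 := is_derive_euler_integral a0 h0 w0.
have d1 := is_derive_euler_integral a1 h1 w0.
split.
  rewrite /has_derivative.
  have -> : - b * (w * euler_integral (a + 1) (a + c) (b + 1) w) / w =
    - b * euler_integral (a + 1) (a + c) (b + 1) w by field.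
  exact: d0.
have := is_derive_cstM (- b) (is_derive_funM (is_derive_id w 1) d1).
rewrite /has_derivative; set D := (X in is_derive _ _ _ X -> _).
move=> dD; set L := (X in is_derive _ _ _ X); suff -> : L = D by [].
rewrite /L /D; have := euler_integral_contiguous a0 cb w0.
have -> : a + 1 + 1 = a + 2 by ring.
have -> : b + 1 + 1 = b + 2 by ring.
set T0 := euler_integral a (a + c) b w.
set T1 := euler_integral (a + 1) (a + c) (b + 1) w.
set T2 := euler_integral (a + 2) (a + c) (b + 2) w => H.
have {}H : a * T0 = - (1 - c - w * (a + b + 1)) * T1 + (1 - w) * (b + 1) * w * T2.
  apply/eqP; rewrite -subr_eq0 -H; apply/eqP; ring.
have -> : (c + w * (a + b)) * (- b * (w * T1)) + w * a * b * T0 =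
  (c + w * (a + b)) * (- b * (w * T1)) + w * b * (a * T0) by ring.
by rewrite H; field; rewrite w1n w0n.
Qed.

End hypergeometric_equation.

(** * Expansion of Euler's integral at 0 *)

Section connection.
Context {R : realType}.
Implicit Types (a b c w x : R).

Lemma ps_ge0 (d : nat -> R) x : (forall k, 0 <= d k) -> cvgn (pseries d x) -> 0 <= x ->
  0 <= ps d x.
Proof.
move=> d0 cd x0; apply: limr_ge => //; apply: nearW => n.
by rewrite /pseries /series/= sumr_ge0// => i _; rewrite mulr_ge0// exprn_ge0.
Qed.

Lemma ps_hyp2F1_gt0 A B C w : 0 < A -> 0 < B -> 0 < C -> 0 < w < 1 ->
  0 < ps (hyp2F1_coef A B C) w.
Proof.
move=> A0 B0 C0 /andP[w0 w1]; have wn : `|w| < 1 by rewrite gtr0_norm.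
have cf : cvg_unit_disk (hyp2F1_coef A B C) by exact: cvg_unit_disk_hyp2F1.
have [cS ->] := ps_shift cf wn; rewrite hyp2F1_coef0 ltr_pwDl//.
rewrite mulr_ge0 ?(ltW w0)// ps_ge0 ?(ltW w0)// => k.
by rewrite !divr_ge0 ?mulr_ge0 ?ltW// ?pochhammer_gt0.
Qed.

Lemma ps_cvg0 (d : nat -> R) (u : nat -> R) : cvg_unit_disk d ->
  u n @[n --> \oo] --> 0 -> ps d (u n) @[n --> \oo] --> d 0%N.
Proof.
move=> cd u0; rewrite -(ps0 cd).
apply: (@cvg_comp _ _ _ u (ps d) _ _ _ u0); apply: ps_continuous => //.
by rewrite normr0.
Qed.

(* Limits at 0 are taken along this sequence. *)
Let u (n : nat) : R := n.+2%:R^-1.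

Let u01 n : 0 < u n < 1.
Proof. by rewrite /u invr_gt0 ltr0n/= invf_lt1// ltr1n. Qed.

Let u_cvg : u n @[n --> \oo] --> 0.
Proof. by rewrite (cvg_shiftS (fun n => (n.+1%:R : R)^-1)); exact: cvg_harmonic. Qed.

(** The relation that makes [w ^ (- c) theta] of the difference of the two sides
    vanish at 0 in [connection_base]. At the poles of [Gamma] it rests on
    [invr_GammaS]. *)
Lemma Beta_oppS b c : c != 0 ->
  c * Beta (- c) (c + b) = - b * Beta (c + b) (1 - c).
Proof.
move=> c0; rewrite /Beta addKr.
have -> : c + b + (1 - c) = b + 1 by ring.
have -> : 1 - c = - c + 1 by ring.
have nc0 : - c != 0 by rewrite oppr_eq0.
by rewrite (GammaS nc0) (invr_GammaS b); ring.
Qed.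

(** The difference of the two sides solves the equation, and [hyp_ode_unique]
    applies: [euler_integral_cvg] gives its limit at 0, and also that of
    [w ^ (- c) theta] of it, since inverting the variable of integration in the
    derivative of Euler's integral extracts the factor [w ^ c] and leaves an
    integral with exponent [1 - c > 0]. *)
Lemma connection_base a b c w : 0 < a -> 0 < c < 1 -> 0 < c + b -> 0 < w < 1 ->
  euler_integral a (a + c) b w =
  Beta a c * ps (hyp2F1_coef b a (1 - c)) w +
  w `^ c * (Beta (- c) (c + b) * ps (hyp2F1_coef (a + c) (c + b) (1 + c)) w).
Proof.
move=> a0 /andP[c0 c1] cb w01.
set f0 := hyp2F1_coef b a (1 - c); set f := hyp2F1_coef (a + c) (c + b) (1 + c).
set B1 := Beta a c; set B2 := Beta (- c) (c + b).
have cf0 : cvg_unit_disk f0 by exact: cvg_unit_disk_hyp2F1.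
have cf : cvg_unit_disk f by exact: cvg_unit_disk_hyp2F1.
have upos n : 0 < u n by case/andP: (u01 n).
have un1 n : `|u n| < 1 by rewrite gtr0_norm//; case/andP: (u01 n).
have h1 : a + 1 < a + c + (b + 1) by lra.
have a1 : 0 < a + 1 by lra.
have ode := hyp_odeB B2 (hyp_odeB B1 (hyp_ode_euler_integral a0 cb) (hyp_ode_hyp2F1_0 a b c1))
  (hyp_ode_hyp2F1_c a b c0).
have := hyp_ode_unique (u := u) c0 ode (hyp_ode_hyp2F1_c a b c0).
rewrite -/f0 -/f => /(_ _ u01 u_cvg) H.
have fu : ps f (u n) @[n --> \oo] --> (1 : R).
  by rewrite -(hyp2F1_coef0 (a + c) (c + b) (1 + c)); exact: ps_cvg0.
have f1u : ps (theta f) (u n) @[n --> \oo] --> (0 : R).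
  rewrite (_ : 0 = theta f 0); last by rewrite /theta mul0r.
  by apply: ps_cvg0 => //; exact: cvg_unit_disk_theta.
suff : forall w, 0 < w < 1 ->
    euler_integral a (a + c) b w - B1 * ps f0 w - B2 * (w `^ c * ps f w) = 0.
  move=> /(_ w w01) /eqP; rewrite subr_eq0 => /eqP e.
  have -> : w `^ c * (B2 * ps f w) = B2 * (w `^ c * ps f w) by ring.
  by rewrite -e; ring.
apply: H => //.
- by move=> x x01; apply: ps_hyp2F1_gt0 => //; lra.
- rewrite (_ : 0 = B1 - B1 * 1 - B2 * (0 * 1)); last by ring.
  apply: cvgB; first apply: cvgB.
  + by apply: euler_integral_cvg => // n; rewrite upos/= ltW//; case/andP: (u01 n).
  + apply: cvgM; first exact: cvg_cst.
    by rewrite -(hyp2F1_coef0 b a (1 - c)); exact: ps_cvg0.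
  + apply: cvgM; first exact: cvg_cst.
    by apply: cvgM => //; exact: powR_cvg0n.
- have E n : u n `^ (- c) * (- b * (u n * euler_integral (a + 1) (a + c) (b + 1) (u n)) -
      B1 * ps (theta f0) (u n) - B2 * (u n `^ c * (c * ps f (u n) + ps (theta f) (u n)))) =
      - b * euler_integral (c + b) (c + b + (1 - c)) (a + c) (u n) -
      B1 * (u n `^ (1 - c) * ps (pseries_diffs f0) (u n)) -
      B2 * (c * ps f (u n) + ps (theta f) (u n)).
    rewrite (euler_integral_flipR a1 h1 (upos n)) ps_theta//.
    have -> : a + c + (b + 1) - (a + 1) = c + b by ring.
    have -> : a + c - (a + 1) = c - 1 by ring.
    have -> : c + b + (1 - c) = b + 1 by ring.
    have e1 : u n `^ (- c) * (u n * u n `^ (c - 1)) = 1.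
      rewrite -[X in _ * (X * _)](powRr1 (ltW (upos n))) -!(powRD_gt0 _ _ (upos n)).
      by rewrite (_ : _ + _ = 0) ?powRr0//; ring.
    have e2 : u n `^ (- c) * u n `^ c = 1.
      by rewrite -(powRD_gt0 _ _ (upos n)) addNr powRr0.
    have e3 : u n `^ (1 - c) = u n `^ (- c) * u n.
      rewrite -[X in _ = _ * X](powRr1 (ltW (upos n))) -(powRD_gt0 _ _ (upos n)).
      by congr (_ `^ _); ring.
    rewrite e3.
    set G := euler_integral _ _ _ _; set P := ps (pseries_diffs f0) _.
    set Q := c * _ + _.
    transitivity (- b * ((u n `^ (- c) * (u n * u n `^ (c - 1))) * G) -
      B1 * (u n `^ (- c) * u n * P) - B2 * ((u n `^ (- c) * u n `^ c) * Q)); first by ring.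
    by rewrite e1 e2 !mul1r.
  rewrite (_ : (fun n => _) = (fun n =>
      - b * euler_integral (c + b) (c + b + (1 - c)) (a + c) (u n) -
      B1 * (u n `^ (1 - c) * ps (pseries_diffs f0) (u n)) -
      B2 * (c * ps f (u n) + ps (theta f) (u n)))); last exact/funext.
  rewrite (_ : 0 = - b * Beta (c + b) (1 - c) - B1 * (0 * pseries_diffs f0 0) -
      B2 * (c * 1 + 0)); last first.
    rewrite -Beta_oppS ?gt_eqF// -/B2; ring.
  apply: cvgB; first apply: cvgB.
  + apply: cvgM; first exact: cvg_cst.
    apply: euler_integral_cvg => //; [by lra|by lra|].
    by move=> n; rewrite upos/= ltW//; case/andP: (u01 n).
  + apply: cvgM; first exact: cvg_cst.
    apply: cvgM; first by apply: powR_cvg0n => //; lra.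
    by apply: ps_cvg0 => //; exact: cvg_unit_disk_diffs.
  + apply: cvgM; first exact: cvg_cst.
    by apply: cvgD => //; apply: cvgM => //; exact: cvg_cst.
Qed.

(** The derivatives of the two sides are multiples of the two sides for [a + 1],
    [b + 1] and [c - 1], so that induction on the integer part of [c] makes their
    difference constant; its limit at 0 is 0. *)
Lemma connection_pos (n : nat) a b c w : 0 < a -> n%:R < c < n.+1%:R -> 0 < c + b -> 0 < w < 1 ->
  euler_integral a (a + c) b w =
  Beta a c * ps (hyp2F1_coef b a (1 - c)) w +
  w `^ c * (Beta (- c) (c + b) * ps (hyp2F1_coef (a + c) (c + b) (1 + c)) w).
Proof.
elim: n => [|n IH] in a b c w *; first exact: connection_base.
move=> a0 /andP[nc cn] cb w01.
have c1 : 1 < c by apply: le_lt_trans nc; rewrite -natr1 lerDr.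
have c0 : 0 < c by lra.
have a1 : 0 < a + 1 by lra.
have c1n : 1 - c != 0 by rewrite subr_eq0 eq_sym gt_eqF.
have cn0 : c != 0 by rewrite gt_eqF.
have nc1 : n%:R < c - 1 < n.+1%:R by rewrite -!natr1 in nc cn *; apply/andP; split; lra.
have cb1 : 0 < c - 1 + (b + 1) by lra.
have acb : a < a + c + b by lra.
set f0 := hyp2F1_coef b a (1 - c); set f := hyp2F1_coef (a + c) (c + b) (1 + c).
set B1 := Beta a c; set B2 := Beta (- c) (c + b).
have cf0 : cvg_unit_disk f0 by exact: cvg_unit_disk_hyp2F1.
have cf : cvg_unit_disk f by exact: cvg_unit_disk_hyp2F1.
have upos m : 0 < u m by case/andP: (u01 m).
pose D w := euler_integral a (a + c) b w - (B1 * ps f0 w + B2 * (w `^ c * ps f w)).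
have Bs1 : - b * Beta (a + 1) (c - 1) = B1 * (b * a / (1 - c)).
  have ec : Gamma c = (c - 1) * Gamma (c - 1).
    by rewrite -GammaS ?subrK// subr_eq0 gt_eqF.
  rewrite /B1 /Beta (GammaS (lt0r_neq0 a0)) ec.
  have -> : a + 1 + (c - 1) = a + c by ring.
  by field; rewrite c1n gt_eqF// Gamma_gt0// addr_gt0.
have Bs2 : - b * Beta (1 - c) (c + b) = B2 * c by rewrite BetaC -Beta_oppS// mulrC.
have dD x : 0 < x < 1 -> has_derivative D x 0.
  move=> x01; have /andP[x0 x1] := x01; have xn : `|x| < 1 by rewrite gtr0_norm.
  have d1 := is_derive_euler_integral a0 acb x0.
  have d2 := is_derive_cstM B1 (is_derive_ps cf0 xn).
  have [d3 _] := hyp_ode_hyp2F1_c a b c0 x01; rewrite -/f in d3.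
  have := is_derive_funB d1 (is_derive_funD d2 (is_derive_cstM B2 d3)).
  rewrite /has_derivative; set E := (X in is_derive _ _ _ X -> _); suff -> : E = 0 by [].
  rewrite /E.
  have -> : c * ps f x + ps (theta f) x = c * ps (hyp2F1_coef (a + c) (c + b) c) x.
    rewrite -psZ// -psD//; [|exact: cvg_unit_diskZ|exact: cvg_unit_disk_theta].
    rewrite -psZ//; last exact: cvg_unit_disk_hyp2F1.
    apply: eq_ps => k; rewrite /theta /f /hyp2F1_coef (addrC 1 c).
    have pk : 0 < pochhammer c k by rewrite pochhammer_gt0.
    have pk1 : pochhammer (c + 1) k = pochhammer c k * (c + k%:R) / c.
      by rewrite pochhammer_shift mulrC mulKf.
    have ck : 0 < c + k%:R by rewrite ltr_wpDr.
    rewrite pk1; field; rewrite cn0 !gt_eqF//=.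
  have -> : ps (pseries_diffs f0) x =
      b * a / (1 - c) * ps (hyp2F1_coef (b + 1) (a + 1) (1 - (c - 1))) x.
    rewrite -psZ//; last exact: cvg_unit_disk_hyp2F1.
    apply: eq_ps => k; rewrite pseries_diffs_hyp2F1//.
    by have -> : 1 - c + 1 = 1 - (c - 1) by ring.
  have := IH (a + 1) (b + 1) (c - 1) x a1 nc1 cb1 x01.
  have -> : a + 1 + (c - 1) = a + c by ring.
  have -> : c - 1 + (b + 1) = c + b by ring.
  have -> : 1 + (c - 1) = c by ring.
  have -> : - (c - 1) = 1 - c by ring.
  move=> ->.
  have -> : x `^ (c - 1) = x `^ c / x.
    by rewrite -(powR_inv1 (ltW x0)) -(powRD_gt0 _ _ x0).
  set F1 := ps _ x; set F2 := ps _ x.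
  transitivity ((- b * Beta (a + 1) (c - 1)) * F1 - B1 * (b * a / (1 - c)) * F1 +
    ((- b * Beta (1 - c) (c + b)) - B2 * c) * (x `^ c / x * F2)); first by ring.
  by rewrite Bs1 Bs2; ring.
have D0 : D (u m) @[m --> \oo] --> B1 - (B1 * 1 + B2 * (0 * 1)).
  apply: cvgB.
    by apply: euler_integral_cvg => // m; rewrite upos/= ltW//; case/andP: (u01 m).
  apply: cvgD.
    apply: cvgM; first exact: cvg_cst.
    by rewrite -(hyp2F1_coef0 b a (1 - c)); exact: ps_cvg0.
  apply: cvgM; first exact: cvg_cst.
  apply: cvgM; first exact: powR_cvg0n.
  by rewrite -(hyp2F1_coef0 (a + c) (c + b) (1 + c)); exact: ps_cvg0.
have : D w = 0.
  have H1 : D (u m) @[m --> \oo] --> D w.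
    rewrite (_ : (fun m => D (u m)) = (fun=> D w)); first exact: cvg_cst.
    by apply/funext => m; exact: has_derivative0_cst.
  rewrite (cvg_unique (@norm_hausdorff _ _) H1 D0); ring.
by rewrite /D => /eqP; rewrite subr_eq0 => /eqP ->; rewrite [B2 * _]mulrCA.
Qed.

(** Expansion at 0 of the Euler integral; the case [-1 < c < 0] follows from the
    case [0 < c < 1] by the inversion of the variable of integration. *)
Lemma connection_formula a b c w : 0 < a -> -1 < c -> (forall n : nat, c != n%:R) ->
  0 < c + b -> 0 < w < 1 ->
  euler_integral a (a + c) b w =
  Beta a c * ps (hyp2F1_coef b a (1 - c)) w +
  w `^ c * (Beta (- c) (c + b) * ps (hyp2F1_coef (a + c) (c + b) (1 + c)) w).
Proof.
move=> a0 c1 cn cb w01; have /andP[w0 w1] := w01.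
have [c0|c0] := ltP 0 c.
  have /andP[c2 c3] := truncn_itv (ltW c0).
  apply: (@connection_pos (Num.truncn c)) => //; rewrite c3 andbT lt_neqAle c2 andbT.
  by rewrite eq_sym; exact: cn.
have {}c0 : c < 0 by rewrite lt_neqAle c0 andbT; exact: (cn 0%N).
have acb : a < a + c + b by lra.
rewrite (euler_integral_flipR a0 acb w0).
have -> : a + c + b - a = c + b by ring.
have -> : a + c - a = c by ring.
have {2}-> : b = c + b + - c by ring.
have Nc : 0 < - c < 1 by apply/andP; split; lra.
have h : 0 < - c + (a + c) by lra.
rewrite (connection_base cb Nc h w01).
have -> : c + b + - c = b by ring.
have -> : - c + (a + c) = a by ring.
rewrite !opprK (BetaC (c + b)) (BetaC c).
have e : w `^ c * w `^ (- c) = 1 by rewrite -(powRD_gt0 _ _ w0) subrr powRr0.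
set F1 := ps _ w; set F2 := ps _ w.
transitivity (w `^ c * (Beta (- c) (c + b) * F1) +
  (w `^ c * w `^ (- c)) * (Beta a c * F2)); first by ring.
by rewrite e mul1r addrC.
Qed.

End connection.

(** * Weighted integrals of arcsinh *)

Section Abel.
Context {R : realType}.
Implicit Types (d : nat -> R) (z : R).

Lemma normed_pseries1 d : [normed pseries d 1] = [normed series d].
Proof.
by rewrite /normed_series_of; congr series; apply/funext => k; rewrite /= expr1n mulr1.
Qed.

Let pseries_tail d z (N n : nat) : 0 <= z <= 1 -> (N <= n)%N ->
  `|pseries d z n - pseries d z N| <=
  [normed series d] n - [normed series d] N.
Proof.
move=> /andP[z0 z1] Nn; rewrite /pseries !sub_series_geq//.
apply: le_trans (ler_norm_sum _ _ _) _; apply: ler_sum => k _.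
by rewrite normrM ler_piMr// normrX ger0_norm// exprn_ile1.
Qed.

(** Absolute convergence at 1 makes the tails small uniformly on the closed unit
    interval. *)
Lemma abel_cvg d (v : nat -> R) : cvgn [normed series d] ->
  (forall n, 0 <= v n < 1) -> v n @[n --> \oo] --> (1 : R) ->
  ps d (v n) @[n --> \oo] --> ps d 1.
Proof.
move=> cd v01 v1; set T := limn [normed series d].
have cz z : 0 <= z <= 1 -> cvgn (pseries d z).
  move=> /andP[z0 z1]; apply: normed_cvg.
  apply: series_le_cvg cd => n /=; [exact: normr_ge0|exact: normr_ge0|].
  by rewrite normrM ler_piMr// normrX ger0_norm// exprn_ile1.
have TN N : [normed series d] N <= T.
  apply: nondecreasing_cvgn_le => //; apply/nondecreasing_seqP => n.
  by rewrite /normed_series_of seriesSr/= lerDl.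
have tail z N : 0 <= z <= 1 -> `|ps d z - pseries d z N| <= T - [normed series d] N.
  move=> z01; have cN : `|pseries d z n - pseries d z N| @[n --> \oo] -->
      `|ps d z - pseries d z N|.
    by apply: cvg_norm; apply: cvgB; [exact: cz|exact: cvg_cst].
  rewrite -(cvg_lim _ cN)//; apply: limr_le; first by apply/cvg_ex; eexists; exact: cN.
  near=> n; apply: le_trans (pseries_tail d z01 _) _.
    by near: n; exact: nbhs_infty_ge.
  by rewrite lerD2r.
apply/cvgrPdist_lt => e e0.
have e3 : 0 < e / 3 by rewrite divr_gt0.
have [N _ HN] : \forall n \near \oo, T - [normed series d] n < e / 3.
  have : T - [normed series d] n @[n --> \oo] --> T - T by apply: cvgB => //; exact: cvg_cst.
  by rewrite subrr => /cvgr_lt; apply.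
have {}HN := HN N (leqnn N); rewrite /= in HN.
have cN : pseries d (v n) N @[n --> \oo] --> pseries d 1 N.
  elim: N {HN} => [|N IHN].
    by rewrite /pseries/= /series/= big_geq//; under eq_fun do rewrite big_geq//; exact: cvg_cst.
  rewrite /pseries seriesSr/=; under eq_fun do rewrite seriesSr/=.
  apply: cvgD; first exact: IHN.
  apply: cvgM; first exact: cvg_cst.
  exact: (@cvg_comp _ _ _ v (fun z => z ^+ N) _ _ _ v1 (@exprn_continuous _ N 1)).
near=> n.
have h1 : `|ps d 1 - pseries d 1 N| < e / 3.
  by apply: le_lt_trans HN; apply: tail; rewrite ler01 lexx.
have h2 : `|pseries d 1 N - pseries d (v n) N| < e / 3.
  by near: n; move/cvgrPdist_lt : cN; apply.
have h3 : `|ps d (v n) - pseries d (v n) N| < e / 3.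
  by apply: le_lt_trans HN; apply: tail; have /andP[-> /ltW ->] := v01 n.
rewrite (_ : ps d 1 - ps d (v n) = (ps d 1 - pseries d 1 N) +
  (pseries d 1 N - pseries d (v n) N) - (ps d (v n) - pseries d (v n) N)); last by ring.
apply: le_lt_trans (ler_normB _ _) _.
have := ler_normD (ps d 1 - pseries d 1 N) (pseries d 1 N - pseries d (v n) N).
lra.
Unshelve. all: by end_near. Qed.

Lemma ps_left_cvg d (v : nat -> R) z :
  cvg_unit_disk d -> z < 1 \/ z = 1 /\ cvgn [normed series d] ->
  (forall n, 0 <= v n < z) -> v n @[n --> \oo] --> z ->
  ps d (v n) @[n --> \oo] --> ps d z.
Proof.
move=> cd [z1|[-> cz]] v0 vz; last exact: abel_cvg.
apply: (@cvg_comp _ _ _ v (ps d) _ _ _ vz); apply: ps_continuous => //.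
have /andP[v00 vz0] := v0 0%N.
by rewrite ger0_norm// ltW// (le_lt_trans v00).
Qed.

End Abel.

Section weighted_arcsinh.
Context {R : realType}.
Notation mu := (@lebesgue_measure R).
Implicit Types (p q s alpha beta a b c d A x : R).

(** The parameters [d] and [d + 1] of a [3F2] act as integration against
    [w ^ (d - 1)]: [(theta + d) 3F2 = d 2F1]. *)
Lemma hyp3F2_coef_lower A B C d k : (forall n : nat, d != - n%:R) ->
  (d + k%:R) * hyp3F2_coef A B d C (d + 1) k = d * hyp2F1_coef A B C k.
Proof.
move=> dn; rewrite /hyp3F2_coef /hyp2F1_coef invfM.
set r := (pochhammer C k)^-1; set t := (k`!%:R)^-1.
transitivity (((d + k%:R) * (pochhammer d k / pochhammer (d + 1) k)) *
  (pochhammer A k * pochhammer B k * r * t)); first by ring.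
by rewrite (pochhammer_ratio k dn).
Qed.

Lemma ps_hyp3F2_lower A B C d w : (forall n : nat, d != - n%:R) -> `|w| < 1 ->
  d * ps (hyp3F2_coef A B d C (d + 1)) w + ps (theta (hyp3F2_coef A B d C (d + 1))) w =
  d * ps (hyp2F1_coef A B C) w.
Proof.
move=> dn w1; set h := hyp3F2_coef _ _ _ _ _.
have ch : cvg_unit_disk h by exact: cvg_unit_disk_hyp3F2.
rewrite -(psZ d ch w1) -(psD (cvg_unit_diskZ (a := d) ch) (cvg_unit_disk_theta ch) w1).
rewrite -(psZ d (@cvg_unit_disk_hyp2F1 _ A B C) w1); apply: eq_ps => k.
by rewrite -(hyp3F2_coef_lower A B C k dn) /theta -/h mulrDl.
Qed.

Lemma is_derive_powR_hyp3F2 A B C d q (t : R) : 0 < q -> 0 < d -> 0 < t < 1 ->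
  is_derive t 1 (fun t => t `^ (q * d) * ps (hyp3F2_coef A B d C (d + 1)) (t `^ q))
    (q * d * (t `^ (q * d - 1) * ps (hyp2F1_coef A B C) (t `^ q))).
Proof.
move=> q0 d0 t01; have /andP[t0 t1] := t01.
set h := hyp3F2_coef _ _ _ _ _.
have ch : cvg_unit_disk h by exact: cvg_unit_disk_hyp3F2.
have z01 : 0 < t `^ q < 1 by rewrite powR_gt0// powR_lt1.
have zn : `|t `^ q| < 1 by rewrite gtr0_norm; case/andP: z01.
have dn (n : nat) : d != - n%:R.
  by rewrite gt_eqF// (le_lt_trans _ d0)// oppr_le0.
have dz := @is_derive1_powR R q t t0.
have d1 := @is_derive1_comp R (ps h) (fun t => t `^ q) t _ _ (is_derive_ps_theta ch z01) dz.
have d2 := @is_derive1_powR R (q * d) t t0.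
have := is_derive_funM d2 d1; set D := (X in is_derive _ _ _ X -> _).
suff -> : q * d * (t `^ (q * d - 1) * ps (hyp2F1_coef A B C) (t `^ q)) = D by [].
rewrite /D /comp.
transitivity (q * t `^ (q * d - 1) * (d * ps (hyp2F1_coef A B C) (t `^ q))); first by ring.
rewrite -(ps_hyp3F2_lower A B C dn zn) -/h.
have e1 : t `^ (q * d) = t `^ (q * d - 1) * t.
  by rewrite -[X in _ = _ * X](powRr1 (ltW t0)) -(powRD_gt0 _ _ t0); congr (_ `^ _); ring.
have e2 : t `^ q = t `^ (q - 1) * t.
  by rewrite -[X in _ = _ * X](powRr1 (ltW t0)) -(powRD_gt0 _ _ t0); congr (_ `^ _); ring.
set F := ps h _; set F1 := ps (theta h) _; rewrite e1 e2.
by field; rewrite !gt_eqF ?powR_gt0.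
Qed.

(** The variable [t] now ranges over an interval that does not depend on [x], as
    needed to exchange the integrals over [x] and [t]. *)
Lemma arcsinh_pq_scale p q x s : 0 < p -> 0 < x -> 0 < s ->
  ((arcsinh_pq p q (s * x))%:E =
   \int[mu]_(t in `]0%R, s[) ((1 + (x * t) `^ q) `^ (- p^-1) * x)%:E)%E.
Proof.
move=> p0 x0 s0; have xs0 : 0 < x * s by rewrite mulr_gt0.
rewrite integral_arcsinh_pq (mulrC s x) fineK.
  rewrite (@ge0_subst_scale R (fun t => (1 + t `^ q) `^ (- p^-1)) x s x0 s0)//.
  - move=> y y0; apply: (@continuous_powRf R (fun y => 1 + y `^ q)).
      by rewrite ltr_pwDl// powR_ge0.
    by apply: cvgD; [exact: cvg_cst|exact: powR_continuous].
  - by move=> y _; exact: powR_ge0.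
rewrite ge0_fin_numE; last by apply: integral_ge0 => t _; rewrite lee_fin powR_ge0.
apply: (@le_lt_trans _ _ (\int[mu]_(t in `]0%R, (x * s)%R[) 1%:E)%E).
  apply: ge0_le_integral => //.
  - by move=> t _; rewrite lee_fin powR_ge0.
  - by apply/measurable_EFinP; apply: measurable_funTS; measR.
  - move=> t _; rewrite lee_fin powRN invf_le1 ?powR_gt0 ?ltr_pwDl ?powR_ge0//.
    rewrite -[X in X <= _](powRr0 (1 + t `^ q)); apply: ler_powR.
      by rewrite lerDl powR_ge0.
    by rewrite invr_ge0 ltW.
rewrite integral_cst//= lebesgue_measure_itv/= lte_fin xs0 oppr0 adde0 mul1e.
exact: ltry.
Qed.

(** Tonelli's theorem, followed by the substitution [y = x ^ q] in the integral
    over [x]. *)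
Lemma integral_arcsinh_pq_tonelli p q alpha beta s : 1 < p -> 1 < q ->
  0 < alpha + q^-1 -> alpha + q^-1 < beta + p^-1 -> 0 < s ->
  (\int[mu]_(x in `]0%R, +oo[)
     (arcsinh_pq p q (s * x) / (x `^ (1 - alpha * q) * (1 + x `^ q) `^ beta))%:E =
   \int[mu]_(t in `]0%R, s[) (q^-1 * euler_integral (alpha + q^-1) beta p^-1 (t `^ q))%:E)%E.
Proof.
move=> p1 q1 A0 AB s0.
have p0 : 0 < p by rewrite (lt_trans ltr01).
have q0 : 0 < q by rewrite (lt_trans ltr01).
pose f x t : R := x `^ (alpha * q) * ((1 + x `^ q) `^ (- beta) * (1 + (x * t) `^ q) `^ (- p^-1)).
have f0 x t : 0 <= f x t by rewrite !mulr_ge0 ?powR_ge0.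
have mf : measurable_fun [set: R * R] (fun z => f z.1 z.2) by rewrite /f; measR.
transitivity (\int[mu]_(x in `]0%R, +oo[) \int[mu]_(t in `]0%R, s[) (f x t)%:E)%E.
  apply: eq_integral => x /set_mem/=; rewrite in_itv/= andbT => x0.
  pose w := x `^ (alpha * q - 1) * (1 + x `^ q) `^ (- beta).
  have w0 : 0 <= w by rewrite mulr_ge0 ?powR_ge0.
  rewrite powR_weight opprB -/w mulrC EFinM (arcsinh_pq_scale q p0 x0 s0).
  rewrite -(ge0_integralZl_total (measurable_itv _) w0); last 2 first.
  - by move=> t; rewrite mulr_ge0 ?powR_ge0// ltW.
  - by measR.
  apply: eq_integral => t _; congr EFin; rewrite /w /f.
  have -> : x `^ (alpha * q) = x `^ (alpha * q - 1) * x.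
    by rewrite -[X in _ = _ * X](powRr1 (ltW x0)) -(powRD_gt0 _ _ x0); congr (_ `^ _); ring.
  move: (x `^ _) (_ `^ (- beta)) (_ `^ (- p^-1)) => u v r; ring.
rewrite (tonelli_itv (measurable_itv _) (measurable_itv _) mf f0).
apply: eq_integral => t /set_mem/=; rewrite in_itv/= => /andP[t0 ts].
have z0 : 0 < t `^ q by rewrite powR_gt0.
rewrite EFinM -(euler_integralE A0 AB z0).
have qV : 0 <= q^-1 by rewrite invr_ge0 ltW.
rewrite -(ge0_integralZl_total (measurable_itv _) qV (euler_integrand_ge0 _ _ _ _)
  (@measurable_euler_integrand _ _ _ _ _ setT)).
rewrite [RHS](@ge0_subst_powR_itv0y R _ q 1 ltr01); last 3 first.
- by rewrite gt_eqF.
- move=> y y0; apply: cvgM; first exact: cvg_cst.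
  apply: cvgM; first exact: powR_continuous.
  apply: cvgM.
    apply: (@continuous_powRf R (fun y => 1 + y)); first by rewrite addr_gt0.
    by apply: cvgD; [exact: cvg_cst|exact: cvg_id].
  apply: (@continuous_powRf R (fun y => 1 + t `^ q * y)); first by rewrite addr_gt0// mulr_gt0.
  apply: cvgD; first exact: cvg_cst.
  by apply: cvgM; [exact: cvg_cst|exact: cvg_id].
- by move=> y _; rewrite mulr_ge0 ?euler_integrand_ge0.
apply: eq_integral => x /set_mem/=; rewrite in_itv/= andbT => x0; congr EFin.
rewrite /f /euler_integrand !mul1r gtr0_norm// (powRM _ (ltW x0) (ltW t0)) -powRrM.
have -> : x `^ (alpha * q) = x `^ (q * (alpha + q^-1 - 1)) * x `^ (q - 1).
  by rewrite -(powRD_gt0 _ _ x0); congr (_ `^ _); field; rewrite gt_eqF.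
rewrite (mulrC (x `^ q) (t `^ q)).
by field; rewrite gt_eqF.
Qed.

(** By [connection_formula] and [is_derive_powR_hyp3F2] the integrand of
    [integral_arcsinh_pq_tonelli] has an explicit antiderivative, which vanishes at
    0 and is continuous up to [s]: when [s = 1] this is Abel's theorem, the two
    [3F2] converging absolutely at 1 because [beta + 1 / p < 2]. *)
Lemma integral_arcsinh_pq_beta p q alpha beta s : 1 < p -> 1 < q ->
  q * alpha > -1 -> q * (alpha - beta) - Num.min 1 (q / p) < -1 ->
  0 <= s <= 1 -> (forall n : nat, beta - alpha - 1 / q != n%:R) ->
  s < 1 \/ beta + 1 / p < 2 ->
  (\int[mu]_(x in `]0%R, +oo[)
     (arcsinh_pq p q (s * x) / (x `^ (1 - alpha * q) * (1 + x `^ q) `^ beta))%:E =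
   (s / q * Beta (alpha + 1 / q) (beta - alpha - 1 / q) *
      hyp3F2 (1 / p) (alpha + 1 / q) (1 / q)
             (alpha - beta + 1 / q + 1) (1 / q + 1) (s `^ q)
    + s `^ (q * (beta - alpha)) / (q ^+ 2 * (beta - alpha)) *
      Beta (alpha - beta + 1 / q) (beta - alpha + 1 / p - 1 / q) *
      hyp3F2 beta (beta - alpha + 1 / p - 1 / q) (beta - alpha)
             (beta - alpha - 1 / q + 1) (beta - alpha + 1) (s `^ q))%:E)%E.
Proof.
move=> p1 q1 qa qab s01 cn sb; have /andP[s0 s1] := s01.
have p0 : 0 < p by rewrite (lt_trans ltr01).
have q0 : 0 < q by rewrite (lt_trans ltr01).
have qn0 : q != 0 by rewrite gt_eqF.
have qV0 : 0 < q^-1 by rewrite invr_gt0.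
rewrite !div1r in cn sb *.
pose c := beta - alpha - q^-1; pose b := p^-1; pose A := alpha + q^-1.
pose d := beta - alpha.
have dE : d = c + q^-1 by rewrite /d /c; ring.
have A0 : 0 < A.
  rewrite /A -(pmulr_rgt0 _ q0) mulrDr divff//; lra.
have [qd1 qd2] : - q * d < 0 /\ - q * d + 1 < q / p.
  have m1 : Num.min 1 (q / p) <= 1 by rewrite ge_min lexx.
  have m2 : Num.min 1 (q / p) <= q / p by rewrite ge_min lexx orbT.
  have e : q * (alpha - beta) = - q * d by rewrite /d; ring.
  by rewrite e in qab; split; lra.
have d0 : 0 < d by rewrite -(pmulr_rgt0 _ q0); lra.
have cb0 : 0 < c + b.
  rewrite -(pmulr_rgt0 _ q0) /c /b -/d.
  have -> : q * (d - q^-1 + p^-1) = q * d - 1 + q / p by field; rewrite !gt_eqF.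
  lra.
have c1 : -1 < c.
  have : q^-1 < 1 by rewrite invf_lt1.
  rewrite /c -/d; lra.
have Ac : A + c = beta by rewrite /A /c; ring.
have Abb : A < beta + b by rewrite -Ac; lra.
rewrite !hyp3F2E -/(ps _ _) -/(ps _ _).
have -> : alpha - beta + q^-1 + 1 = 1 - c by rewrite /c; ring.
have -> : alpha - beta + q^-1 = - c by rewrite /c; ring.
have -> : beta - alpha + p^-1 - q^-1 = c + b by rewrite /c /b; ring.
have -> : beta - alpha - q^-1 + 1 = 1 + c by rewrite /c; ring.
rewrite -/c -/A -/d -/b.
set h1 := hyp3F2_coef b A q^-1 (1 - c) (q^-1 + 1).
set h2 := hyp3F2_coef beta (c + b) d (1 + c) (d + 1).
set B1 := Beta A c; set B2 := Beta (- c) (c + b).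
have ch1 : cvg_unit_disk h1 by exact: cvg_unit_disk_hyp3F2.
have ch2 : cvg_unit_disk h2 by exact: cvg_unit_disk_hyp3F2.
have [s0'|sn0] := eqVneq s 0.
  rewrite s0' (@powR0 R (q * d)) ?mulf_neq0 ?(gt_eqF d0)// !mul0r addr0.
  apply: integral0_eq => x _.
  by rewrite mul0r integral_arcsinh_pq set_itv_ge ?bnd_simp ?ltxx// integral_set0 mul0r.
have {sn0 s0}s0 : 0 < s by rewrite lt_neqAle eq_sym sn0.
rewrite (integral_arcsinh_pq_tonelli p1 q1 A0 Abb s0).
pose H t := B1 / q * (t `^ (q * q^-1) * ps h1 (t `^ q)) +
            B2 / (q ^+ 2 * d) * (t `^ (q * d) * ps h2 (t `^ q)).
have [u [v [uv u0 ucvg vs vcvg]]] := exhausts_itvoo s0.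
have [_ _ uvlt uvI _] := uv.
have v0 n : 0 < v n by rewrite (lt_trans (u0 n)).
have v1 n : v n < 1 by rewrite (lt_le_trans (vs n)).
have dG t : 0 < t < s -> has_derivative H t (q^-1 * euler_integral A beta b (t `^ q)).
  move=> /andP[t0 ts]; have t01 : 0 < t < 1 by rewrite t0 (lt_le_trans ts).
  have z01 : 0 < t `^ q < 1 by rewrite powR_gt0// powR_lt1.
  have D1 := is_derive_cstM (B1 / q) (is_derive_powR_hyp3F2 b A (1 - c) q0 qV0 t01).
  have D2 := is_derive_cstM (B2 / (q ^+ 2 * d)) (is_derive_powR_hyp3F2 beta (c + b) (1 + c) q0 d0 t01).
  have := is_derive_funD D1 D2; rewrite /has_derivative.
  set D := (X in is_derive _ _ _ X -> _) => HD.
  suff -> : q^-1 * euler_integral A beta b (t `^ q) = D by exact: HD.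
  rewrite /D -{1}Ac (connection_formula A0 c1 cn cb0 z01) Ac -/B1 -/B2.
  rewrite divff// subrr powRr0 -powRrM.
  have -> : q * d - 1 = q * c by rewrite dE; field.
  by field; rewrite !gt_eqF.
have cG t : 0 < t -> {for t, continuous (fun t => q^-1 * euler_integral A beta b (t `^ q))}.
  move=> t0; apply: cvgM; first exact: cvg_cst.
  have z0 : 0 < t `^ q by rewrite powR_gt0.
  apply: (@continuous_comp _ _ _ (fun t => t `^ q) (euler_integral A beta b)).
    exact: powR_continuous.
  exact: is_derive_continuous (is_derive_euler_integral A0 Abb z0).
have uq : u n `^ q @[n --> \oo] --> 0 by exact: powR_cvg0n.
have cvgH0 : H (u n) @[n --> \oo] --> 0.
  rewrite (_ : 0 = B1 / q * (0 * h1 0) + B2 / (q ^+ 2 * d) * (0 * h2 0)); last by ring.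
  apply: cvgD.
    apply: cvgM; first exact: cvg_cst.
    by apply: cvgM; [apply: powR_cvg0n => //; rewrite mulr_gt0|exact: ps_cvg0].
  apply: cvgM; first exact: cvg_cst.
  by apply: cvgM; [apply: powR_cvg0n => //; rewrite mulr_gt0|exact: ps_cvg0].
have sq : s `^ q < 1 \/ s `^ q = 1 /\ s = 1.
  move: s1; rewrite le_eqVlt => /predU1P[->|s1].
    by right; split => //; rewrite (congr1 (fun f => f q) (@powR1 R)).
  by left; rewrite powR_lt1// s0.
have left_cvg e : cvg_unit_disk e -> (beta + b < 2 -> cvgn [normed series e]) ->
    ps e (v n `^ q) @[n --> \oo] --> ps e (s `^ q).
  move=> ce ne; apply: ps_left_cvg => //.
  - case: sq => [|[sq1 s1']]; first by left.
    by right; split => //; case: sb => [|/ne//]; rewrite s1' ltxx.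
  - by move=> n; rewrite powR_ge0/= powR_lt// ltW.
  - by apply: (@cvg_comp _ _ _ v (@powR R ^~ q) _ _ _ vcvg); exact: powR_continuous.
have cvgHs : H (v n) @[n --> \oo] --> H s.
  have cp (r : R) : v n `^ r @[n --> \oo] --> s `^ r.
    by apply: (@cvg_comp _ _ _ v (@powR R ^~ r) _ _ _ vcvg); exact: powR_continuous.
  apply: cvgD.
    apply: cvgM; first exact: cvg_cst.
    apply: cvgM; first exact: cp.
    apply: left_cvg => // bb; rewrite -normed_pseries1.
    by apply: hyp3F2_coef_normed_cvg => //; right; split => //; rewrite -/b -Ac in bb *; lra.
  apply: cvgM; first exact: cvg_cst.
  apply: cvgM; first exact: cp.
  apply: left_cvg => // bb; rewrite -normed_pseries1.
  by apply: hyp3F2_coef_normed_cvg => //; right; split => //; lra.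
rewrite (@ge0_FTC_exhausts R _ u v _ H 0 (H s) uv).
- rewrite subr0 /H divff// powRr1 ?(ltW s0)//; congr EFin.
  by field; rewrite !gt_eqF.
- by move=> t /=; rewrite in_itv/=; exact: dG.
- by move=> t /=; rewrite in_itv/= => /andP[t0 _]; exact: cG.
- exact: cvgH0.
- exact: cvgHs.
- apply: open_continuous_measurable_fun; first exact: itv_open.
  by move=> t /set_mem/=; rewrite in_itv/= => /andP[t0 _]; exact: cG.
- move=> t _; rewrite mulr_ge0 ?(ltW qV0)//.
  by apply: Rintegral_ge0 => y _; exact: euler_integrand_ge0.
Qed.

End weighted_arcsinh.

Unset Implicit Arguments.

Theorem theorem5 (R : realType) (p q alpha beta s : R)
    (hp : 1 < p) (hq : 1 < q) :
  [/\ (alpha < 2 -> beta < 1 -> 0 <= s <= 1 ->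
       (\int[lebesgue_measure]_(x in `]0%R, 1%R[)
          (arcsin_pq p q (s * x) /
             (x `^ alpha * (1 - x `^ q) `^ beta))%:E)%E
       = (s / q * Beta ((2 - alpha) / q) (1 - beta) *
          hyp3F2 (1 / p) ((2 - alpha) / q) (1 / q)
                 ((2 - alpha) / q + 1 - beta) (1 / q + 1) (s `^ q))%:E),
      (alpha < 1 -> beta < 1 -> 0 <= s <= 1 ->
       (\int[lebesgue_measure]_(x in `]0%R, 1%R[)
          (arccos_pq p q (s * x) /
             (x `^ alpha * (1 - x `^ p) `^ beta))%:E)%E
       = (1 / (p * q) * Beta ((p - 1) / p) (1 / q) *
            Beta ((1 - alpha) / p) (1 - beta)
          - s `^ (p - 1) / (q * (p - 1)) * Beta (1 - alpha / p) (1 - beta) *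
            hyp3F2 (1 - 1 / q) (1 - alpha / p) ((p - 1) / p)
                   (2 - alpha / p - beta) ((2 * p - 1) / p) (s `^ p))%:E),
      (q * alpha > -1 ->
       q * (alpha - beta) - Num.min 1 (q / p) < -1 ->
       0 <= s <= 1 ->
       (forall n : nat, beta - alpha - 1 / q != n%:R) ->
       s < 1 \/ beta + 1 / p < 2 ->
       (\int[lebesgue_measure]_(x in `]0%R, +oo[)
          (arcsinh_pq p q (s * x) /
             (x `^ (1 - alpha * q) * (1 + x `^ q) `^ beta))%:E)%E
       = (s / q * Beta (alpha + 1 / q) (beta - alpha - 1 / q) *
            hyp3F2 (1 / p) (alpha + 1 / q) (1 / q)
                   (alpha - beta + 1 / q + 1) (1 / q + 1) (s `^ q)
          + s `^ (q * (beta - alpha)) / (q ^+ 2 * (beta - alpha)) *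
            Beta (alpha - beta + 1 / q) (beta - alpha + 1 / p - 1 / q) *
            hyp3F2 beta (beta - alpha + 1 / p - 1 / q) (beta - alpha)
                   (beta - alpha - 1 / q + 1) (beta - alpha + 1)
                   (s `^ q))%:E)
    & (p < q -> 1 <= s -> beta < 1 -> (alpha + beta) * p > 1 ->
       (\int[lebesgue_measure]_(x in `]1%R, +oo[)
          (arccosh_pq p q (s * x) /
             (x `^ (alpha * p) * (x `^ p - 1) `^ beta))%:E)%E
       = (1 / (p * q) * Beta (1 / p - 1 / q) (1 / q) *
            Beta (1 - beta) (beta + alpha - 1 / p)
          + s `^ (p / q - 1) / (p - q) * Beta (beta + alpha - 1 / q) (1 - beta) *
            hyp3F2 (1 - 1 / q) (beta + alpha - 1 / q) (1 / p - 1 / q)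
                   (alpha + 1 - 1 / q) (1 / p - 1 / q + 1) (s `^ (- p)))%:E)].
Proof.
split.
- exact: integral_arcsin_pq_beta.
- exact: integral_arccos_pq_beta.
- exact: integral_arcsinh_pq_beta.
- exact: integral_arccosh_pq_beta.
Qed.
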